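(* Let $\gamma>0$ be an absolute constant and $d\ge n^\gamma$. Suppose that $\mathbf G\sim\mathsf{RGG}(n,\mathbb S^{d-1},1/2)$ (equivalently $\mathbf G\sim\mathsf{RGG}(n,\mathcal N(0,\frac1dI_d),\frac12)$). - If $d\le n(\log n)^8$, then with high probability $|\lambda_2(\mathbf G)|\le n(\log n)^{10}/\sqrt d$. - If $d\ge n(\log n)^8$, then with high probability $|\lambda_2(\mathbf G)|\le(\log n)^{10}\sqrt n$.
   Context: $\mathsf{RGG}(n,\mathbb S^{d-1},1/2)$: draw $V_1,\dots,V_n$ i.i.d. uniform on the unit sphere $\mathbb S^{d-1}\subset\mathbb R^d$; $i\ne j$ are adjacent iff $\langle V_i,V_j\rangle\ge0$. $\mathsf{RGG}(n,\mathcal N(0,\frac1dI_d),\frac12)$: the same with i.i.d. vectors $Z_i\sim\mathcal N(0,\frac1dI_d)$ and threshold $\langle Z_i,Z_j\rangle\ge0$. $\lambda_2(\mathbf G)$ denotes the second largest eigenvalue of the adjacency matrix of $\mathbf G$ (eigenvalues listed in decreasing order). ''With high probability'' means with probability tending to $1$ as $n\to\infty$. *)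

(* Defs.v *)
From HB Require Import structures.
From mathcomp Require Import all_boot all_order all_algebra.
From mathcomp Require Import complex.
From mathcomp Require Import all_classical all_reals all_analysis.

Set Implicit Arguments.
Unset Strict Implicit.
Unset Printing Implicit Defensive.

Import Order.TTheory GRing.Theory Num.Theory.
Import numFieldNormedType.Exports.

Local Open Scope classical_set_scope.
Local Open Scope ring_scope.

Lemma char_poly_sym_split (R : rcfType) n (A : 'M[R]_n) : A^T = A ->
  exists s : seq R, char_poly A = \prod_(x <- s) ('X - x%:P).
Proof.
move=> sA; pose toC : {rmorphism R -> R[i]} := real_complex R.
pose B := map_mx toC A.
have realB : B \is a realmx.
  apply/mxOverP => i j; rewrite mxE; apply/CrealP.
  exact: conjc_real.
have hB : B \is hermsymmx.
  apply: realsym_hermsym => //; apply/is_hermitianmxP.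
  by rewrite expr0 scale1r map_mx_id // /B -{1}sA map_trmx.
have /hermitian_normalmx/orthomx_spectralP BE := hB.
have /mxOverP realD := @hermitian_spectral_diag_real _ n B hB.
set Q := spectralmx B in BE; set D := spectral_diag B in BE realD.
have Qu : Q \in unitmx by exact: spectral_unit.
have charBE : char_poly B = char_poly (diag_mx D).
  have PQ : map_mx polyC (invmx Q) *m map_mx polyC Q = 1%:M.
    by rewrite -map_mxM mulVmx // map_mx1.
  rewrite /char_poly /char_poly_mx BE !map_mxM.
  rewrite -[X in \det (X - _)]mulmx1 -PQ mulmxA -(scalar_mxC 'X).
  rewrite -mulmxBl -mulmxBr !det_mulmx mulrAC -det_mulmx.
  by rewrite PQ det1 mul1r.
pose r i := complex.Re (D 0 i).
exists [seq r i | i <- index_enum 'I_n].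
apply: (map_poly_inj toC); rewrite map_char_poly -/B charBE.
rewrite char_poly_trig ?diag_mx_is_trig // rmorph_prod big_map.
apply: eq_bigr => i _; rewrite rmorphB /= map_polyX map_polyC; congr ('X - _%:P).
by rewrite !mxE eqxx mulr1n /toC /r /=; symmetry; apply/RRe_real/realD.
Qed.

Section Spectrum.
Variables (R : realType) (n : nat).
Implicit Types (A : 'M[R]_n) (s : seq R).

(* The eigenvalues of A, listed in decreasing order with algebraic
   multiplicity: the unique such list when the characteristic polynomial of A
   splits over R (see eigenvaluesP for symmetric matrices), and the empty list
   otherwise. *)
Definition is_spectrum A s : Prop :=
  sorted >=%R s /\ char_poly A = \prod_(x <- s) ('X - x%:P).

Definition eigenvalues A : seq R := xget [::] [set s | is_spectrum A s].

(* The entries are indexed from 0; lambda2 A is 0 when n < 2. *)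
Definition lambda2 A : R := nth 0 (eigenvalues A) 1.

Lemma is_spectrum_unique A s t : is_spectrum A s -> is_spectrum A t -> s = t.
Proof.
move=> [ss sE] [ts tE]; apply: (@sorted_eq _ >=%R) => //.
- by move=> x y z /= yx zx; apply: le_trans zx yx.
- by move=> x y /=; rewrite andbC; apply: le_anti.
by apply: prod_XsubC_eq; rewrite -sE -tE.
Qed.

Lemma eigenvaluesP A : A^T = A -> is_spectrum A (eigenvalues A).
Proof.
move=> sA; have [s sE] := char_poly_sym_split sA.
suff : [set s | is_spectrum A s] (sort >=%R s) by move=> h; apply: xgetI h.
split; first by apply: sort_sorted => x y /=; exact: le_total.
by rewrite sE; apply: perm_big; rewrite perm_sym perm_sort.
Qed.

Lemma size_eigenvalues A : A^T = A -> size (eigenvalues A) = n.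
Proof.
move=> /eigenvaluesP[_ /(congr1 (fun p : {poly R} => size p))].
by rewrite size_char_poly size_prod_XsubC => -[].
Qed.

End Spectrum.

Section GeometricGraph.
Variables (R : realType) (n d : nat).

Definition dotp (u v : d.-tuple R) : R := \sum_(k < d) tnth u k * tnth v k.

Definition rgg_adj (v : 'I_n -> d.-tuple R) : rel 'I_n :=
  fun i j => (i != j) && (0 <= dotp (v i) (v j)).

Definition adjacency (e : rel 'I_n) : 'M[R]_n := \matrix_(i, j) (e i j)%:R.

Lemma adjacency_rgg_sym v : (adjacency (rgg_adj v))^T = adjacency (rgg_adj v).
Proof.
apply/matrixP => i j; rewrite !mxE /rgg_adj eq_sym; congr ((_ && (0 <= _))%:R).
by apply: eq_bigr => k _; rewrite mulrC.
Qed.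

End GeometricGraph.

Section Laws.
Variables (R : realType) (d : nat).
Local Open Scope ereal_scope.

(* Matrix-vector product, on the measurable type of d-tuples. *)
Definition mulmx_tuple (O : 'M[R]_d) (v : d.-tuple R) : d.-tuple R :=
  [tuple (\sum_(l < d) O k l * tnth v l)%R | k < d].

(* The uniform law on the unit sphere is the unique Borel probability on R^d
   that is carried by the sphere and invariant under the orthogonal group. *)
Definition uniform_sphere_law (mu : set (d.-tuple R) -> \bar R) : Prop :=
  mu [set v | dotp v v = 1%R] = 1 /\
  forall O : 'M[R]_d, (O *m O^T = 1%:M)%R ->
  forall A, measurable A -> mu (mulmx_tuple O @^-1` A) = mu A.

(* N(0, I_d / d) is the product of d copies of N(0, 1/d); the second
   parameter of normal_prob is the standard deviation. *)
Definition gaussian_law (mu : set (d.-tuple R) -> \bar R) : Prop :=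
  forall A : 'I_d -> set R, (forall k, measurable (A k)) ->
  mu [set v | forall k, A k (tnth v k)] =
  \prod_(k < d) normal_prob 0%R (Num.sqrt d%:R)^-1%R (A k).

End Laws.

Section IID.
Variables (R : realType) (disp disp' : measure_display).
Variables (T : measurableType disp) (E : measurableType disp').
Variables (P : probability T R) (n : nat).
Local Open Scope ereal_scope.

(* The product rule for subfamilies is the case A i = setT for some i. *)
Definition independent (X : 'I_n -> {RV P >-> E}) : Prop :=
  forall A : 'I_n -> set E, (forall i, measurable (A i)) ->
  P [set w | forall i, A i (X i w)] = \prod_(i < n) P (X i @^-1` A i).

Definition iid (law : (set E -> \bar R) -> Prop) (X : 'I_n -> {RV P >-> E}) :
    Prop :=
  independent X /\ forall i, law (distribution P (X i)).

End IID.

(* The graphs RGG(n, S^(d-1), 1/2) and RGG(n, N(0, I_d / d), 1/2) are both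
   rgg_adj of a random family of vectors; only the law of the family differs. *)
Section RGG.
Variables (R : realType) (disp : measure_display) (T : measurableType disp).
Variables (P : probability T R) (n d : nat).

Definition rgg_sphere (V : 'I_n -> {RV P >-> d.-tuple R}) : Prop :=
  iid (@uniform_sphere_law R d) V.

Definition rgg_gaussian (V : 'I_n -> {RV P >-> d.-tuple R}) : Prop :=
  iid (@gaussian_law R d) V.

Definition rgg_lambda2 (V : 'I_n -> {RV P >-> d.-tuple R}) (w : T) : R :=
  lambda2 (adjacency R (rgg_adj (fun i => V i w))).

End RGG.

Definition whp (R : realType) (disp : nat -> measure_display)
    (T : forall n, measurableType (disp n)) (P : forall n, probability (T n) R)
    (E : forall n, set (T n)) : Prop :=
  P n (E n) @[n --> \oo] --> 1%E.

(* Main.v *)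
From HB Require Import structures.
Require Import Defs.
From mathcomp Require Import all_boot all_order all_algebra.
From mathcomp Require Import all_classical all_reals all_analysis.
From mathcomp Require Import measurable_realfun complex.
From mathcomp Require Import ring lra.
Import Order.TTheory GRing.Theory Num.Theory.
Import numFieldNormedType.Exports.
Set Implicit Arguments. Unset Strict Implicit. Unset Printing Implicit Defensive.
Local Open Scope classical_set_scope.
Local Open Scope ring_scope.


(** Write [M] for the matrix of the signs of the inner products [<V_i, V_j>], with zero
    diagonal, and [J] for the all-ones matrix. Almost surely no inner product vanishes,
    and then the adjacency matrix is [A = (J - 1 + M) / 2]. The rank-one matrix [J]
    affects one direction only, so [lambda2 A] is at most [(1 + |M|) / 2] in absolute
    value ([lambda2_abs_le], [lambda2_rgg_le]), and it remains to bound the operator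
    norm [|M|].

    The rows of [M] are dependent. The form of [M] at a vector is four times the average,
    over the subsets [I] of the indices, of the form of the block with rows in [I] and
    columns outside [I] ([cut_average]). Hence its power of exponent [2 p] is bounded by
    the average over [I] of the moments [tr (S ^+ p)], where [S] is the sum over [i] in
    [I] of [s_i s_i^T] and [s_i] is the row of [i] in the block ([sign_form_moment]).
    Given the vectors outside [I], the rows [s_i] are independent, with square norms at
    most [n].

    For such sums of independent rank-one matrices [r_i r_i^T] of size [m], with square
    norms at most [b] and covariances at most [Lam], a matrix Chernoff bound holds in
    moment form: [E tr (sum r_i r_i^T) ^+ p <= m (p b + n Lam) ^+ p]
    ([chernoff_moment]). It is proved by induction on the power, replacing one
    [r_i r_i^T] by the scalar matrix [b], which no longer depends on [r_i]. The
    replacement is licit because the moments of a positive semidefinite matrix at a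
    vector form a log-convex sequence ([rank1_update]).

    The covariance of [s_i] has the entries [E sg <x, V_j> sg <x, V_k>]. The correlation
    of two signs is an affine function of the angle, being bounded and additive
    ([sgK_plane]). It is therefore [2 / pi] times the arcsine of the cosine [g] of the
    angle, that is [(2 / pi) g] up to [g ^+ 2] ([sgK_linear_approx]). As the rows of the
    Gram matrix [G] of the directions [V_j / |V_j|] have square norms at most [|G|], the
    covariance of [s_i] is at most [2 |G|] ([correlation_bound]). Finally [G] has the
    nonzero spectrum of a sum of rank-one matrices of size [d], of norm at most [1] and
    covariance [1 / d]: the Chernoff bound applies again and gives
    [E tr (G ^+ p) <= n (p + n / d) ^+ p] ([gram_moment]). Together these yield
    [E tr (S ^+ p) <= n ^+ 2 (8 n (p + n / d)) ^+ p] ([sign_moment]).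

    Markov's inequality with [p] close to [ln n] concludes ([lambda2_probability]): the
    powers of [ln n] in the two bounds make the error at most [1 / n].

    The only property of the law of the vectors that is used is [rotation_invariant]:
    it has no atom at the origin, and it is invariant under the rotations of the planes
    of two coordinates. For the sphere this is a case of orthogonal invariance; for the
    Gaussian law it reduces to the plane, where it follows from the rotation invariance
    of Lebesgue measure. *)

(** * Log-convex sequences *)

Section LogConvex.
Variables (R : realFieldType) (f : nat -> R).
Hypotheses (f0 : forall m, 0 <= f m)
  (fconv : forall m, f m.+1 ^+ 2 <= f m * f m.+2).

(** The ratios of consecutive terms of a log-convex sequence increase. The
  statement is division-free, since terms may vanish. *)
Lemma logconvex_ratio a k : f a.+1 * f (a + k)%N <= f a * f (a + k).+1.
Proof.
elim: k => [|k IH]; first by rewrite addn0 mulrC.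
rewrite addnS; have := f0 (a + k); rewrite le_eqVlt => /orP[/eqP fb|fb].
  have := fconv (a + k); rewrite -fb mul0r => h.
  have /eqP -> : f (a + k).+1 == 0 by rewrite -sqrf_eq0 eq_le h sqr_ge0.
  by rewrite mulr0 mulr_ge0.
rewrite -(ler_pM2l fb) mulrCA [f (a + k)%N * (_ * _)]mulrCA.
apply: le_trans (ler_wpM2l (f0 a) (fconv (a + k))).
by rewrite expr2 mulrA mulrA ler_wpM2r.
Qed.

Lemma logconvex_mul a b : f a * f b <= f 0%N * f (a + b)%N.
Proof.
wlog ab : a b / (a <= b)%N => [W|].
  by case/orP: (leq_total a b) => h; [exact: W|rewrite mulrC addnC; exact: W].
elim: a b ab => [//|a IH] b ab.
have := logconvex_ratio a (b - a); rewrite subnKC ?(ltnW ab)// => /le_trans; apply.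
by rewrite addSnnS; apply: IH; apply: (leq_trans (ltnW ab)).
Qed.

Lemma logconvex_pow m : f 1%N ^+ m.+1 <= f 0%N ^+ m * f m.+1.
Proof.
elim: m => [|m IH]; first by rewrite expr0 mul1r expr1.
rewrite exprS; apply: (le_trans (ler_wpM2l (f0 1) IH)).
rewrite mulrCA exprSr -mulrA ler_wpM2l ?exprn_ge0//.
exact: (logconvex_mul 1 m.+1).
Qed.
End LogConvex.

(** The power sums of nonnegative numbers form a log-convex sequence. *)
Lemma power_mean (R : realFieldType) (I : finType) (x : I -> R) m :
  (forall i, 0 <= x i) ->
  (\sum_i x i) ^+ m.+1 <= #|I|%:R ^+ m * \sum_i x i ^+ m.+1.
Proof.
move=> x0; pose f k := \sum_i x i ^+ k.
have cI : f 0%N = #|I|%:R.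
  by rewrite /f (eq_bigr (fun=> 1)) ?sumr_const// => i _; rewrite expr0.
rewrite -cI; have -> : \sum_i x i = f 1%N by apply: eq_bigr => i _; rewrite expr1.
apply: logconvex_pow => [k|k]; first by apply: sumr_ge0 => i _; rewrite exprn_ge0.
rewrite /f expr2 !big_distrlr /= -subr_ge0.
set A := \sum_i _; set B := \sum_i _.
have -> : A - B = 2%:R^-1 * \sum_i \sum_j x i ^+ k * x j ^+ k * (x i - x j) ^+ 2.
  have E : \sum_i \sum_j x i ^+ k * x j ^+ k * (x i - x j) ^+ 2 =
     A + A - (B + B).
    have AE : A = \sum_i \sum_j x i ^+ k.+2 * x j ^+ k.
      rewrite /A exchange_big /=; apply: eq_bigr => i _; apply: eq_bigr => j _.
      exact: mulrC.
    rewrite {2}AE /A /B -!big_split -sumrB /=.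
    apply: eq_bigr => i _; rewrite -!big_split -sumrB /=; apply: eq_bigr => j _.
    by rewrite !exprS; ring.
  by rewrite E; field.
apply: mulr_ge0; first by rewrite invr_ge0 ler0n.
apply: sumr_ge0 => i _; apply: sumr_ge0 => j _.
by apply: mulr_ge0; [apply: mulr_ge0; apply: exprn_ge0|exact: sqr_ge0].
Qed.

(** * Positive semidefinite matrices *)

Section Psd.
Variable R : rcfType.

(** The inner product of column vectors. *)
Definition dot n (u v : 'cV[R]_n) : R := (u^T *m v) 0 0.

Lemma dotE n (u v : 'cV[R]_n) : dot u v = \sum_i u i 0 * v i 0.
Proof. by rewrite /dot mxE; apply: eq_bigr => i _; rewrite mxE. Qed.

Lemma dotC n (u v : 'cV[R]_n) : dot u v = dot v u.
Proof. by rewrite !dotE; apply: eq_bigr => i _; rewrite mulrC. Qed.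

Lemma dot_ge0 n (u : 'cV[R]_n) : 0 <= dot u u.
Proof. by rewrite dotE; apply: sumr_ge0 => i _; rewrite -expr2 sqr_ge0. Qed.

Lemma dotDr n (u v w : 'cV[R]_n) : dot u (v + w) = dot u v + dot u w.
Proof. by rewrite /dot mulmxDr mxE. Qed.

Lemma dotZr n a (u v : 'cV[R]_n) : dot u (a *: v) = a * dot u v.
Proof. by rewrite /dot -scalemxAr mxE. Qed.

Lemma dot_adj m n (A : 'M[R]_(m, n)) u v : dot u (A *m v) = dot (A^T *m u) v.
Proof. by rewrite /dot trmx_mul trmxK mulmxA. Qed.

Lemma dot_eq0 n (u : 'cV[R]_n) : (dot u u == 0) = (u == 0).
Proof.
apply/idP/eqP => [|->]; last by rewrite dotE big1 // => i _; rewrite mxE mul0r.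
rewrite dotE psumr_eq0 => [/allP h|i _]; last by rewrite -expr2 sqr_ge0.
apply/matrixP => i j; rewrite !mxE ord1.
by have := h i (mem_index_enum _); rewrite mulf_eq0 orbb => /eqP.
Qed.

Lemma cauchy_schwarz n (u v : 'cV[R]_n) : dot u v ^+ 2 <= dot u u * dot v v.
Proof.
have [->|u0] := eqVneq u 0.
  have d0 w : dot (0 : 'cV[R]_n) w = 0.
    by rewrite dotE big1 // => i _; rewrite mxE mul0r.
  by rewrite !d0 mul0r expr0n.
have uu : 0 < dot u u by rewrite lt_neqAle eq_sym dot_eq0 u0 dot_ge0.
have := dot_ge0 (dot u u *: v + (- dot u v) *: u).
rewrite dotDr !dotZr ![dot (_ + _) _]dotC !dotDr !dotZr [dot v u]dotC => h.
rewrite -subr_ge0 -(pmulr_rge0 _ uu); apply: le_trans h _.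
by rewrite le_eqVlt; apply/orP; left; apply/eqP; ring.
Qed.

(** Positive semidefinite matrices, given by a factorization. *)
Definition psd n (A : 'M[R]_n) : Prop :=
  exists m, exists B : 'M[R]_(n, m), A = B *m B^T.

Lemma psd_sym n (A : 'M[R]_n) : psd A -> A^T = A.
Proof. by case=> m [B ->]; rewrite trmx_mul trmxK. Qed.

Lemma psd_dot n (A : 'M[R]_n) : psd A -> exists m, exists B : 'M[R]_(n, m),
  forall u v, dot u (A *m v) = dot (B^T *m u) (B^T *m v).
Proof. by case=> m [B ->]; exists m, B => u v; rewrite -mulmxA dot_adj. Qed.

Lemma psd_ge0 n (A : 'M[R]_n) u : psd A -> 0 <= dot u (A *m u).
Proof. by move=> /psd_dot[m [B ->]]; exact: dot_ge0. Qed.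

Lemma psd_cauchy_schwarz n (A : 'M[R]_n) u v : psd A ->
  dot u (A *m v) ^+ 2 <= dot u (A *m u) * dot v (A *m v).
Proof. by move=> /psd_dot[m [B E]]; rewrite !E; exact: cauchy_schwarz. Qed.

Lemma psd_scalar n (K : R) : 0 <= K -> psd (K%:M : 'M[R]_n).
Proof.
move=> K0; exists n, (Num.sqrt K)%:M.
by rewrite tr_scalar_mx -scalar_mxM -expr2 sqr_sqrtr.
Qed.

Lemma psd0 n : psd (0 : 'M[R]_n).
Proof. by exists n, 0; rewrite mul0mx. Qed.

Lemma psdD n (A B : 'M[R]_n) : psd A -> psd B -> psd (A + B).
Proof.
move=> [m [C ->]] [k [D ->]]; exists (m + k)%N, (row_mx C D).
by rewrite tr_row_mx mul_row_col.
Qed.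

Lemma psd_rank1 n (r : 'cV[R]_n) : psd (r *m r^T).
Proof. by exists 1%N, r. Qed.

Lemma psd_sum n (I : Type) (s : seq I) (P : pred I) (A : I -> 'M[R]_n) :
  (forall i, psd (A i)) -> psd (\sum_(i <- s | P i) A i).
Proof. by move=> h; elim/big_ind: _ => //; [exact: psd0|exact: psdD]. Qed.

Lemma trmxX n (A : 'M[R]_n) q : (A ^+ q)^T = A^T ^+ q.
Proof.
elim: q => [|q IH]; first by rewrite !expr0 trmx1.
by rewrite exprS trmx_mul IH exprSr.
Qed.

Lemma psdX n (A : 'M[R]_n) q : psd A -> psd (A ^+ q).
Proof.
move=> pA; have sA := psd_sym pA.
rewrite -(odd_double_half q) -addnn addnA exprD.
case: (odd q) => /=; last by exists n, (A ^+ q./2); rewrite trmxX sA.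
case: pA => m [B AE]; exists m, (A ^+ q./2 *m B).
rewrite trmx_mul trmxX sA mulmxA -(mulmxA _ B) -AE.
by congr (_ *m _); rewrite add1n exprSr.
Qed.

Lemma psd_moment_ge0 n (A : 'M[R]_n) u m : psd A -> 0 <= dot u (A ^+ m *m u).
Proof. by move=> pA; apply/psd_ge0/psdX. Qed.

(** The moments of the spectral measure of [A] at [u] are log-convex. *)
Lemma psd_moment_logconvex n (A : 'M[R]_n) u m : psd A ->
  dot u (A ^+ m.+1 *m u) ^+ 2 <=
  dot u (A ^+ m *m u) * dot u (A ^+ m.+2 *m u).
Proof.
move=> pA; have sA := psd_sym pA.
have -> : dot u (A ^+ m.+1 *m u) = dot u (A ^+ m *m (A *m u)).
  by rewrite mulmxA; congr (dot _ (_ *m _)); rewrite exprSr.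
have -> : dot u (A ^+ m.+2 *m u) = dot (A *m u) (A ^+ m *m (A *m u)).
  rewrite -[in dot (A *m u)]sA -dot_adj !mulmxA; congr (dot _ (_ *m _)).
  by rewrite exprS exprSr mulrA.
exact/psd_cauchy_schwarz/psdX.
Qed.

Lemma psd_moment_mul n (A : 'M[R]_n) u a b : psd A ->
  dot u (A ^+ a *m u) * dot u (A ^+ b *m u) <=
  dot u u * dot u (A ^+ (a + b) *m u).
Proof.
move=> pA.
have := @logconvex_mul _ (fun k => dot u (A ^+ k *m u)) _ _ a b.
rewrite expr0 mul1mx; apply=> m; first exact: psd_moment_ge0.
exact: psd_moment_logconvex.
Qed.

Lemma psd_moment_pow n (A : 'M[R]_n) u m : psd A ->
  dot u (A *m u) ^+ m.+1 <= dot u u ^+ m * dot u (A ^+ m.+1 *m u).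
Proof.
move=> pA.
have := @logconvex_pow _ (fun k => dot u (A ^+ k *m u)) _ _ m.
rewrite expr0 mul1mx expr1; apply=> k; first exact: psd_moment_ge0.
exact: psd_moment_logconvex.
Qed.

(** The comparison driving the moment method: inside the quadratic form of [r],
  the rank-one perturbation [r r^T] may be replaced by the scalar [b >= |r|^2],
  which commutes with [T]. *)
Lemma rank1_update n (T : 'M[R]_n) r b q : psd T -> dot r r <= b ->
  dot r ((T + r *m r^T) ^+ q *m r) <= dot r ((T + b%:M) ^+ q *m r).
Proof.
move=> pT rb.
(* The moments G, H with the perturbed and the shifted matrix obey the recursions
   GS and HS; the term f a * G 0 of the former is at most b * H a. *)
pose G a q := dot r (T ^+ a *m ((T + r *m r^T) ^+ q *m r)).
pose H a q := dot r (T ^+ a *m ((T + b%:M) ^+ q *m r)).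
pose f a := dot r (T ^+ a *m r).
have b0 : 0 <= b by exact: le_trans (dot_ge0 r) rb.
have GS a k : G a k.+1 = G a.+1 k + f a * G 0%N k.
  rewrite /G exprS mulrDl !mulmxDl mulmxDr dotDr; congr (_ + _).
    by rewrite !mulmxA exprSr.
  rewrite expr0 mul1mx -[r *m r^T * _]/(r *m r^T *m _) -!mulmxA.
  rewrite [r^T *m _]mx11_scalar mul_mx_scalar -scalemxAr dotZr mulrC.
  by rewrite -[(r^T *m _) 0 0]/(dot _ _).
have HS a k : H a k.+1 = H a.+1 k + b * H a k.
  rewrite /H exprS mulrDl !mulmxDl mulmxDr dotDr; congr (_ + _).
    by rewrite !mulmxA exprSr.
  rewrite -[b%:M * _]/(b%:M *m _) mul_scalar_mx -scalemxAl -scalemxAr.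
  by rewrite dotZr.
have H0 k a : 0 <= H a k.
  elim: k a => [|k IH] a; last by rewrite HS addr_ge0 ?mulr_ge0.
  by rewrite /H expr0 mul1mx psd_moment_ge0.
have fH k a c : f a * H c k <= dot r r * H (a + c)%N k.
  elim: k c => [|k IH] c; first by rewrite /H !expr0 !mul1mx psd_moment_mul.
  rewrite !HS !mulrDr lerD // -?addnS // mulrCA [dot r r * _]mulrCA.
  exact: ler_wpM2l.
have GH k a : G a k <= H a k.
  elim: k a => [|k IH] a; first by rewrite /G /H !expr0.
  rewrite GS HS lerD //; apply: (@le_trans _ _ (f a * H 0%N k)).
    by rewrite ler_wpM2l // psd_moment_ge0.
  apply: le_trans (fH k a 0%N) _; rewrite addn0.
  exact: ler_wpM2r.
by have := GH q 0%N; rewrite /G /H expr0 !mul1mx.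
Qed.

Lemma mxtrace_rank1 n (A : 'M[R]_n) (r : 'cV[R]_n) :
  \tr (r *m r^T *m A) = dot r (A *m r).
Proof.
by rewrite -mulmxA mxtrace_mulC /mxtrace big_ord1 /dot mulmxA.
Qed.

Lemma psd_tr_ge0 n (A : 'M[R]_n) : psd A -> 0 <= \tr A.
Proof.
case=> m [B ->]; apply: sumr_ge0 => i _; rewrite mxE.
by apply: sumr_ge0 => j _; rewrite !mxE -expr2 sqr_ge0.
Qed.

(** The trace dominates the largest eigenvalue. *)
Lemma psd_le_tr n (A : 'M[R]_n) u : psd A -> dot u (A *m u) <= \tr A * dot u u.
Proof.
case=> m [B ->]; rewrite -mulmxA dot_adj dotE mxtrace_mulC {1}/mxtrace mulr_suml.
apply: ler_sum => j _; rewrite -expr2.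
have -> : (B^T *m u) j 0 = dot (col j B) u.
  by rewrite mxE dotE; apply: eq_bigr => i _; rewrite !mxE.
apply: le_trans (cauchy_schwarz _ _) _; apply: ler_wpM2r; first exact: dot_ge0.
by rewrite dotE mxE; apply: ler_sum => i _; rewrite !mxE.
Qed.

(** The trace of [A ^+ p] dominates the p-th power of the operator norm of [A]. *)
Lemma psd_pow_le_tr n (A : 'M[R]_n) u p : psd A -> (0 < p)%N ->
  dot u (A *m u) ^+ p <= dot u u ^+ p * \tr (A ^+ p).
Proof.
case: p => // m pA _; apply: le_trans (psd_moment_pow u m pA) _.
rewrite [dot u u ^+ m.+1]exprSr -mulrA ler_wpM2l ?exprn_ge0 ?dot_ge0 // mulrC.
exact/psd_le_tr/psdX.
Qed.

(** [Tr (A L) <= lam Tr A] as soon as [L <= lam] in the semidefinite order. *)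
Lemma psd_tr_mul n (A L : 'M[R]_n) lam : psd A ->
  (forall c, dot c (L *m c) <= lam * dot c c) -> \tr (A *m L) <= lam * \tr A.
Proof.
case=> m [B ->] hL; rewrite -mulmxA mxtrace_mulC -mulmxA [\tr (B *m B^T)]mxtrace_mulC.
rewrite /mxtrace mulr_sumr; apply: ler_sum => j _.
have E (C : 'M[R]_n) : (B^T *m (C *m B)) j j = dot (col j B) (C *m col j B).
  rewrite mxE dotE; apply: eq_bigr => i _; rewrite !mxE; congr (_ * _).
  by apply: eq_bigr => k _; rewrite !mxE.
have E1 : (B^T *m B) j j = dot (col j B) (col j B).
  by have := E 1%:M; rewrite !mul1mx.
by rewrite E1 E.
Qed.

Lemma mxtrace_gramX m n (W : 'M[R]_(m, n)) p : (0 < p)%N ->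
  \tr ((W *m W^T) ^+ p) = \tr ((W^T *m W) ^+ p).
Proof.
case: p => // p _.
have -> : (W *m W^T) ^+ p.+1 = W *m (W^T *m W) ^+ p *m W^T.
  elim: p => [|p IH]; first by rewrite expr1 expr0 mulmx1.
  rewrite exprS {}IH exprS -[_ * (_ *m _ *m _)]/(_ *m _).
  by rewrite -[_ * _ ^+ p]/(_ *m _) !mulmxA.
by rewrite mxtrace_mulC mulmxA exprS.
Qed.

End Psd.

(** * The second eigenvalue of a real symmetric matrix *)

Section ComplexForm.
Variable R : realType.

Lemma complexReD (x y : R[i]) : complex.Re (x + y) = complex.Re x + complex.Re y.
Proof. by case: x; case: y. Qed.

Lemma complexRe_sum (I : Type) (s : seq I) (F : I -> R[i]) :
  complex.Re (\sum_(i <- s) F i) = \sum_(i <- s) complex.Re (F i).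
Proof. exact: (big_morph _ complexReD). Qed.

(** The standard Hermitian form on complex row vectors. *)
Definition herm n (z w : 'rV[R[i]]_n) : R[i] := \sum_k z 0 k * (w 0 k)^*.

Lemma hermDl n (z1 z2 w : 'rV[R[i]]_n) : herm (z1 + z2) w = herm z1 w + herm z2 w.
Proof. by rewrite /herm -big_split; apply: eq_bigr => k _; rewrite mxE mulrDl. Qed.

Lemma hermDr n (z w1 w2 : 'rV[R[i]]_n) : herm z (w1 + w2) = herm z w1 + herm z w2.
Proof.
by rewrite /herm -big_split; apply: eq_bigr => k _; rewrite mxE rmorphD mulrDr.
Qed.

Lemma hermZl n a (z w : 'rV[R[i]]_n) : herm (a *: z) w = a * herm z w.
Proof. by rewrite /herm mulr_sumr; apply: eq_bigr => k _; rewrite mxE mulrA. Qed.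

Lemma hermZr n a (z w : 'rV[R[i]]_n) : herm z (a *: w) = a^* * herm z w.
Proof.
by rewrite /herm mulr_sumr; apply: eq_bigr => k _; rewrite mxE rmorphM mulrCA.
Qed.

(** The real and imaginary parts of a complex row vector, as columns. *)
Definition re_col n (z : 'rV[R[i]]_n) : 'cV[R]_n := \col_k complex.Re (z 0 k).
Definition im_col n (z : 'rV[R[i]]_n) : 'cV[R]_n := \col_k complex.Im (z 0 k).

(** A real symmetric form at a complex vector is the sum of its values at the real
  and imaginary parts. *)
Lemma Re_herm_form n (A : 'M[R]_n) (z : 'rV[R[i]]_n) : A^T = A ->
  complex.Re (herm (z *m map_mx (real_complex R) A) z) =
  dot (re_col z) (A *m re_col z) + dot (im_col z) (A *m im_col z).
Proof.
move=> sA; rewrite /herm complexRe_sum !dotE -big_split /=; apply: eq_bigr => k _.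
rewrite !mxE !mulr_sumr mulr_suml complexRe_sum -big_split /=.
apply: eq_bigr => l _; rewrite !mxE -{1}sA mxE.
by case: (z 0 k) => a b; case: (z 0 l) => c e /=; ring.
Qed.

Lemma Re_herm n (z : 'rV[R[i]]_n) :
  complex.Re (herm z z) = dot (re_col z) (re_col z) + dot (im_col z) (im_col z).
Proof.
have := Re_herm_form z (trmx1 R n); rewrite map_mx1 mulmx1 => ->.
by rewrite !mul1mx.
Qed.

End ComplexForm.

Section Lambda2.
Variables (R : realType) (n : nat) (A : 'M[R]_n).
Hypothesis sA : A^T = A.
(* The spectral decomposition is that of A seen as a complex Hermitian matrix. *)
Let toC : {rmorphism R -> R[i]} := real_complex R.
Let B := map_mx toC A.
Let Q := spectralmx B.
Let D := spectral_diag B.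
Let r i := complex.Re (D 0 i).

Let hB : B \is hermsymmx.
Proof.
have realB : B \is a realmx.
  apply/mxOverP => i j; rewrite mxE; apply/CrealP.
  exact: conjc_real.
apply: realsym_hermsym => //; apply/is_hermitianmxP.
by rewrite expr0 scale1r map_mx_id // /B -{1}sA map_trmx.
Qed.

Let BE : B = invmx Q *m diag_mx D *m Q.
Proof. by have /hermitian_normalmx/orthomx_spectralP := hB. Qed.

Let DE i : D 0 i = (r i)%:C%C.
Proof.
have /mxOverP realD := @hermitian_spectral_diag_real _ n B hB.
by symmetry; apply/RRe_real/realD.
Qed.

Let eig_perm : perm_eq (eigenvalues A) [seq r i | i <- index_enum 'I_n].
Proof.
have [_ E] := eigenvaluesP sA; apply: prod_XsubC_eq; rewrite -E.
have charBE : char_poly B = char_poly (diag_mx D).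
  have PQ : map_mx polyC (invmx Q) *m map_mx polyC Q = 1%:M.
    by rewrite -map_mxM mulVmx ?spectral_unit // map_mx1.
  rewrite /char_poly /char_poly_mx BE !map_mxM.
  rewrite -[X in \det (X - _)]mulmx1 -PQ mulmxA -(scalar_mxC 'X).
  rewrite -mulmxBl -mulmxBr !det_mulmx mulrAC -det_mulmx.
  by rewrite PQ det1 mul1r.
apply: (map_poly_inj toC); rewrite map_char_poly -/B charBE.
rewrite char_poly_trig; last exact: diag_mx_is_trig.
rewrite rmorph_prod big_map.
apply: eq_bigr => i _; rewrite rmorphB /= map_polyX map_polyC; congr ('X - _%:P).
by rewrite !mxE eqxx mulr1n DE.
Qed.

Let rowB i : row i Q *m B = D 0 i *: row i Q.
Proof.
rewrite -row_mul BE !mulmxA mulmxV ?spectral_unit // mul1mx row_mul row_diag_mx.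
by rewrite -scalemxAl -rowE.
Qed.

Let rowQ i j : herm (row i Q) (row j Q) = (i == j)%:R.
Proof.
have /unitarymxP QQ := spectral_unitarymx B.
have := congr1 (fun M : 'M[R[i]]_n => M i j) QQ; rewrite [RHS]mxE => <-.
by rewrite !mxE; apply: eq_bigr => k _; rewrite !mxE.
Qed.

(** The upper bound on the form is only needed orthogonally to the all-ones vector:
  two orthonormal eigenvectors with eigenvalues at least [lambda2 A] span a plane
  that meets this hyperplane. *)
Lemma lambda2_abs_le tau : (1 < n)%N ->
  (forall u, dot (const_mx 1) u = 0 -> dot u (A *m u) <= tau * dot u u) ->
  (forall u, - tau * dot u u <= dot u (A *m u)) -> `|lambda2 A| <= tau.
Proof.
move=> n1 hub hlb; have [ss _] := eigenvaluesP sA.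
have sz := size_eigenvalues sA.
rewrite /lambda2; set l2 := nth 0 _ 1.
have l2s : l2 \in eigenvalues A by rewrite mem_nth // sz.
rewrite ler_norml; apply/andP; split.
  move: l2s; rewrite (perm_mem eig_perm) => /mapP[i _ ->].
  have := lerD (hlb (re_col (row i Q))) (hlb (im_col (row i Q))).
  rewrite -mulrDr -Re_herm -Re_herm_form // -/B rowB hermZl rowQ eqxx DE.
  by rewrite !mulr1.
have [i [j [ij [li lj]]]] : exists i j, i != j /\ l2 <= r i /\ l2 <= r j.
  have : (1 < count (fun x => (l2 <= x)%R) [seq r i | i <- index_enum 'I_n])%N.
    rewrite -(permP eig_perm); move: ss sz; rewrite /l2.
    case: (eigenvalues A) => [|a [|b t]] /=; try by case: n n1 => [|[]].
    by move=> /andP[ab _] _; rewrite ab lexx.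
  rewrite count_map -sum1_count => n2.
  have /card_gt1P[i [j [hi hj ij]]] : (1 < #|[pred i | (l2 <= r i)%R]|)%N.
    rewrite -sum1_card; apply: leq_trans n2 _.
    by rewrite leq_eqVlt (eq_bigl _ _ (fun=> erefl)) eqxx.
  by exists i, j.
(* Coefficients making the combination of the two eigenvectors sum to zero. *)
pose c (k : 'I_n) : R[i] := \sum_l Q k l.
have [a [b [abn ab0]]] : exists a b : R[i], 0 < complex.Re (a * a^* + b * b^*) /\
    a * c i + b * c j = 0.
  have pos (z : R[i]) : 0 <= complex.Re (z * z^*).
    by case: z => x y /=; rewrite mulrN opprK addr_ge0 // -expr2 sqr_ge0.
  have pos' (z : R[i]) : z != 0 -> 0 < complex.Re (z * z^*).
    case: z => x y /= z0; rewrite mulrN opprK lt_neqAle eq_sym.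
    rewrite paddr_eq0 -?expr2 ?sqr_ge0 // !sqrf_eq0 addr_ge0 ?sqr_ge0 // andbT.
    by apply: contra z0 => /andP[/eqP -> /eqP ->].
  have [cj|cj] := eqVneq (c j) 0.
    exists 0, 1; split; last by rewrite mul0r cj mulr0 addr0.
    by rewrite mul0r add0r; apply: pos'; exact: oner_neq0.
  exists (c j), (- c i); split; last by rewrite mulNr mulrC subrr.
  by rewrite complexReD; apply: ltr_pwDl; [exact: pos'|exact: pos].
pose z := a *: row i Q + b *: row j Q.
have hzz : herm z z = a * a^* + b * b^*.
  rewrite /z !hermDl !hermDr !hermZl !hermZr !rowQ !eqxx (negbTE ij) eq_sym.
  by rewrite (negbTE ij) !mulr1 !mulr0 addr0 add0r.
have hzB : complex.Re (herm (z *m B) z) =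
    r i * complex.Re (a * a^*) + r j * complex.Re (b * b^*).
  have -> : z *m B = (a * D 0 i) *: row i Q + (b * D 0 j) *: row j Q.
    rewrite /z (mulmxDl (a *: row i Q)) -(scalemxAl a) -(scalemxAl b).
    by rewrite !rowB !scalerA.
  rewrite hermDl !hermZl /z !hermDr !hermZr !rowQ.
  rewrite !eqxx (negbTE ij) eq_sym (negbTE ij) !mulr1 !mulr0 addr0 add0r !DE.
  by rewrite complexReD; case: a {abn ab0 z hzz} => ? ?; case: b => ? ? /=; ring.
have [x0 y0] : dot (const_mx 1) (re_col z) = 0 /\ dot (const_mx 1) (im_col z) = 0.
  have : \sum_k z 0 k = 0.
    apply: etrans ab0; rewrite /c !mulr_sumr -big_split; apply: eq_bigr => k _.
    by rewrite !mxE.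
  move=> z0; rewrite !dotE.
  have E (f : R[i] -> R) : (forall x y, f (x + y) = f x + f y) -> f 0 = 0 ->
      \sum_k f (z 0 k) = 0.
    by move=> fD f0; rewrite -(big_morph f fD f0) z0.
  split.
  - transitivity (\sum_k complex.Re (z 0 k)); last exact: (E _ (@complexReD R)).
    apply: eq_bigr => k _.
    by rewrite !mxE mul1r.
  - have ImD (x y : R[i]) : complex.Im (x + y) = complex.Im x + complex.Im y.
      by case: x; case: y.
    transitivity (\sum_k complex.Im (z 0 k)); last exact: (E _ ImD).
    apply: eq_bigr => k _.
    by rewrite !mxE mul1r.
have := lerD (hub _ x0) (hub _ y0).
rewrite -mulrDr -Re_herm -Re_herm_form // -/B hzB hzz complexReD => h.
have pos (u : R[i]) : 0 <= complex.Re (u * u^*).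
  by case: u => x y /=; rewrite mulrN opprK addr_ge0 // -expr2 sqr_ge0.
rewrite complexReD in abn; rewrite -(ler_pM2r abn); apply: le_trans h.
by rewrite mulrDr lerD // ler_wpM2r.
Qed.
End Lambda2.

(** * Product laws: drawing one entry afresh *)

Section TupleUpdate.
Variables (E : Type) (N : nat).

(** The tuple [v] with its [i]-th entry replaced by [x]. *)
Definition upd (v : N.-tuple E) (i : 'I_N) (x : E) : N.-tuple E :=
  [tuple if k == i then x else tnth v k | k < N].

Lemma tnth_upd v i x k : tnth (upd v i x) k = if k == i then x else tnth v k.
Proof. exact: tnth_mktuple. Qed.

Lemma tnth_upd_eq v i x : tnth (upd v i x) i = x.
Proof. by rewrite tnth_upd eqxx. Qed.

Lemma tnth_upd_neq v i x k : k != i -> tnth (upd v i x) k = tnth v k.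
Proof. by rewrite tnth_upd => /negbTE ->. Qed.
End TupleUpdate.

(** Measurable rectangles, the pi-system generating the product sigma-algebra. *)
Definition rectangles d (E : measurableType d) N : set (set (N.-tuple E)) :=
  [set C | exists2 A : 'I_N -> set E, (forall i, measurable (A i)) &
     C = [set v | forall i, A i (tnth v i)]].

Lemma rectangles_generate d (E : measurableType d) N :
  (measurable : set (set (N.-tuple E))) = <<s @rectangles d E N >>.
Proof.
apply/seteqP; split.
  apply: smallest_sub; first exact: smallest_sigma_algebra.
  case: N => [|m]; first by rewrite big_ord0.
  rewrite -bigcup_mkord_ord; apply: bigcup_sub => i Ii C [A mA <-].
  apply: sub_sigma_algebra; exists (fun k => if k == inord i then A else setT).
    by move=> k; case: ifP.
  apply/seteqP; split=> v /=; first by move=> [_ h] k; case: eqP => [->|].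
  by move=> h; split => //; have := h (inord i); rewrite eqxx.
apply: smallest_sub; first exact: sigma_algebra_measurable.
move=> _ [A mA ->].
have -> : [set v : N.-tuple E | forall i, A i (tnth v i)] =
    \bigcap_(i in [set: 'I_N]) ((fun v : N.-tuple E => tnth v i) @^-1` A i).
  by apply/seteqP; split => v /= h i; [move=> _|]; exact: h.
apply: fin_bigcap_measurable => // i _.
by rewrite -[X in measurable X]setTI; exact: measurable_tnth.
Qed.

Section Resample.
Context d (E : measurableType d) (R : realType) (N : nat).

Lemma tuple_measure_unique (m1 m2 : {measure set (N.-tuple E) -> \bar R}) :
  (m1 setT < +oo)%E ->
  (forall A : 'I_N -> set E, (forall i, measurable (A i)) ->
    m1 [set v | forall i, A i (tnth v i)] =
    m2 [set v | forall i, A i (tnth v i)]) ->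
  forall A, measurable A -> m1 A = m2 A.
Proof.
move=> m1oo m12 A mA.
have rT : @rectangles _ E N setT.
  by exists (fun=> setT) => //; apply/seteqP; split.
apply: (measure_unique (@rectangles _ E N) (fun=> setT)) => //.
- exact: rectangles_generate.
- move=> _ _ [B mB ->] [C mC ->]; exists (fun i => B i `&` C i).
    by move=> i; exact: measurableI.
  apply/seteqP; split=> v /=; first by move=> [h1 h2] i; split.
  by move=> h; split=> i; have [] := h i.
- by rewrite bigcup_const.
- by move=> _ [B mB ->]; exact: m12.
Qed.

Lemma measurable_upd (i : 'I_N) :
  measurable_fun setT (fun z : E * N.-tuple E => upd z.2 i z.1).
Proof.
apply/measurable_fun_tnthP => k.
rewrite (_ : _ \o _ = fun z : E * N.-tuple E => if k == i then z.1 else tnth z.2 k).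
  case: (k == i); first exact: measurable_fst.
  exact: (measurableT_comp (measurable_tnth k) measurable_snd).
by apply/funext => z /=; rewrite tnth_upd.
Qed.

Variables (nu : probability (N.-tuple E) R) (mu : 'I_N -> probability E R).
Hypothesis prod_law : forall A : 'I_N -> set E, (forall i, measurable (A i)) ->
  nu [set v | forall i, A i (tnth v i)] = (\prod_(i < N) mu i (A i))%E.

(** Under a product law, the law is unchanged by drawing one entry afresh. *)
Lemma resample_measure (i : 'I_N) (A : set (N.-tuple E)) : measurable A ->
  nu A = pushforward (mu i \x nu)%E (fun z => upd z.2 i z.1) A.
Proof.
move=> mA; pose phi (z : E * N.-tuple E) := upd z.2 i z.1.
pose mphi := isMeasurableFun.Build _ _ _ _ _ (measurable_upd i).
pose phi' : {mfun _ >-> _} := HB.pack phi mphi.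
apply: (@tuple_measure_unique nu (pushforward (mu i \x nu)%E phi')) => //.
  by rewrite [ltLHS]probability_setT ltry.
move=> B mB; apply: etrans (prod_law mB) _.
change (\prod_(i < N) mu i (B i) =
  (mu i \x nu) (phi @^-1` [set v | forall k, B k (tnth v k)]))%E.
pose B' k := if k == i then setT else B k.
have mB' k : measurable (B' k) by rewrite /B'; case: ifP.
have -> : phi @^-1` [set v | forall k, B k (tnth v k)] =
    B i `*` [set v | forall k, B' k (tnth v k)].
  apply/seteqP; split => -[x v] /=.
    move=> h; split; first by have := h i; rewrite tnth_upd_eq.
    by move=> k; rewrite /B'; have := h k; rewrite tnth_upd; case: eqP.
  move=> [hx h] k; have := h k; rewrite tnth_upd /B'.
  by case: eqP => [->|].
rewrite product_measure1E //=; last first.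
  by rewrite rectangles_generate; apply: sub_sigma_algebra; exists B'.
rewrite [X in (_ = _ * X)%E](prod_law mB') (bigD1 i) //=.
rewrite [X in (_ = _ * X)%E](bigD1 i) //=.
rewrite {1}/B' eqxx probability_setT mul1e; congr (_ * _)%E.
by apply: eq_bigr => k ki; rewrite /B' (negbTE ki).
Qed.

Lemma resample_integral (i : 'I_N) (f : N.-tuple E -> \bar R) :
  measurable_fun [set: N.-tuple E] f -> (forall v, 0 <= f v)%E ->
  (\int[nu]_v f v = \int[nu]_v \int[mu i]_x f (upd v i x))%E.
Proof.
move=> mf f0.
pose mphi := isMeasurableFun.Build _ _ _ _ _ (measurable_upd i).
pose phi' : {mfun _ >-> _} := HB.pack (fun z => upd z.2 i z.1) mphi.
rewrite (@eq_measure_integral _ _ _ setT (pushforward (mu i \x nu)%E phi')); last first.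
  by move=> A mA _; apply: resample_measure.
rewrite ge0_integral_pushforward //=.
rewrite preimage_setT (fubini_tonelli2 (f \o fun z => upd z.2 i z.1)) //.
- by apply: measurableT_comp => //; exact: measurable_upd.
- by move=> z; exact: f0.
- exact: measurable_upd.
Qed.

End Resample.

(** * Expectations of bounded measurable functions *)

Section BoundedMeasurable.
Context d (T : measurableType d) (R : realType).
Implicit Types (f g : T -> R).

(** Bounded measurable functions: they are integrable for every probability and
  form an algebra, so that expectations below need no integrability condition. *)
Definition bmeas f := measurable_fun setT f /\ exists C, forall x, `|f x| <= C.

Lemma bmeas_cst c : bmeas (fun=> c).
Proof. by split; [exact: measurable_cst|exists `|c|]. Qed.

Lemma bmeasD f g : bmeas f -> bmeas g -> bmeas (fun x => f x + g x).
Proof.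
move=> [mf [C fC]] [mg [D gD]]; split; first exact: measurable_funD.
by exists (C + D) => x; rewrite (le_trans (ler_normD _ _)) // lerD.
Qed.

Lemma bmeasM f g : bmeas f -> bmeas g -> bmeas (fun x => f x * g x).
Proof.
move=> [mf [C fC]] [mg [D gD]]; split; first exact: measurable_funM.
by exists (C * D) => x; rewrite normrM ler_pM.
Qed.

Lemma bmeasZ c f : bmeas f -> bmeas (fun x => c * f x).
Proof. by apply: bmeasM; exact: bmeas_cst. Qed.

Lemma bmeasN f : bmeas f -> bmeas (fun x => - f x).
Proof. by move=> /(bmeasZ (- 1)); under eq_fun do rewrite mulN1r. Qed.

Lemma bmeasB f g : bmeas f -> bmeas g -> bmeas (fun x => f x - g x).
Proof. by move=> bf bg; apply: bmeasD => //; exact: bmeasN. Qed.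

Lemma bmeas_sum (I : Type) (s : seq I) (P : pred I) (F : I -> T -> R) :
  (forall i, P i -> bmeas (F i)) -> bmeas (fun x => \sum_(i <- s | P i) F i x).
Proof.
move=> bF; elim: s => [|i s IH].
  by under eq_fun do rewrite big_nil; exact: bmeas_cst.
case Pi : (P i); under eq_fun do rewrite big_cons Pi; last exact: IH.
by apply: bmeasD => //; exact: bF.
Qed.

Lemma bmeasX f n : bmeas f -> bmeas (fun x => f x ^+ n).
Proof.
move=> bf; elim: n => [|n IH].
  by under eq_fun do rewrite expr0; exact: bmeas_cst.
by under eq_fun do rewrite exprS; exact: bmeasM.
Qed.

End BoundedMeasurable.

Lemma bmeas_comp d d' (T : measurableType d) (T' : measurableType d')
    (R : realType) (f : T' -> R) (h : T -> T') :
  bmeas f -> measurable_fun setT h -> bmeas (fun x => f (h x)).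
Proof.
move=> [mf [C fC]] mh; split; first exact: (measurableT_comp mf mh).
by exists C => x; exact: fC.
Qed.

Section Expectation.
Context d (T : measurableType d) (R : realType) (P : probability T R).
Implicit Types (f g : T -> R).

(** The expectation of a real function. *)
Definition Ex f : R := \int[P]_x f x.

Lemma bmeas_integrable f : bmeas f -> P.-integrable setT (EFin \o f).
Proof.
move=> [mf [C fC]]; apply: measurable_bounded_integrable => //.
  by rewrite [ltLHS]probability_setT ltry.
by exists C; split; [exact: num_real|move=> M CM x _; exact: le_trans (fC x) (ltW CM)].
Qed.

Lemma ExE f : bmeas f -> (Ex f)%:E = (\int[P]_x (f x)%:E)%E.
Proof.
by move=> bf; rewrite /Ex /Rintegral fineK // integrable_fin_num //; exact: bmeas_integrable.
Qed.

Lemma eq_Ex f g : f =1 g -> Ex f = Ex g.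
Proof. by move=> /funext ->. Qed.

Lemma Ex_cst c : Ex (fun=> c) = c.
Proof. by rewrite /Ex Rintegral_cst // [X in fine X]probability_setT mulr1. Qed.

Lemma ExD f g : bmeas f -> bmeas g -> Ex (fun x => f x + g x) = Ex f + Ex g.
Proof. by move=> bf bg; rewrite /Ex RintegralD //; exact: bmeas_integrable. Qed.

Lemma ExZ c f : bmeas f -> Ex (fun x => c * f x) = c * Ex f.
Proof. by move=> bf; rewrite /Ex RintegralZl //; exact: bmeas_integrable. Qed.

Lemma ExN f : bmeas f -> Ex (fun x => - f x) = - Ex f.
Proof.
move=> bf; rewrite -[RHS]mulN1r -ExZ //.
by apply: eq_Ex => x; rewrite mulN1r.
Qed.

Lemma ExB f g : bmeas f -> bmeas g -> Ex (fun x => f x - g x) = Ex f - Ex g.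
Proof. by move=> bf bg; rewrite ExD ?ExN //; exact: bmeasN. Qed.

Lemma Ex_sum (I : Type) (s : seq I) (Q : pred I) (F : I -> T -> R) :
  (forall i, Q i -> bmeas (F i)) ->
  Ex (fun x => \sum_(i <- s | Q i) F i x) = \sum_(i <- s | Q i) Ex (F i).
Proof.
move=> bF; elim: s => [|i s IH].
  rewrite big_nil -[RHS](Ex_cst 0).
  by apply: eq_Ex => x; rewrite big_nil.
rewrite big_cons -IH; case Qi : (Q i).
  rewrite -ExD; [|exact: bF|exact: bmeas_sum].
  by apply: eq_Ex => x; rewrite big_cons Qi.
by apply: eq_Ex => x; rewrite big_cons Qi.
Qed.

Lemma le_Ex f g : bmeas f -> bmeas g -> (forall x, f x <= g x) -> Ex f <= Ex g.
Proof. by move=> bf bg fg; apply: le_Rintegral => //; exact: bmeas_integrable. Qed.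

Lemma Ex_ge0 f : (forall x, 0 <= f x) -> 0 <= Ex f.
Proof. by move=> f0; apply: Rintegral_ge0. Qed.

Lemma abs_Ex_le f C : bmeas f -> (forall x, `|f x| <= C) -> `|Ex f| <= C.
Proof.
move=> bf fC; rewrite ler_norml -(Ex_cst C) -ExN; last exact: bmeas_cst.
apply/andP; split; apply: le_Ex => //; try exact: bmeas_cst.
- by move=> x; have := fC x; rewrite ler_norml => /andP[].
- by move=> x; have := fC x; rewrite ler_norml => /andP[].
Qed.

Lemma bmeas_indic A : measurable A -> bmeas (\1_A : T -> R).
Proof.
move=> mA; split; first exact: measurable_indic.
by exists 1 => x; rewrite ger0_norm // indicE; case: (_ \in _).
Qed.

Lemma Ex_indic A : measurable A -> Ex (\1_A) = fine (P A).
Proof. by move=> mA; rewrite /Ex /Rintegral integral_indic // setIT. Qed.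

Lemma null_eq_Ex f g N : measurable N -> P N = 0%E -> bmeas f -> bmeas g ->
  (forall x, ~ N x -> f x = g x) -> Ex f = Ex g.
Proof.
move=> mN PN [mf _] [mg _] fg; rewrite /Ex /Rintegral; congr fine.
apply: ae_eq_integral => //; [exact/measurable_EFinP|exact/measurable_EFinP|].
exists N; split => // x /= h; apply: contrapT => Nx; apply: h => _.
by rewrite fg.
Qed.

End Expectation.

Lemma Ex_pushforward d d' (T : measurableType d) (T' : measurableType d')
    (R : realType) (P : probability T R) (X : {mfun T >-> T'}) (f : T' -> R) :
  bmeas f -> Ex (distribution P X) f = Ex P (fun w => f (X w)).
Proof.
move=> bf; rewrite /Ex /Rintegral integral_distribution //.
  by case: bf => mf _; exact/measurable_EFinP.
have mX : measurable_fun setT X by exact: measurable_funPT.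
exact: (bmeas_integrable P (bmeas_comp bf mX)).
Qed.

Section ResampleExpectation.
Context d (E : measurableType d) (R : realType) (N : nat).
Variables (nu : probability (N.-tuple E) R) (mu : 'I_N -> probability E R).

Lemma measurable_updr (v : N.-tuple E) (i : 'I_N) : measurable_fun setT (upd v i).
Proof.
apply/measurable_fun_tnthP => k.
rewrite (_ : _ \o _ = fun x : E => if k == i then x else tnth v k).
  by case: (k == i).
by apply/funext => z /=; rewrite tnth_upd.
Qed.

Lemma bmeas_updr (f : N.-tuple E -> R) i v : bmeas f -> bmeas (fun x => f (upd v i x)).
Proof. by move=> bf; apply: bmeas_comp bf _; exact: measurable_updr. Qed.

Lemma bmeas_resample (f : N.-tuple E -> R) i : bmeas f ->
  bmeas (fun v => Ex (mu i) (fun x => f (upd v i x))).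
Proof.
move=> bf; have [mf [C fC]] := bf; split; last first.
  by exists C => v; apply: abs_Ex_le => //; exact: bmeas_updr.
(* Adding the bound C makes f nonnegative. *)
pose g v : R := f v + C.
have g0 v : 0 <= g v by have := fC v; rewrite ler_norml /g => /andP[h _]; lra.
have bg : bmeas g by apply: bmeasD => //; exact: bmeas_cst.
have -> : (fun v => Ex (mu i) (fun x => f (upd v i x))) =
    (fun v => fine (\int[mu i]_x (g (upd v i x))%:E)%E - C).
  apply/funext => v; rewrite -[fine _]/(Ex (mu i) (fun x => g (upd v i x))) ExD.
  - by rewrite Ex_cst addrK.
  - exact: bmeas_updr.
  - exact: bmeas_cst.
apply: measurable_funB; last exact: measurable_cst.
apply: measurableT_comp => //.
apply: (@measurable_fun_fubini_tonelli_G _ _ _ _ _ (mu i)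
  (fun z : E * N.-tuple E => (g (upd z.2 i z.1))%:E)) => [|z]; last by rewrite lee_fin.
apply/measurable_EFinP; apply: (measurableT_comp (proj1 bg)).
exact: measurable_upd.
Qed.

Hypothesis prod_law : forall A : 'I_N -> set E, (forall i, measurable (A i)) ->
  nu [set v | forall i, A i (tnth v i)] = (\prod_(i < N) mu i (A i))%E.

(** Fubini: integrate the [i]-th entry first, the others being fixed. *)
Lemma resample (f : N.-tuple E -> R) i : bmeas f ->
  Ex nu f = Ex nu (fun v => Ex (mu i) (fun x => f (upd v i x))).
Proof.
move=> bf; have [mf [C fC]] := bf.
pose g v : R := f v + C.
have g0 v : 0 <= g v by have := fC v; rewrite ler_norml /g => /andP[h _]; lra.
have bg : bmeas g by apply: bmeasD => //; exact: bmeas_cst.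
suff gE : Ex nu g = Ex nu (fun v => Ex (mu i) (fun x => g (upd v i x))).
  apply: (addIr C); rewrite -{1}(Ex_cst nu C) -ExD //; last exact: bmeas_cst.
  rewrite [LHS]gE -(Ex_cst nu C) -ExD; [|exact: bmeas_resample|exact: bmeas_cst].
  apply: eq_Ex => v; rewrite ExD ?Ex_cst //; [exact: bmeas_updr|exact: bmeas_cst].
apply: EFin_inj; rewrite ExE // ExE; last exact: bmeas_resample.
rewrite (resample_integral prod_law i) //=; last first.
  by apply/measurable_EFinP; exact: (proj1 bg).
by apply: eq_integral => v _; rewrite ExE //; exact: bmeas_updr.
Qed.

End ResampleExpectation.

(** * Rotations of the coordinate planes *)

Section Givens.
Variables (R : realType) (d : nat).
Implicit Types (v w x y z : d.-tuple R) (a b k : 'I_d) (c s : R).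

(** Rotation by the angle with cosine [c] and sine [s] in the plane of the
  coordinates [a] and [b]. *)
Definition givens a b c s v : d.-tuple R :=
  [tuple if k == a then c * tnth v a - s * tnth v b
         else if k == b then s * tnth v a + c * tnth v b else tnth v k | k < d].

Lemma tnth_givens a b c s v k : tnth (givens a b c s v) k =
  if k == a then c * tnth v a - s * tnth v b
  else if k == b then s * tnth v a + c * tnth v b else tnth v k.
Proof. exact: tnth_mktuple. Qed.

Lemma dotp_givens a b c s v w : a != b -> c ^+ 2 + s ^+ 2 = 1 ->
  dotp (givens a b c s v) (givens a b c s w) = dotp v w.
Proof.
move=> ab cs; rewrite /dotp.
rewrite (bigD1 a) //= (bigD1 b) /=; last by rewrite eq_sym.
rewrite [in RHS](bigD1 a) //= [in RHS](bigD1 b) /=; last by rewrite eq_sym.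
rewrite !tnth_givens eqxx eq_sym (negbTE ab) eqxx !addrA; congr (_ + _); last first.
  by apply: eq_bigr => k /andP[/negbTE ka /negbTE kb]; rewrite !tnth_givens ka kb.
transitivity ((c ^+ 2 + s ^+ 2) * (tnth v a * tnth w a + tnth v b * tnth w b)).
  by ring.
by rewrite cs mul1r.
Qed.

Lemma measurable_givens a b c s : measurable_fun setT (givens a b c s).
Proof.
apply/measurable_fun_tnthP => k.
rewrite (_ : _ \o _ = fun v => if k == a then c * tnth v a - s * tnth v b
  else if k == b then s * tnth v a + c * tnth v b else tnth v k); last first.
  by apply/funext => v /=; rewrite tnth_givens.
case: (k == a); last case: (k == b).
- by apply: measurable_funB; apply: measurable_funM => //; exact: measurable_tnth.
- by apply: measurable_funD; apply: measurable_funM => //; exact: measurable_tnth.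
- exact: measurable_tnth.
Qed.

(** Finite compositions of coordinate plane rotations. *)
Inductive is_rotation : (d.-tuple R -> d.-tuple R) -> Prop :=
| rotation_id : is_rotation id
| rotation_comp rho a b c s : a != b -> c ^+ 2 + s ^+ 2 = 1 ->
    is_rotation rho -> is_rotation (givens a b c s \o rho).

Lemma rotation_trans rho1 rho2 :
  is_rotation rho1 -> is_rotation rho2 -> is_rotation (rho2 \o rho1).
Proof.
move=> h1; elim => [//|rho a b c s ab cs _ IH].
exact: (rotation_comp ab cs IH).
Qed.

Lemma dotp_rotation rho v w : is_rotation rho -> dotp (rho v) (rho w) = dotp v w.
Proof. by elim=> // ? ? ? ? ? ? ? _ IH; rewrite /= dotp_givens. Qed.

(** Rotations in the planes [(a, k)] with [k] in [K]
  move the mass of [y] on the coordinates in [K] to the coordinate [a]. The last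
  two clauses say that they act on the coordinates in [a :: K] only. *)
Lemma rotation_zero a (K : seq 'I_d) y : a \notin K ->
  exists2 rho, is_rotation rho & [/\ forall k, k \in K -> tnth (rho y) k = 0,
    forall w k, k != a -> k \notin K -> tnth (rho w) k = tnth w k &
    forall w, (forall k, k \in a :: K -> tnth w k = 0) -> rho w = w].
Proof.
elim: K => [_|k K IH]; first by exists id; [exact: rotation_id|split].
rewrite inE negb_or => /andP[ak aK]; have [rho hrho [h1 h2 h3]] := IH aK.
pose p := tnth (rho y) a; pose q := tnth (rho y) k.
have [c [s [cs cs0]]] : exists c s, c ^+ 2 + s ^+ 2 = 1 /\ s * p + c * q = 0.
  have [pq0|pq0] := eqVneq (p ^+ 2 + q ^+ 2) 0.
    have /eqP := pq0; rewrite paddr_eq0 ?sqr_ge0 // !sqrf_eq0 => /andP[/eqP -> /eqP ->].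
    by exists 1, 0; rewrite expr1n expr0n !mulr0 !addr0.
  pose r := Num.sqrt (p ^+ 2 + q ^+ 2).
  have r2 : r ^+ 2 = p ^+ 2 + q ^+ 2 by rewrite sqr_sqrtr // addr_ge0 ?sqr_ge0.
  have r0 : r != 0 by rewrite -sqrf_eq0 r2.
  exists (p / r), (- q / r); split; last by field.
  by rewrite !exprMn sqrrN exprVn -mulrDl r2 divff.
exists (givens a k c s \o rho); first exact: rotation_comp.
split=> [j|w j ja|w w0] /=.
- rewrite tnth_givens inE; have [->|jk] := eqVneq j k.
    by rewrite eq_sym (negbTE ak).
  by case: eqVneq => [->|_] /=; [rewrite (negbTE aK)|exact: h1].
- by rewrite inE negb_or => /andP[jk jK]; rewrite tnth_givens (negbTE ja) (negbTE jk) h2.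
- have w0' : rho w = w.
    apply: h3 => j jaK; apply: w0; move: jaK.
    by rewrite !inE => /orP[->|->]; rewrite ?orbT.
  apply: eq_from_tnth => j; rewrite w0' tnth_givens.
  have wa : tnth w a = 0 by rewrite w0 // mem_head.
  have wk : tnth w k = 0 by rewrite w0 // !inE eqxx orbT.
  case: eqVneq => [->|_]; first by rewrite wa wk !mulr0 subr0.
  by case: eqVneq => [->|//]; rewrite wa wk !mulr0 addr0.
Qed.

(** The vector with coordinates [p] and [q] on the axes [a] and [b]. *)
Definition planar a b p q : d.-tuple R :=
  [tuple if k == a then p else if k == b then q else 0 | k < d].

Lemma tnth_planar a b p q k : tnth (planar a b p q) k =
  if k == a then p else if k == b then q else 0.
Proof. exact: tnth_mktuple. Qed.

Lemma dotp_planar a b x p q : a != b ->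
  dotp x (planar a b p q) = tnth x a * p + tnth x b * q.
Proof.
move=> ab; rewrite /dotp (bigD1 a) //= (bigD1 b) /=; last by rewrite eq_sym.
rewrite !tnth_planar eqxx eq_sym (negbTE ab) eqxx big1 ?addr0 //.
by move=> k /andP[/negbTE ka /negbTE kb]; rewrite tnth_planar ka kb mulr0.
Qed.

Lemma givens_planar a b c s p q : a != b ->
  givens a b c s (planar a b p q) = planar a b (c * p - s * q) (s * p + c * q).
Proof.
move=> ab; apply: eq_from_tnth => k; rewrite tnth_givens !tnth_planar.
rewrite eqxx [b == a]eq_sym (negbTE ab) eqxx.
by case: eqVneq => // _; case: eqVneq.
Qed.

(** Every vector is rotated onto the axis [a]. *)
Lemma rotation_axis a b y : a != b ->
  exists2 rho, is_rotation rho & exists p, rho y = planar a b p 0.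
Proof.
move=> ab.
have [rho hr [h1 h2 _]] := @rotation_zero a [seq k <- enum 'I_d | k != a] y
  ltac:(by rewrite mem_filter eqxx).
exists rho => //; exists (tnth (rho y) a); apply: eq_from_tnth => k.
rewrite tnth_planar; case: eqVneq => [->//|ka].
by rewrite h1 ?if_same // mem_filter ka mem_enum.
Qed.

(** Two vectors are rotated simultaneously into a coordinate plane. *)
Lemma rotation_plane a b y z : a != b -> exists2 rho, is_rotation rho &
  exists p q r, rho y = planar a b p 0 /\ rho z = planar a b q r.
Proof.
move=> ab; have [rho1 hr1 [p yp]] := rotation_axis y ab.
pose K := [seq k <- enum 'I_d | (k != a) && (k != b)].
have memK k : (k \in K) = (k != a) && (k != b).
  by rewrite mem_filter mem_enum andbT.
have [|rho2 hr2 [h1 h2 h3]] := @rotation_zero b K (rho1 z).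
  by rewrite memK eqxx andbF.
exists (rho2 \o rho1); first exact: rotation_trans.
exists p, (tnth (rho2 (rho1 z)) a), (tnth (rho2 (rho1 z)) b); split => /=.
  rewrite yp; apply: h3 => k; rewrite inE memK tnth_planar.
  case/orP => [/eqP ->|/andP[/negbTE -> /negbTE ->]//].
  by rewrite eqxx eq_sym (negbTE ab).
apply: eq_from_tnth => k; rewrite tnth_planar.
case: eqVneq => [->//|ka]; case: eqVneq => [->//|kb].
by rewrite h1 // memK ka kb.
Qed.

Lemma dotpC x y : dotp x y = dotp y x.
Proof. by apply: eq_bigr => k _; rewrite mulrC. Qed.

Lemma dotp_ge0 x : 0 <= dotp x x.
Proof. by apply: sumr_ge0 => k _; rewrite -expr2 sqr_ge0. Qed.

Lemma dotp_eq0 x : (dotp x x == 0) = [forall k, tnth x k == 0].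
Proof.
rewrite /dotp psumr_eq0 => [|k _]; last by rewrite -expr2 sqr_ge0.
apply/allP/forallP => h k; last by rewrite mulf_eq0 (eqP (h k)) eqxx.
by have := h k (mem_index_enum _); rewrite mulf_eq0 orbb.
Qed.

Lemma measurable_dotp y : measurable_fun setT (fun x => dotp x y).
Proof.
apply: measurable_sum => k; apply: measurable_funM => //; exact: measurable_tnth.
Qed.

Lemma measurable_dotp2 : measurable_fun setT (fun x => dotp x x).
Proof.
by apply: measurable_sum => k; apply: measurable_funM => //; exact: measurable_tnth.
Qed.

End Givens.

(** * Linear approximation of the arcsine and additive functions *)

Section Angle.
Variable R : realType.

Lemma sin_le_id (x : R) : 0 <= x -> x <= pi -> sin x <= x /\ x * cos x <= sin x.
Proof.
rewrite le_eqVlt => /orP[/eqP <-|x0]; first by rewrite sin0 mul0r.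
move=> xpi.
have [c cx] := @MVT R sin cos 0 x x0 (fun y _ => is_derive_sin y)
  (continuous_subspaceT (@continuous_sin R)).
move: cx; rewrite in_itv /= => /andP[c0 cx]; rewrite sin0 !subr0 => ->.
rewrite mulrC; split; first by rewrite ler_piMr ?cos_le1 ?(ltW x0).
rewrite ler_pM2l // ltW // ltr_cos // in_itv /= ?(ltW x0) ?(ltW c0) //=.
exact: le_trans (ltW cx) xpi.
Qed.

(** At [x = asin t]: the function [(2 / pi) asin] is linear up to [t ^+ 2]. *)
Lemma sin_linear_approx (x : R) : 0 <= x -> x <= pi / 2 ->
  `|2 / pi * x - 2 / pi * sin x| <= sin x ^+ 2.
Proof.
move=> x0 xpi2; have pi0 := @pi_gt0 R.
have xpi : x <= pi by apply: le_trans xpi2 _; rewrite ler_pdivrMr //; lra.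
have [h1 h2] := sin_le_id x0 xpi.
have c0 : 0 <= cos x.
  by apply: cos_ge0_pihalf; rewrite xpi2 andbT (le_trans _ x0) // oppr_le0; lra.
have c1 := cos_le1 x.
have h3 : x - sin x <= x * sin x ^+ 2.
  rewrite sin2cos2; apply: (@le_trans _ _ (x * (1 - cos x))); first by lra.
  by rewrite ler_wpM2l // lerD2l lerN2 expr2 ler_piMr.
rewrite -mulrBr ger0_norm; last by rewrite mulr_ge0 ?divr_ge0 ?subr_ge0 // ltW.
have p20 : 0 < 2 / pi :> R by rewrite divr_gt0.
apply: (@le_trans _ _ (2 / pi * (pi / 2 * sin x ^+ 2))).
  by rewrite ler_pM2l // (le_trans h3) // ler_wpM2r // sqr_ge0.
by rewrite mulrA mulf_div [2 * pi]mulrC divff ?mul1r // mulf_neq0 // gt_eqF.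
Qed.

(** A bounded additive function on an interval [[0, H]] is linear. *)
Lemma additive_bounded_linear (H C : R) (chi : R -> R) : 0 < H ->
  (forall s t, 0 <= s -> 0 <= t -> s + t <= H -> chi (s + t) = chi s + chi t) ->
  (forall t, `|chi t| <= C) ->
  forall t, 0 <= t -> t <= H -> chi t = t / H * chi H.
Proof.
move=> H0 chiD chiC.
pose g t := chi t - t / H * chi H.
have gD s t : 0 <= s -> 0 <= t -> s + t <= H -> g (s + t) = g s + g t.
  by move=> s0 t0 st; rewrite /g chiD // !mulrDl; ring.
have gH : g H = 0 by rewrite /g divff ?gt_eqF // mul1r subrr.
have gC t : 0 <= t -> t <= H -> `|g t| <= C *+ 2.
  move=> t0 tH; rewrite (le_trans (ler_normB _ _)) // mulr2n lerD //.
  rewrite normrM (le_trans _ (chiC H)) // ler_piMl //.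
  by rewrite ger0_norm ?divr_ge0 ?(ltW H0) // ler_pdivrMr // mul1r.
(* Halving: g (2 t) = 2 g t on the first half, g t = - g (H - t) on the second. *)
have gk k t : 0 <= t -> t <= H -> `|g t| <= C *+ 2 / 2 ^+ k.
  elim: k t => [|k IH] t t0 tH; first by rewrite expr0 divr1 gC.
  wlog tH2 : t t0 tH / t <= H / 2.
    move=> W; have [|tH2] := leP t (H / 2); first exact: W.
    have := gD t (H - t) t0; rewrite subr_ge0 addrCA subrr addr0 gH => /(_ tH (lexx _)).
    move=> /esym/eqP; rewrite addr_eq0 => /eqP ->; rewrite normrN.
    by apply: W; lra.
  have tt : t + t <= H by lra.
  have := IH (t + t) (addr_ge0 t0 t0) tt; rewrite gD // -mulr2n normrMn.
  rewrite -[`|g t| *+ 2]mulr_natr -ler_pdivlMr // => /le_trans; apply.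
  by rewrite exprSr invfM mulrA.
move=> t t0 tH; apply/eqP; rewrite -subr_eq0 -/(g t) -normr_eq0 eq_le normr_ge0 andbT.
apply/ler_addgt0Pr => e e0; rewrite add0r.
have C0 : 0 <= C by exact: le_trans (normr_ge0 _) (chiC 0).
have [k hk] : exists k : nat, C *+ 2 / e <= k%:R.
  exists (Num.truncn (C *+ 2 / e)).+1; apply: ltW; exact: truncnS_gt.
apply: le_trans (gk k t t0 tH) _.
rewrite ler_pdivrMr ?exprn_gt0 // mulrC -ler_pdivrMr // (le_trans hk) //.
by rewrite -natrX ler_nat ltnW // ltn_expl.
Qed.
End Angle.

(** * Rotation invariant laws *)

Lemma bmeas_sg d (T : measurableType d) (R : realType) (f : T -> R) :
  measurable_fun setT f -> bmeas (fun x => Num.sg (f x)).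
Proof.
move=> mf.
have m1 : measurable [set x | 0 < f x].
  rewrite -[X in measurable X]setTI.
  have := @measurable_fun_ltr _ _ _ setT (fun=> 0) f (@measurable_cst _ _ _ _ _ _) mf.
  by move=> /(_ measurableT [set true]) /=; apply.
have m2 : measurable [set x | f x < 0].
  rewrite -[X in measurable X]setTI.
  have := @measurable_fun_ltr _ _ _ setT f (fun=> 0) mf (@measurable_cst _ _ _ _ _ _).
  by move=> /(_ measurableT [set true]) /=; apply.
have -> : (fun x => Num.sg (f x)) =
    (fun x => \1_[set x | 0 < f x] x - \1_[set x | f x < 0] x).
  apply/funext => x; rewrite !indicE.
  have -> : (x \in [set x | 0 < f x]) = (0 < f x) by apply/idP/idP; rewrite inE.
  have -> : (x \in [set x | f x < 0]) = (f x < 0) by apply/idP/idP; rewrite inE.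
  by case: sgrP; rewrite ?subr0 // sub0r.
by apply: bmeasB; exact: bmeas_indic.
Qed.

Section Direction.
Variables (R : realType) (d : nat).
Implicit Types (x y z : d.-tuple R).

(** The direction [x / |x|] of a vector, with value [0] at [0]. *)
Definition hat x : d.-tuple R :=
  [tuple tnth x k * dotp x x `^ (- 2^-1) | k < d].

Lemma tnth_hat x k : tnth (hat x) k = tnth x k * dotp x x `^ (- 2^-1).
Proof. exact: tnth_mktuple. Qed.

Lemma dotp_hatr x y : dotp x (hat y) = dotp x y * dotp y y `^ (- 2^-1).
Proof. by rewrite /dotp mulr_suml; apply: eq_bigr => k _; rewrite tnth_hat mulrA. Qed.

Lemma hat_norm_gt0 x : dotp x x != 0 -> 0 < dotp x x `^ (- 2^-1).
Proof. by move=> x0; rewrite powR_gt0 // lt_neqAle eq_sym x0 dotp_ge0. Qed.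

Lemma dotp_hat x : dotp (hat x) (hat x) = (dotp x x != 0)%:R.
Proof.
rewrite dotp_hatr dotpC dotp_hatr -mulrA -powRD; last first.
  by apply/implyP => /eqP h; exfalso; lra.
have -> : - 2^-1 + - 2^-1 = -1 :> R by lra.
have [->|x0] := eqVneq (dotp x x) 0; first by rewrite mul0r.
by rewrite powR_inv1 ?dotp_ge0 // divff.
Qed.

Lemma dotp_hat_le1 x : dotp (hat x) (hat x) <= 1.
Proof. by rewrite dotp_hat; case: (_ != _). Qed.

Lemma sg_dotp_hatr x y : Num.sg (dotp x (hat y)) = Num.sg (dotp x y).
Proof.
rewrite dotp_hatr sgrM; have [y0|y0] := eqVneq (dotp y y) 0; last first.
  by rewrite [Num.sg (_ `^ _)]gtr0_sg ?hat_norm_gt0 // mulr1.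
suff -> : dotp x y = 0 by rewrite sgr0 mul0r.
move/eqP: y0; rewrite dotp_eq0 => /forallP y0.
by apply: big1 => k _; rewrite (eqP (y0 k)) mulr0.
Qed.

Lemma hat_givens a b c s x : a != b -> c ^+ 2 + s ^+ 2 = 1 ->
  hat (givens a b c s x) = givens a b c s (hat x).
Proof.
move=> ab cs; apply: eq_from_tnth => k.
rewrite tnth_hat !tnth_givens dotp_givens // !tnth_hat.
by case: eqVneq => _; [|case: eqVneq => _ //]; ring.
Qed.

Lemma measurable_hat k : measurable_fun setT (fun x => tnth (hat x) k).
Proof.
under eq_fun do rewrite tnth_hat.
apply: measurable_funM; first exact: measurable_tnth.
apply: (measurableT_comp (f := fun t : R => t `^ (- 2^-1))) => //.
exact: measurable_dotp2.
Qed.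

Lemma bmeas_hat k : bmeas (fun x => tnth (hat x) k).
Proof.
split; first exact: measurable_hat.
exists 1 => x; rewrite -(@expr_le1 _ 2) // real_normK ?num_real //.
apply: le_trans (dotp_hat_le1 x); rewrite /dotp (bigD1 k) //= expr2 lerDl.
by apply: sumr_ge0 => j _; rewrite -expr2 sqr_ge0.
Qed.

End Direction.

Section InvariantLaw.
Variables (R : realType) (d : nat) (mu : probability (d.-tuple R) R).
Implicit Types (x y z : d.-tuple R).

(** Laws without atom at the origin that are invariant under the rotations of the
  coordinate planes. *)
Definition rotation_invariant : Prop :=
  mu [set x | dotp x x = 0] = 0%E /\
  forall (a b : 'I_d) c s, a != b -> c ^+ 2 + s ^+ 2 = 1 ->
  forall A, measurable A -> mu (givens a b c s @^-1` A) = mu A.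

Hypothesis mu_inv : rotation_invariant.

Lemma Ex_givens a b c s (f : d.-tuple R -> R) : a != b -> c ^+ 2 + s ^+ 2 = 1 ->
  bmeas f -> Ex mu (fun x => f (givens a b c s x)) = Ex mu f.
Proof.
move=> ab cs bf; have mg := measurable_givens a b c s.
pose mphi := isMeasurableFun.Build _ _ _ _ _ mg.
pose phi : {mfun _ >-> _} := HB.pack (givens a b c s) mphi.
have := Ex_pushforward mu phi bf => /= <-.
rewrite /Ex /Rintegral; congr fine; apply: eq_measure_integral => A mA _.
exact: (proj2 mu_inv).
Qed.

Lemma Ex_rotation rho (f : d.-tuple R -> R) : is_rotation rho -> bmeas f ->
  Ex mu (fun x => f (rho x)) = Ex mu f.
Proof.
move=> hr; elim: hr f => [//|r a b c s ab cs _ IH] f bf /=.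
rewrite (IH (fun x => f (givens a b c s x))).
  exact: Ex_givens.
by apply: bmeas_comp bf _; exact: measurable_givens.
Qed.

Lemma measurable_dotp_eq0 y : measurable [set x | dotp x y = 0].
Proof.
rewrite -[X in measurable X]setTI; have := measurable_dotp y.
by move=> /(_ measurableT [set 0]); apply; exact: measurable_set1.
Qed.

Lemma measurable_dotp2_eq0 : measurable [set x : d.-tuple R | dotp x x = 0].
Proof.
rewrite -[X in measurable X]setTI; have := @measurable_dotp2 R d.
by move=> /(_ measurableT [set 0]); apply; exact: measurable_set1.
Qed.

(* The probability that y is orthogonal to a random vector. By invariance it does
   not depend on y, as long as y is not 0. *)
Let tie y := Ex mu (\1_[set x | dotp x y = 0]).

Let tie_rotation rho y : is_rotation rho -> tie (rho y) = tie y.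
Proof.
move=> hr; rewrite /tie -(Ex_rotation hr); last first.
  by apply: bmeas_indic; exact: measurable_dotp_eq0.
apply: eq_Ex => x; rewrite !indicE; congr ((nat_of_bool _)%:R).
by apply/idP/idP; rewrite !inE /= dotp_rotation.
Qed.

Let tie_scale y p : p != 0 -> tie [tuple p * tnth y k | k < d] = tie y.
Proof.
move=> p0; apply: eq_Ex => x; rewrite !indicE; congr ((nat_of_bool _)%:R).
have E : dotp x [tuple p * tnth y k | k < d] = p * dotp x y.
  rewrite /dotp mulr_sumr; apply: eq_bigr => k _.
  by rewrite tnth_mktuple mulrCA.
apply/idP/idP; rewrite !inE /= E => /eqP; last by move=> /eqP ->; rewrite mulr0.
by rewrite mulf_eq0 (negbTE p0) => /eqP.
Qed.

Let tie_const (a b : 'I_d) y : a != b -> dotp y y != 0 ->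
  tie y = tie (planar a b (1 : R) 0).
Proof.
move=> ab y0; have [rho hr [p yp]] := rotation_axis y ab.
have p0 : p != 0.
  apply: contraNneq y0 => p0; rewrite -(dotp_rotation _ _ hr) yp p0.
  by rewrite dotp_planar // !mulr0 addr0.
rewrite -(tie_rotation _ hr) yp -(tie_scale (planar a b (1 : R) 0) p0).
congr tie; apply: eq_from_tnth => k; rewrite tnth_planar tnth_mktuple tnth_planar.
by case: ifP; rewrite ?mulr1 // if_same mulr0.
Qed.

(* The vectors (1, i, .., i^(d-1)) are in general position: the inner product of x
   with the i-th of them is a polynomial in i, of degree less than d. *)
Let tie_count m x : dotp x x != 0 ->
  \sum_(i < m) \1_[set x | dotp x [tuple (i%:R : R) ^+ k | k < d] = 0] x <= d%:R :> R.
Proof.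
move=> x0; pose p := \poly_(k < d) (nth 0 x k).
have px i : p.[i%:R] = dotp x [tuple (i%:R : R) ^+ k | k < d].
  rewrite horner_poly /dotp; apply: eq_bigr => k _.
  by rewrite tnth_mktuple (tnth_nth 0).
have p0 : p != 0.
  apply: contraNneq x0 => p0; rewrite dotp_eq0; apply/forallP => k.
  have : p`_k = 0 by rewrite p0 coef0.
  by rewrite coef_poly ltn_ord (tnth_nth 0) => ->.
pose rs := [seq (nat_of_ord i)%:R : R | i <- enum 'I_m & p.[(nat_of_ord i)%:R] == 0].
have : (size rs < size p)%N.
  apply: max_poly_roots => //.
    rewrite /rs all_map; apply/allP => i; rewrite mem_filter => /andP[h _].
    by rewrite /= /root.
  rewrite map_inj_in_uniq => [|i j _ _ /eqP]; first exact/filter_uniq/enum_uniq.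
  by rewrite eqr_nat => /eqP; exact: val_inj.
move=> /leq_trans /(_ (size_poly _ _)); rewrite size_map size_filter => /ltnW.
rewrite -(ler_nat R); apply: le_trans.
rewrite -sum1_count natr_sum big_enum_cond /= [X in _ <= X]big_mkcond /=.
apply: ler_sum => i _; rewrite indicE px.
by case: eqP => h; [case: (_ \in _); rewrite ?ler01|rewrite memNset].
Qed.

(** A random vector is almost surely not orthogonal to a given one: otherwise it
  would be orthogonal to more than [d] vectors in general position on average. *)
Lemma tie_null y : (1 < d)%N -> dotp y y != 0 -> mu [set x | dotp x y = 0] = 0%E.
Proof.
move=> d1 y0.
have [a [b ab]] : exists a b : 'I_d, a != b.
  by exists (Ordinal (ltnW d1)), (Ordinal d1).
suff t0 : tie y = 0.
  move: t0; rewrite /tie Ex_indic; last exact: measurable_dotp_eq0.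
  move=> h; rewrite -[LHS]fineK ?h // fin_num_measure //.
  exact: measurable_dotp_eq0.
pose v (i : nat) : d.-tuple R := [tuple (i%:R : R) ^+ k | k < d].
have v0 i : dotp (v i) (v i) != 0.
  rewrite dotp_eq0; apply/forallPn; exists (Ordinal (ltnW d1)).
  by rewrite tnth_mktuple expr0 oner_neq0.
have tv i : tie (v i) = tie y.
  by rewrite (tie_const ab) // (tie_const ab y0).
have bt i : bmeas (\1_[set x | dotp x (v i) = 0] : _ -> R).
  by apply: bmeas_indic; exact: measurable_dotp_eq0.
have ty0 : 0 <= tie y by apply: Ex_ge0 => x; rewrite indicE ler0n.
have hm m : m%:R * tie y <= d%:R.
  have -> : m%:R * tie y = Ex mu (fun x => \sum_(i < m) \1_[set x | dotp x (v i) = 0] x).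
    rewrite Ex_sum //; under eq_bigr do rewrite -/(tie (v _)) tv.
    by rewrite sumr_const card_ord mulr_natl.
  have bz : bmeas (\1_[set x : d.-tuple R | dotp x x = 0] : _ -> R).
    by apply: bmeas_indic; exact: measurable_dotp2_eq0.
  apply: (@le_trans _ _ (Ex mu (fun x => d%:R + m%:R * \1_[set x | dotp x x = 0] x))).
    apply: le_Ex => [||x].
    - exact: bmeas_sum.
    - by apply: bmeasD; [exact: bmeas_cst|exact: bmeasZ].
    have [x0|x0] := eqVneq (dotp x x) 0; last first.
      by apply: le_trans (tie_count m x0) _; rewrite lerDl mulr_ge0 // indicE.
    rewrite [X in _ + _ * X]indicE mem_set // mulr1.
    apply: ler_wpDl => //; rewrite -[X in _ <= X%:R]card_ord -sum1_card natr_sum.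
    by apply: ler_sum => i _; rewrite indicE; case: (_ \in _).
  rewrite ExD ?Ex_cst ?ExZ //; [|exact: bmeas_cst|exact: bmeasZ].
  rewrite Ex_indic; last exact: measurable_dotp2_eq0.
  by rewrite (proj1 mu_inv) /= mulr0 addr0.
apply/eqP; rewrite eq_le ty0 andbT leNgt; apply/negP => tpos.
have := hm (Num.truncn (d%:R / tie y)).+1.
by rewrite -ler_pdivlMr // leNgt truncnS_gt.
Qed.

End InvariantLaw.

(** * The correlation of signs *)

Section SignKernel.
Variables (R : realType) (d : nat) (mu : probability (d.-tuple R) R).
Hypotheses (mu_inv : rotation_invariant mu) (d1 : (1 < d)%N).
Implicit Types (x y z : d.-tuple R).

Lemma dotp_eq0l x y : dotp x x = 0 -> dotp x y = 0.
Proof.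
move/eqP; rewrite dotp_eq0 => /forallP x0; apply: big1 => k _.
by rewrite (eqP (x0 k)) mul0r.
Qed.

Lemma null_origin : mu [set x | dotp x x = 0] = 0%E.
Proof. exact: (proj1 mu_inv). Qed.

(** The directions are isotropic, with covariance [I / d]. *)
Lemma Ex_hat_mul (a b : 'I_d) :
  Ex mu (fun x => tnth (hat x) a * tnth (hat x) b) = (a == b)%:R / d%:R.
Proof.
have bm (i j : 'I_d) : bmeas (fun x => tnth (hat x) i * tnth (hat x) j).
  by apply: bmeasM; exact: bmeas_hat.
have [->|ab] := eqVneq a b; last first.
  rewrite mul0r; pose e := Ex mu (fun x => tnth (hat x) a * tnth (hat x) b).
  have : e = - e; last by rewrite /e; lra.
  have cs : (0 : R) ^+ 2 + 1 ^+ 2 = 1 by rewrite expr0n add0r expr1n.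
  rewrite {1}/e -(Ex_givens mu_inv ab cs) // -ExN //; apply: eq_Ex => x.
  rewrite hat_givens // !tnth_givens eqxx eq_sym (negbTE ab) eqxx.
  by rewrite !mul0r !mul1r sub0r addr0 mulNr mulrC.
have same (i j : 'I_d) : Ex mu (fun x => tnth (hat x) i * tnth (hat x) i) =
    Ex mu (fun x => tnth (hat x) j * tnth (hat x) j).
  have [->//|ij] := eqVneq i j.
  have cs : (0 : R) ^+ 2 + 1 ^+ 2 = 1 by rewrite expr0n add0r expr1n.
  rewrite -(Ex_givens mu_inv ij cs) //; apply: eq_Ex => x.
  by rewrite hat_givens // !tnth_givens eqxx !mul0r !mul1r sub0r mulrNN.
have d0 : d%:R != 0 :> R by rewrite pnatr_eq0 -lt0n ltnW.
apply: (mulfI d0); rewrite mul1r divff //.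
have <- : \sum_(i < d) Ex mu (fun x => tnth (hat x) i * tnth (hat x) i) =
    d%:R * Ex mu (fun x => tnth (hat x) b * tnth (hat x) b).
  by rewrite (eq_bigr _ (fun i _ => same i b)) sumr_const card_ord mulr_natl.
rewrite -Ex_sum //; apply: (etrans _ (Ex_cst mu 1)).
apply: (null_eq_Ex (@measurable_dotp2_eq0 R d) null_origin).
- exact: bmeas_sum.
- exact: bmeas_cst.
by move=> x /= /eqP x0; have := dotp_hat x; rewrite x0.
Qed.

(** The correlation of the signs of [<x, y>] and [<x, z>] for a random [x]. *)
Definition sgK y z : R := Ex mu (fun x => Num.sg (dotp x y) * Num.sg (dotp x z)).

Lemma bmeas_sg_dotp y : bmeas (fun x => Num.sg (dotp x y)).
Proof. by apply: bmeas_sg; exact: measurable_dotp. Qed.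

Lemma bmeas_sgK y z : bmeas (fun x => Num.sg (dotp x y) * Num.sg (dotp x z)).
Proof. by apply: bmeasM; exact: bmeas_sg_dotp. Qed.

Lemma sgKC y z : sgK y z = sgK z y.
Proof. by apply: eq_Ex => x; rewrite mulrC. Qed.

Lemma sgK_rotation rho y z : is_rotation rho -> sgK (rho y) (rho z) = sgK y z.
Proof.
move=> hr; rewrite /sgK -(Ex_rotation mu_inv hr); last exact: bmeas_sgK.
by apply: eq_Ex => x; rewrite !dotp_rotation.
Qed.

Lemma sgK_givens (a b : 'I_d) c s y z : a != b -> c ^+ 2 + s ^+ 2 = 1 ->
  sgK (givens a b c s y) (givens a b c s z) = sgK y z.
Proof.
move=> ab cs; apply: (@sgK_rotation (givens a b c s \o id)).
by apply: rotation_comp => //; exact: rotation_id.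
Qed.

Lemma sgK_hat y z : sgK (hat y) (hat z) = sgK y z.
Proof. by apply: eq_Ex => x; rewrite !sg_dotp_hatr. Qed.

(** The opposite of a tuple. *)
Definition negt z : d.-tuple R := [tuple - tnth z k | k < d].

Lemma dotp_negt x z : dotp x (negt z) = - dotp x z.
Proof. by rewrite -sumrN; apply: eq_bigr => k _; rewrite tnth_mktuple mulrN. Qed.

Lemma sgK_negt y z : sgK y (negt z) = - sgK y z.
Proof.
rewrite /sgK -ExN; last exact: bmeas_sgK.
by apply: eq_Ex => x; rewrite dotp_negt sgrN mulrN.
Qed.

Section Plane.
Variables (a b : 'I_d).
Hypothesis ab : a != b.
(* The unit vector at angle t in the plane of the axes a and b, and the correlation
   of signs at angular distance t. *)
Let pl t := planar a b (cos t : R) (sin t).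
Let psi t := sgK (pl 0) (pl t).

Let dotp_pl x t : dotp x (pl t) = tnth x a * cos t + tnth x b * sin t.
Proof. exact: dotp_planar. Qed.

Let pl_neq0 t : dotp (pl t) (pl t) != 0.
Proof.
rewrite dotp_pl !tnth_planar eqxx [b == a]eq_sym (negbTE ab) eqxx -!expr2 cos2Dsin2.
exact: oner_neq0.
Qed.

Let sgK_pl s t : sgK (pl s) (pl t) = psi (t - s).
Proof.
have cs : cos s ^+ 2 + (- sin s) ^+ 2 = 1 :> R by rewrite sqrrN cos2Dsin2.
rewrite /psi -(sgK_givens (pl s) (pl t) ab cs) !givens_planar //.
congr (sgK _ _); congr planar.
- by rewrite cos0 mulNr opprK -!expr2 cos2Dsin2.
- by rewrite sin0; ring.
- by rewrite cosB; ring.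
- by rewrite sinB; ring.
Qed.

(* If B is a nonnegative combination of A and C, its sign agrees with one of
   theirs. *)
Let sg_additive (A B C al be ga : R) : A != 0 -> B != 0 -> C != 0 ->
  0 <= al -> 0 <= be -> 0 < ga -> ga * B = al * A + be * C ->
  1 - Num.sg A * Num.sg C = (1 - Num.sg A * Num.sg B) + (1 - Num.sg B * Num.sg C).
Proof.
move=> A0 B0 C0 al0 be0 ga0 E.
have sgE (u : R) : u != 0 -> (0 < u) && (Num.sg u == 1) || (u < 0) && (Num.sg u == -1).
  by case: (ltgtP u 0) => // h _; [rewrite ltr0_sg|rewrite gtr0_sg]; rewrite ?h ?eqxx ?orbT.
have [/orP[]/andP[hA /eqP ->] /orP[]/andP[hB /eqP ->] /orP[]/andP[hC /eqP ->]] :=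
  And3 (sgE A A0) (sgE B B0) (sgE C C0); try by lra.
- suff : 0 <= ga * B by rewrite pmulr_rge0 // leNgt hB.
  by rewrite E addr_ge0 // mulr_ge0 // ltW.
- suff : ga * B <= 0 by rewrite pmulr_rle0 // leNgt hB.
  by rewrite E -oppr_ge0 opprD addr_ge0 // -mulrN mulr_ge0 // oppr_ge0 ltW.
Qed.

Let psi0 : psi 0 = 1.
Proof.
rewrite /psi /sgK; apply: (etrans _ (Ex_cst mu 1)).
apply: (null_eq_Ex (measurable_dotp_eq0 (pl 0)) (tie_null mu_inv d1 (pl_neq0 0))).
- exact: bmeas_sgK.
- exact: bmeas_cst.
by move=> x /= /eqP h; rewrite -expr2 sqr_sg h.
Qed.

(* For s + t at most a right angle, the direction pl s is a nonnegative combination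
   of pl 0 and pl (s + t): the linear form of x changes sign at most once on the
   arc. *)
Let chi_additive s t : 0 <= s -> 0 <= t -> s + t <= pi / 2 ->
  1 - psi (s + t) = (1 - psi s) + (1 - psi t).
Proof.
move=> s0 t0 st.
have [s00|s_neq0] := eqVneq s 0; first by rewrite s00 psi0 add0r subrr add0r.
have spos : 0 < s by rewrite lt_neqAle eq_sym s_neq0.
have pi0 := @pi_gt0 R.
have hpi : pi / 2 < pi :> R by rewrite ltr_pdivrMr //; lra.
have -> : psi t = sgK (pl s) (pl (s + t)) by rewrite sgK_pl addrAC subrr add0r.
have E1 u v : 1 - sgK u v = Ex mu (fun=> 1) - sgK u v by rewrite Ex_cst.
rewrite /psi !E1 /sgK.
have bc : bmeas (fun _ : d.-tuple R => 1 : R) by exact: bmeas_cst.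
have bK := bmeas_sgK.
rewrite -!ExB // -ExD; [|exact: bmeasB|exact: bmeasB].
pose N t := [set x | dotp x (pl t) = 0].
have mN u : measurable (N u) by exact: measurable_dotp_eq0.
have N0 u : mu (N u) = 0%E by exact: tie_null.
apply: (@null_eq_Ex _ _ _ _ _ _ (N 0 `|` N s `|` N (s + t))).
- by apply: measurableU; [apply: measurableU|]; exact: mN.
- have mU : measurable (N 0 `|` N s) by apply: measurableU; exact: mN.
  apply: etrans (measureU0 mU (mN _) (N0 _)) _.
  exact: etrans (measureU0 (mN _) (mN _) (N0 _)) (N0 _).
- exact: bmeasB.
- by apply: bmeasD; exact: bmeasB.
move=> x /= h.
apply: (@sg_additive _ _ _ (sin t) (sin s) (sin (s + t))).
- by apply/eqP => h0; apply: h; left; left.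
- by apply/eqP => h0; apply: h; left; right.
- by apply/eqP => h0; apply: h; right.
- by apply: sin_ge0_pi; apply/andP; split => //; lra.
- by apply: sin_ge0_pi; apply/andP; split => //; lra.
- by apply: sin_gt0_pi; apply/andP; split; lra.
rewrite !dotp_pl cos0 sin0 sinD cosD.
(* The identity sin (s + t) pl s = sin t pl 0 + sin s pl (s + t). *)
have c2 := cos2sin2 s; ring : c2.
Qed.

(* The quarter turn takes (pl 0, pl (pi / 2)) to (pl (pi / 2), - pl 0). *)
Let psi_pihalf : psi (pi / 2) = 0.
Proof.
have cs : (0 : R) ^+ 2 + 1 ^+ 2 = 1 by rewrite expr0n add0r expr1n.
have E : psi (pi / 2) = - psi (pi / 2).
  rewrite {2}/psi -sgK_negt -(sgK_givens (pl 0) _ ab cs) sgKC /psi.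
  congr (sgK _ _); rewrite /pl cos0 sin0 cos_pihalf sin_pihalf.
    apply: eq_from_tnth => k; rewrite tnth_givens !tnth_mktuple.
    rewrite eqxx [b == a]eq_sym (negbTE ab) eqxx oppr0 mul0r mul1r.
    by case: (k == a); last case: (k == b);
      rewrite ?mul0r ?mulr0 ?mul1r ?addr0 ?oppr0 ?sub0r ?opprK.
  by rewrite givens_planar // !mul0r !mul1r subr0 addr0.
lra.
Qed.

(** The correlation of signs is affine in the angle: it is bounded, and [1 - psi] is
  additive. *)
Lemma sgK_plane t : 0 <= t -> t <= pi / 2 ->
  sgK (planar a b 1 0) (planar a b (cos t) (sin t)) = 1 - 2 / pi * t.
Proof.
have pi0 := @pi_gt0 R; have pi20 : 0 < pi / 2 :> R by rewrite divr_gt0.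
move=> t0 th.
have bd u : `|1 - psi u| <= 2.
  rewrite (le_trans (ler_normB _ _)) // normr1 -[2]/(1 + 1) lerD2l.
  apply: abs_Ex_le; first exact: bmeas_sgK.
  move=> x; rewrite normrM -[X in _ <= X]mulr1 ler_pM //.
  - by rewrite normr_sg; case: (_ != _).
  - by rewrite normr_sg; case: (_ != _).
have := additive_bounded_linear pi20 chi_additive bd t0 th.
rewrite psi_pihalf subr0 mulr1 {1}/psi /pl cos0 sin0 => E.
by rewrite mulrC -invf_div -E opprB addrCA subrr addr0.
Qed.
End Plane.

Let acos_pihalf (t : R) : 0 <= t -> t <= 1 -> 0 <= acos t <= pi / 2.
Proof.
move=> t0 t1.
have t11 : -1 <= t <= 1 by rewrite t1 andbT (le_trans _ t0) // lerN10.
rewrite acos_ge0 //= -acos0.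
have [//|h] := leP (acos t) (acos 0).
have : cos (acos t) < cos (acos 0).
  by rewrite ltr_cos // in_itv /= ?acos_ge0 ?acos_lepi // lerN10 ler01.
by rewrite !acosK ?in_itv //= ?lerN10 ?ler01 // ltNge t0.
Qed.

Let sgK_unit y z : dotp y y = 1 -> dotp z z = 1 -> 0 <= dotp y z ->
  sgK y z = 1 - 2 / pi * acos (dotp y z).
Proof.
move=> yy zz yz0; set t := dotp y z.
have [a [b ab]] : exists a b : 'I_d, a != b.
  by exists (Ordinal (ltnW d1)), (Ordinal d1).
have [rho hr [p [q [r [yE zE]]]]] := rotation_plane y z ab.
have pl2 u v u' v' : dotp (planar a b u v : d.-tuple R) (planar a b u' v') = u * u' + v * v'.
  by rewrite dotp_planar // !tnth_planar eqxx [b == a]eq_sym (negbTE ab) eqxx.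
have p2 : p * p = 1 by rewrite -yy -(dotp_rotation y y hr) yE pl2; ring.
have pq : p * q = t by rewrite /t -(dotp_rotation y z hr) yE zE pl2; ring.
have qr : q ^+ 2 + r ^+ 2 = 1 by rewrite -zz -(dotp_rotation z z hr) zE pl2; ring.
have p2' : p ^+ 2 + 0 ^+ 2 = 1 by rewrite -p2; ring.
have KE : sgK y z = sgK (planar a b 1 0) (planar a b t (p * r)).
  rewrite -(sgK_rotation y z hr) yE zE.
  rewrite -(sgK_givens (planar a b p 0) (planar a b q r) ab p2') !givens_planar //.
  by rewrite p2 pq !mul0r !mulr0 !subr0 !add0r.
have tr : t ^+ 2 + (p * r) ^+ 2 = 1.
  by rewrite -pq !exprMn -mulrDr qr mulr1 expr2.
have t1 : t <= 1.
  by rewrite -(@expr_le1 _ 2) // -tr lerDl sqr_ge0.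
have t11 : -1 <= t <= 1 by rewrite t1 andbT (le_trans _ yz0) // lerN10.
have KE' : sgK y z = sgK (planar a b 1 0) (planar a b t `|p * r|).
  rewrite KE; have [//|h] := ger0P (p * r).
  have tr' : t ^+ 2 + (- (p * r)) ^+ 2 = 1 by rewrite sqrrN.
  rewrite sgKC -(sgK_givens (planar a b t (p * r)) (planar a b 1 0) ab tr').
  rewrite !givens_planar //; congr (sgK _ _); congr planar.
  - by rewrite -tr; ring.
  - by ring.
  - by ring.
  - by ring.
have /andP[ac0 ac1] := acos_pihalf yz0 t1.
rewrite KE' -(sgK_plane ab ac0 ac1); congr sgK; congr planar.
  by rewrite acosK // in_itv.
rewrite sin_acos // -sqrtr_sqr; congr Num.sqrt.
by apply/eqP; rewrite eq_sym subr_eq addrC tr.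
Qed.

(** Up to a quadratic error, the sign correlation is linear in the cosine
  of the angle between the two directions. *)
Lemma sgK_linear_approx y z :
  `|sgK y z - 2 / pi * dotp (hat y) (hat z)| <= dotp (hat y) (hat z) ^+ 2.
Proof.
wlog t0 : z / 0 <= dotp (hat y) (hat z).
  move=> W; have [|h] := leP 0 (dotp (hat y) (hat z)); first exact: W.
  have hn : dotp (hat y) (hat (negt z)) = - dotp (hat y) (hat z).
    have nn : dotp (negt z) (negt z) = dotp z z.
      by rewrite dotp_negt dotpC dotp_negt opprK.
    by rewrite dotp_hatr dotp_negt nn mulNr -dotp_hatr.
  have := W (negt z); rewrite hn sgK_negt oppr_ge0 => /(_ (ltW h)).
  by rewrite mulrN -opprD normrN sqrrN.
have zero u v : dotp u u = 0 -> sgK u v = 0 /\ dotp (hat u) (hat v) = 0.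
  move=> u0; split.
    rewrite -[RHS](Ex_cst mu 0); apply: eq_Ex => x.
    by rewrite dotpC dotp_eq0l // sgr0 mul0r.
  by apply: dotp_eq0l; rewrite dotp_hat u0 eqxx.
have [y0|y0] := eqVneq (dotp y y) 0.
  have [-> ->] := zero y z y0.
  by rewrite mulr0 subrr normr0 expr0n.
have [z0|z0] := eqVneq (dotp z z) 0.
  have [h1 h2] := zero z y z0.
  by rewrite sgKC h1 dotpC h2 mulr0 subrr normr0 expr0n.
have hy : dotp (hat y) (hat y) = 1 by rewrite dotp_hat y0.
have hz : dotp (hat z) (hat z) = 1 by rewrite dotp_hat z0.
rewrite -sgK_hat sgK_unit //.
have t1 : dotp (hat y) (hat z) <= 1.
  have : 0 <= \sum_k (tnth (hat y) k - tnth (hat z) k) ^+ 2.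
    by apply: sumr_ge0 => k _; exact: sqr_ge0.
  have -> : \sum_k (tnth (hat y) k - tnth (hat z) k) ^+ 2 =
      dotp (hat y) (hat y) + dotp (hat z) (hat z) - 2 * dotp (hat y) (hat z).
    rewrite /dotp mulr_sumr -big_split -sumrB /=.
    by apply: eq_bigr => k _; ring.
  by rewrite hy hz subr_ge0 -[1 + 1]/(2 : R) ger_pMr.
move: (dotp _ _) t0 t1 => t t0 t1.
have pi0 := @pi_gt0 R.
have /andP[ac0 ac1] := acos_pihalf t0 t1.
have := @sin_linear_approx R (pi / 2 - acos t).
rewrite sinB sin_pihalf cos_pihalf mul1r mul0r subr0 acosK; last first.
  by rewrite in_itv /= t1 andbT (le_trans _ t0) // lerN10.
rewrite mulrBr mulf_div [2 * pi]mulrC divff ?mulf_neq0 ?gt_eqF //; apply.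
- by rewrite subr_ge0.
- by rewrite lerBlDr lerDl.
Qed.

End SignKernel.

(** * The uniform law on the sphere and the Gaussian law are rotation invariant *)

Section SphereLaw.
Variables (R : realType) (d : nat).

Lemma uniform_sphere_rotation_invariant (mu : probability (d.-tuple R) R) :
  uniform_sphere_law mu -> rotation_invariant mu.
Proof.
move=> [mu1 muO]; split.
  have m1 : measurable [set v : d.-tuple R | dotp v v = 1].
    rewrite -[X in measurable X]setTI; have := @measurable_dotp2 R d.
    by move=> /(_ measurableT [set 1]); apply; exact: measurable_set1.
  have h := probability_setC mu m1; rewrite mu1 subee // in h.
  apply/eqP; rewrite eq_le measure_ge0 andbT -h le_measure ?inE //.
  - exact: measurable_dotp2_eq0.
  - exact: measurableC.
  - by move=> x /= ->; apply/eqP; rewrite eq_sym oner_neq0.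
move=> a b c s ab cs A mA.
(* O is the matrix of the plane rotation, read on the canonical basis. *)
pose e (l : 'I_d) : d.-tuple R := [tuple (k == l)%:R | k < d].
pose O : 'M[R]_d := \matrix_(k, l) tnth (givens a b c s (e l)) k.
have OO : O *m O^T = 1%:M.
  apply: mulmx1C; apply/matrixP => i j; rewrite mxE.
  transitivity (dotp (givens a b c s (e i)) (givens a b c s (e j))).
    by apply: eq_bigr => k _; rewrite !mxE.
  rewrite dotp_givens // mxE /dotp (bigD1 i) //= !tnth_mktuple eqxx mul1r.
  by rewrite big1 ?addr0 // => k /negbTE ki; rewrite tnth_mktuple ki mul0r.
rewrite -(muO O OO A mA); congr (mu (_ @^-1` A)); apply/funext => v.
have sume (k : 'I_d) : \sum_l tnth (e l) k * tnth v l = tnth v k.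
  rewrite (bigD1 k) //= tnth_mktuple eqxx mul1r big1 ?addr0 // => l lk.
  by rewrite tnth_mktuple eq_sym (negbTE lk) mul0r.
apply: eq_from_tnth => k; rewrite [in RHS]tnth_mktuple tnth_givens -!sume.
under [RHS]eq_bigr do rewrite mxE tnth_givens.
case: (k == a); last case: (k == b) => //.
  by rewrite !mulr_sumr -sumrB; apply: eq_bigr => l _; ring.
by rewrite !mulr_sumr -big_split; apply: eq_bigr => l _ /=; ring.
Qed.

End SphereLaw.

Section LebesguePlane.
Variable R : realType.
Local Notation leb := (@lebesgue_measure R).
Local Open Scope ereal_scope.

Lemma measurable_affine (a b : R) : measurable_fun setT (fun x : R => a * x + b)%R.
Proof. by apply: measurable_funD => //; exact: measurable_funM. Qed.

Let aff (a b : R) (x : measurableTypeR R) : measurableTypeR R := (a * x + b)%R.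

Let measurable_aff a b : measurable_fun setT (aff a b).
Proof. exact: measurable_affine. Qed.

Let affm a b := pushforward leb (aff a b).
HB.instance Definition _ a b := Measure.copy (affm a b)
  (measure_function_pushforward__canonical__measure_function_Measure leb (measurable_aff a b)).

Lemma lebesgue_affine (a b : R) (A : set R) : a != 0%R -> measurable A ->
  leb A = `|a|%:E * leb ((fun x => a * x + b)%R @^-1` A).
Proof.
move=> a0 mA.
have an : (0 <= `|a|)%R by [].
pose m2 := mscale (NngNum an) (affm a b).
suff -> : leb A = m2 A by [].
apply: lebesgue_measure_unique => // _ [[u v]] _ <-.
change (leb `]u, v]%classic = `|a|%:E * leb (aff a b @^-1` `]u, v]%classic)).
have [a_gt0|a_lt0|/esym/eqP] := ltgtP 0%R a; last by rewrite (negbTE a0).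
  have -> : aff a b @^-1` `]u, v] = [set` `]((u - b) / a)%R, ((v - b) / a)%R]].
    apply/seteqP; split => x /=; rewrite !in_itv /= /aff.
      by rewrite ltr_pdivrMr // ler_pdivlMr // ltrBlDr lerBrDr mulrC.
    by rewrite ltr_pdivrMr // ler_pdivlMr // ltrBlDr lerBrDr mulrC.
  rewrite !lebesgue_measure_itv /= !lte_fin ltr_pM2r ?invr_gt0 // ltrD2r.
  case: ifP => _; last by rewrite mule0.
  by rewrite -!EFinB -EFinM; congr EFin; rewrite gtr0_norm //; field.
have -> : aff a b @^-1` `]u, v] = [set` `[((v - b) / a)%R, ((u - b) / a)%R[].
  apply/seteqP; split => x /=; rewrite !in_itv /= /aff.
    by rewrite ltr_ndivlMr // ler_ndivrMr // ltrBlDr lerBrDr mulrC andbC.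
  by rewrite ltr_ndivlMr // ler_ndivrMr // ltrBlDr lerBrDr mulrC andbC.
rewrite !lebesgue_measure_itv /= !lte_fin ltr_nM2r ?invr_lt0 // ltrD2r.
case: ifP => _; last by rewrite mule0.
by rewrite -!EFinB -EFinM; congr EFin; rewrite ltr0_norm //; field.
Qed.

Lemma integral_affine (a b : R) (f : R -> \bar R) : a != 0%R ->
  measurable_fun setT f -> (forall x, 0 <= f x) ->
  \int[leb]_x f x = `|a|%:E * \int[leb]_x f (a * x + b)%R.
Proof.
move=> a0 mf f0.
have an : (0 <= `|a|)%R by [].
rewrite (@eq_measure_integral _ _ _ setT (mscale (NngNum an) (affm a b))).
  by rewrite ge0_integral_mscale //= ge0_integral_pushforward.
by move=> A mA _; exact: lebesgue_affine.
Qed.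

(** Lebesgue measure of the plane is rotation invariant: a rotation with [c != 0] is
  a composition of shears and dilations of the axes. *)
Lemma integral_plane_rotation (c s : R) (F : R * R -> \bar R) :
  (c ^+ 2 + s ^+ 2 = 1)%R -> measurable_fun setT F -> (forall z, 0 <= F z) ->
  \int[leb]_x \int[leb]_y F (c * x - s * y, s * x + c * y)%R =
  \int[leb]_x \int[leb]_y F (x, y).
Proof.
move=> cs mF F0.
have mF2 (g h : R * R -> R) : measurable_fun setT g -> measurable_fun setT h ->
    measurable_fun setT (fun z => F (g z, h z)).
  by move=> mg mh; apply: (measurableT_comp mF); exact: measurable_fun_pair.
have mlin (a b : R) : measurable_fun setT (fun z : R * R => a * z.1 + b * z.2)%R.
  by apply: measurable_funD; apply: measurable_funM.
transitivity (\int[leb]_y \int[leb]_x F (c * x - s * y, s * x + c * y)%R).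
  apply: (fubini_tonelli (m1 := leb) (m2 := leb)
    (fun z : R * R => F (c * z.1 - s * z.2, s * z.1 + c * z.2)%R)) => //.
  apply: mF2; last exact: mlin.
  by have := mlin c (- s)%R; apply: eq_measurable_fun => z _ /=; rewrite mulNr.
have msec1 (g : R -> R) (h : R -> R) : measurable_fun setT g -> measurable_fun setT h ->
    measurable_fun setT (fun x => F (g x, h x)).
  by move=> mg mh; apply: (measurableT_comp mF); exact: measurable_fun_pair.
(* For c = 0, the rotation is a quarter turn and exchanges the axes. *)
have [c0|c0] := eqVneq c 0%R.
  have s1 : `|s|%R = 1%R.
    apply/eqP; rewrite -(@eqrXn2 _ 2) // expr1n real_normK ?num_real //.
    by rewrite -cs c0 expr0n add0r.
  have s0 : s != 0%R by rewrite -normr_eq0 s1 oner_neq0.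
  have inner y : \int[leb]_x F (c * x - s * y, s * x + c * y)%R =
      \int[leb]_x F ((- s * y + 0)%R, x).
    rewrite (@integral_affine s 0 (fun x => F ((- s * y + 0)%R, x))) //; last first.
      by apply: msec1.
    rewrite s1 mul1e; apply: eq_integral => x _.
    by rewrite c0 !mul0r sub0r mulNr !addr0.
  under eq_integral do rewrite inner.
  rewrite [RHS](@integral_affine (- s)%R 0 (fun u => \int[leb]_x F (u, x))) ?oppr_eq0 //.
  - by rewrite normrN s1 mul1e.
  - exact: (measurable_fun_fubini_tonelli_F (m2 := leb) F mF F0).
  - by move=> u; exact: integral_ge0.
(* Substitute c x - s y for x at fixed y, then s x + c y for y at fixed x. *)
pose G (z : R * R) := (`|c^-1|%:E * F (z.1, c^-1 * z.2 + s * z.1 / c)%R).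
have mG : measurable_fun setT G.
  apply: measurable_funeM; apply: mF2; first exact: measurable_fst.
  have := mlin (s / c)%R c^-1%R; apply: eq_measurable_fun => z _ /=.
  by rewrite addrC mulrAC.
have G0 z : 0 <= G z by rewrite mule_ge0 // lee_fin.
have ci0 : c^-1%R != 0%R by rewrite invr_eq0.
transitivity (\int[leb]_y \int[leb]_x G (x, y)).
  apply: eq_integral => y _.
  rewrite (@integral_affine c^-1 (s * y / c)%R); last 3 first.
  - exact: ci0.
  - apply: msec1.
      by have := measurable_affine c (- (s * y))%R.
    by have := measurable_affine s (c * y)%R.
  - by move=> x; exact: F0.
  rewrite -ge0_integralZl //=; last first.
    have maff : measurable_fun setT (fun x => c^-1 * x + s * y / c)%R.
      exact: measurable_affine.
    apply: msec1.
      by apply: measurable_funB => //; exact: measurable_funM.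
    by apply: measurable_funD => //; exact: measurable_funM.
  apply: eq_integral => x _; rewrite /G /=; congr (_ * F (_, _)); first by field.
  transitivity ((s * x + (c ^+ 2 + s ^+ 2) * y) / c)%R; first by field.
  by rewrite cs; field.
apply: etrans (esym (fubini_tonelli (m1 := leb) (m2 := leb) G mG G0)) _.
apply: eq_integral => x _.
rewrite [RHS](@integral_affine c^-1 (s * x / c)%R) //; last exact: msec1.
rewrite -ge0_integralZl //; apply: msec1 => //.
exact: measurable_affine.
Qed.

End LebesguePlane.

Section GaussianLaw.
Variables (R : realType) (d : nat).
Local Notation leb := (@lebesgue_measure R).
Local Open Scope ereal_scope.

Lemma integral_normal_prob_density (m sigma : R) (f : R -> \bar R) :
  measurable_fun setT f -> (forall x, 0 <= f x) ->
  \int[normal_prob m sigma]_x f x =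
  \int[leb]_x (f x * (normal_pdf m sigma x)%:E).
Proof.
move=> mf f0; have dom := normal_prob_dominates m sigma.
have := Radon_Nikodym_SigmaFinite.change_of_variables dom f0 measurableT mf.
move=> <-; set g := Radon_Nikodym_SigmaFinite.f _ _.
have gi := Radon_Nikodym_SigmaFinite.f_integrable dom.
have mpdf : measurable_fun setT (EFin \o normal_pdf m sigma).
  by apply/measurable_EFinP; exact: measurable_normal_pdf.
apply: ae_eq_integral => //.
- by apply: emeasurable_funM => //; exact: measurable_int gi.
- exact: emeasurable_funM.
apply: ae_eqe_mul2l; apply: integral_ae_eq => // A _ mA.
by rewrite -(Radon_Nikodym_SigmaFinite.f_integral dom mA).
Qed.

(** The product of two centred normal laws of equal variance is invariant under
  the rotations of the plane. *)
Lemma normal_prob_plane_rotation (sigma c s : R) (H : R * R -> \bar R) :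
  (sigma != 0)%R -> (c ^+ 2 + s ^+ 2 = 1)%R ->
  measurable_fun setT H -> (forall z, 0 <= H z) ->
  \int[normal_prob 0 sigma]_x \int[normal_prob 0 sigma]_y
     H (c * x - s * y, s * x + c * y)%R =
  \int[normal_prob 0 sigma]_x \int[normal_prob 0 sigma]_y H (x, y).
Proof.
move=> sg0 cs mH H0.
pose p := normal_pdf 0 sigma.
have mp : measurable_fun setT p := measurable_normal_pdf 0 sigma.
have p0 x : (0 <= p x)%R := normal_pdf_ge0 0 sigma x.
have toleb (K : R * R -> \bar R) : measurable_fun setT K -> (forall z, 0 <= K z) ->
    \int[normal_prob 0 sigma]_x \int[normal_prob 0 sigma]_y K (x, y) =
    \int[leb]_x \int[leb]_y (K (x, y) * (p x * p y)%:E).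
  move=> mK K0.
  have mKx x : measurable_fun setT (fun y => K (x, y)).
    exact: measurableT_comp mK (measurable_pair1 x).
  rewrite integral_normal_prob_density.
  - apply: eq_integral => x _; rewrite integral_normal_prob_density //.
    rewrite -ge0_integralZr //; last 3 first.
    + by apply: emeasurable_funM; [exact: mKx|exact/measurable_EFinP].
    + by move=> y _; rewrite mule_ge0 // lee_fin.
    + by rewrite lee_fin.
    by apply: eq_integral => y _; rewrite -muleA -EFinM [in RHS]mulrC.
  - exact: (measurable_fun_fubini_tonelli_F (m2 := normal_prob 0 sigma) K mK K0).
  - by move=> x; exact: integral_ge0.
have mrot : measurable_fun setT (fun z : R * R => (c * z.1 - s * z.2, s * z.1 + c * z.2)%R).
  apply: measurable_fun_pair.
    by apply: measurable_funB; apply: measurable_funM.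
  by apply: measurable_funD; apply: measurable_funM.
have mHrot := measurableT_comp mH mrot.
apply: etrans (toleb _ mHrot (fun z => H0 _)) _.
apply: etrans _ (esym (toleb _ mH H0)).
pose F (z : R * R) := H z * (p z.1 * p z.2)%:E.
have mF : measurable_fun setT F.
  apply: emeasurable_funM => //; apply/measurable_EFinP; apply: measurable_funM.
    exact: (measurableT_comp mp measurable_fst).
  exact: (measurableT_comp mp measurable_snd).
have F0 z : 0 <= F z by rewrite mule_ge0 // lee_fin mulr_ge0.
apply: etrans _ (integral_plane_rotation cs mF F0).
apply: eq_integral => x _; apply: eq_integral => y _; congr (_ * _%:E).
  rewrite /p normal_pdfE // /normal_fun mulrACA [in RHS]mulrACA -!expRD; congr (_ * expR _)%R.
  rewrite !subr0 -!mulrDl; congr (_ / _)%R.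
  rewrite -!opprD; congr (- _)%R.
  transitivity ((c ^+ 2 + s ^+ 2) * (x ^+ 2 + y ^+ 2))%R; first by rewrite cs mul1r.
  by rewrite /=; ring.
Qed.

Let idR (x : measurableTypeR R) : R := x.
Let measurable_idR : measurable_fun setT idR.
Proof. by move=> _ Y mY; rewrite setTI; exact: mY. Qed.
HB.instance Definition _ := isMeasurableFun.Build _ _ _ _ idR measurable_idR.

(** The centred normal law of standard deviation [sigma], on the measurable space
  [R] itself rather than on its alias [measurableTypeR R]. *)
Definition centred_normal (sigma : R) : probability R R :=
  distribution (normal_prob 0 sigma) idR.

Lemma integral_centred_normal sigma (f : R -> \bar R) :
  measurable_fun setT f -> (forall x, 0 <= f x) ->
  \int[centred_normal sigma]_x f x = \int[normal_prob 0 sigma]_x f x.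
Proof. by move=> mf f0; rewrite ge0_integral_distribution. Qed.

Lemma gaussian_rotation_invariant (mu : probability (d.-tuple R) R) :
  (0 < d)%N -> gaussian_law mu -> rotation_invariant mu.
Proof.
move=> d0 muG; set sigma := ((Num.sqrt d%:R)^-1)%R : R.
have sg0 : sigma != 0%R by rewrite invr_eq0 sqrtr_eq0 -ltNge ltr0n.
pose ga := centred_normal sigma.
have prod_law (A : 'I_d -> set R) : (forall i, measurable (A i)) ->
  mu [set v | forall i, A i (tnth v i)] = \prod_(i < d) ga (A i).
  exact: muG.
split.
  (* The origin has a null first coordinate. *)
  pose a := Ordinal d0; pose A (k : 'I_d) : set R := if k == a then [set 0%R] else setT.
  have mA k : measurable (A k) by rewrite /A; case: ifP.
  apply/eqP; rewrite eq_le measure_ge0 andbT.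
  apply: (@le_trans _ _ (mu [set v | forall i, A i (tnth v i)])).
    apply: le_measure; rewrite ?inE.
    - exact: measurable_dotp2_eq0.
    - by rewrite rectangles_generate; apply: sub_sigma_algebra; exists A.
    move=> v /= /eqP; rewrite dotp_eq0 => /forallP h i.
    by rewrite /A; case: eqP => // _; exact/eqP/h.
  rewrite prod_law // (bigD1 a) //= {1}/A eqxx.
  have -> : ga [set 0%R] = 0 by exact: integral_set1.
  by rewrite mul0e.
move=> a b c s ab cs A mA.
have ba : b != a by rewrite eq_sym.
pose f : d.-tuple R -> \bar R := fun v => (\1_A v)%:E.
have mf : measurable_fun setT f by apply/measurable_EFinP; exact: measurable_indic.
have f0 v : 0 <= f v by rewrite lee_fin indicE ler0n.
(* Integrate the coordinates a and b first. *)
pose upd2 (v : d.-tuple R) (x y : R) := upd (upd v a x) b y.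
have resample2 g : measurable_fun setT g -> (forall v, 0 <= g v) ->
    \int[mu]_v g v = \int[mu]_v \int[ga]_x \int[ga]_y g (upd2 v x y).
  move=> mg g0; rewrite (resample_integral prod_law b mg g0).
  rewrite (resample_integral prod_law a) //.
    apply: (measurable_fun_fubini_tonelli_G (m1 := ga)
      (fun z : R * d.-tuple R => g (upd z.2 b z.1))) => //.
    exact: (measurableT_comp mg (measurable_upd b)).
  by move=> v; exact: integral_ge0.
have mupd2 v : measurable_fun setT (fun z : R * R => upd2 v z.1 z.2).
  apply/measurable_fun_tnthP => k.
  rewrite (_ : _ \o _ = fun z : R * R =>
    if k == b then z.2 else if k == a then z.1 else tnth v k).
    case: (k == b); first exact: measurable_snd.
    by case: (k == a); [exact: measurable_fst|exact: measurable_cst].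
  by apply/funext => z /=; rewrite !tnth_upd.
have mg := measurable_givens a b c s.
have mE : measurable (givens a b c s @^-1` A).
  by rewrite -[X in measurable X]setTI; exact: mg.
have muI B : measurable B -> mu B = \int[mu]_v (\1_B v)%:E.
  by move=> mB; rewrite integral_indic // setIT.
rewrite (muI _ mE) (muI _ mA).
rewrite (resample2 (fun v => (\1_(givens a b c s @^-1` A) v)%:E)); last first.
- by move=> v; rewrite lee_fin indicE ler0n.
- by apply/measurable_EFinP; exact: measurable_indic.
rewrite (resample2 f mf f0); apply: eq_integral => v _.
have mf2 : measurable_fun setT (fun z : R * R => f (upd2 v z.1 z.2)).
  exact: (measurableT_comp mf (mupd2 v)).
have mgf2 : measurable_fun setT (fun z : R * R =>
    (\1_(givens a b c s @^-1` A) (upd2 v z.1 z.2))%:E : \bar R).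
  apply: (measurableT_comp (f := fun v => (\1_(givens a b c s @^-1` A) v)%:E)).
    by apply/measurable_EFinP; exact: measurable_indic.
  exact: mupd2.
have toN (K : R * R -> \bar R) : measurable_fun setT K -> (forall z, 0 <= K z) ->
    \int[ga]_x \int[ga]_y K (x, y) =
    \int[normal_prob 0 sigma]_x \int[normal_prob 0 sigma]_y K (x, y).
  move=> mK K0; rewrite integral_centred_normal.
  - apply: eq_integral => x _; rewrite integral_centred_normal //.
    exact: measurableT_comp mK (measurable_pair1 x).
  - exact: (measurable_fun_fubini_tonelli_F (m2 := ga) K mK K0).
  - by move=> x; exact: integral_ge0.
apply: etrans (toN _ mgf2 _) _; first by move=> z; rewrite lee_fin indicE ler0n.
apply: etrans _ (esym (toN _ mf2 (fun z => f0 _))) => /=.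
transitivity (\int[normal_prob 0 sigma]_x \int[normal_prob 0 sigma]_y
    f (upd2 v (c * x - s * y)%R (s * x + c * y)%R)); last first.
  exact: (normal_prob_plane_rotation (H := fun z => f (upd2 v z.1 z.2)) sg0 cs mf2
    (fun z => f0 _)).
apply: eq_integral => x _; apply: eq_integral => y _.
rewrite /f !indicE; congr ((nat_of_bool _)%:R)%:E.
suff -> : upd2 v (c * x - s * y)%R (s * x + c * y)%R = givens a b c s (upd2 v x y).
  by apply/idP/idP; rewrite !inE.
apply: eq_from_tnth => k; rewrite tnth_givens /upd2 !tnth_upd eqxx (negbTE ab) eqxx.
by case: (eqVneq k a) => [->|_]; [rewrite (negbTE ab)|case: eqVneq].
Qed.

End GaussianLaw.

(** * A matrix Chernoff bound in moment form *)

Section MatrixBounded.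
Context d (T : measurableType d) (R : realType).

(** Matrix-valued functions with bounded measurable entries. *)
Definition mbmeas m n (A : T -> 'M[R]_(m, n)) := forall i j, bmeas (fun w => A w i j).

Lemma mbmeasD m n (A B : T -> 'M[R]_(m, n)) :
  mbmeas A -> mbmeas B -> mbmeas (fun w => A w + B w).
Proof. by move=> mA mB i j; under eq_fun do rewrite mxE; exact: bmeasD. Qed.

Lemma mbmeas_cst m n (A : 'M[R]_(m, n)) : mbmeas (fun=> A).
Proof. by move=> i j; exact: bmeas_cst. Qed.

Lemma mbmeasM m n p (A : T -> 'M[R]_(m, n)) (B : T -> 'M[R]_(n, p)) :
  mbmeas A -> mbmeas B -> mbmeas (fun w => A w *m B w).
Proof.
move=> mA mB i j; under eq_fun do rewrite mxE.
by apply: bmeas_sum => k _; exact: bmeasM.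
Qed.

Lemma mbmeas_tr m n (A : T -> 'M[R]_(m, n)) : mbmeas A -> mbmeas (fun w => (A w)^T).
Proof. by move=> mA i j; under eq_fun do rewrite mxE; exact: mA. Qed.

Lemma mbmeasX n (A : T -> 'M[R]_n) q : mbmeas A -> mbmeas (fun w => A w ^+ q).
Proof.
move=> mA; elim: q => [|q IH].
  by under eq_fun do rewrite expr0; exact: mbmeas_cst.
by under eq_fun do rewrite exprS; exact: mbmeasM.
Qed.

Lemma mbmeas_sum m n (I : Type) (s : seq I) (P : pred I) (A : I -> T -> 'M[R]_(m, n)) :
  (forall i, mbmeas (A i)) -> mbmeas (fun w => \sum_(i <- s | P i) A i w).
Proof.
by move=> mA i j; under eq_fun do rewrite summxE; apply: bmeas_sum => k _; exact: mA.
Qed.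

Lemma bmeas_mxtrace n (A : T -> 'M[R]_n) : mbmeas A -> bmeas (fun w => \tr (A w)).
Proof. by move=> mA; apply: bmeas_sum. Qed.

Lemma bmeas_dot n (x y : T -> 'cV[R]_n) : mbmeas x -> mbmeas y ->
  bmeas (fun w => dot (x w) (y w)).
Proof.
move=> mx my; exact: (mbmeasM (mbmeas_tr mx) my).
Qed.

End MatrixBounded.

Section Chernoff.
Context dE (E : measurableType dE) (R : realType) (n : nat).
Variables (nu : probability (n.-tuple E) R) (mu : 'I_n -> probability E R).
Hypothesis prod_law : forall A : 'I_n -> set E, (forall i, measurable (A i)) ->
  nu [set v | forall i, A i (tnth v i)] = (\prod_(i < n) mu i (A i))%E.
(* The vectors r i, i in I, have square norm at most b. Given the entries outside I
   they are independent, and their conditional covariances are at most Lam. *)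
Variables (m : nat) (r : 'I_n -> n.-tuple E -> 'cV[R]_m) (b : R).
Variables (Lam : n.-tuple E -> R) (I : {set 'I_n}).

(** Functions that do not depend on the entries in [I]. *)
Definition unaffected (f : n.-tuple E -> R) : Prop :=
  forall i v x, i \in I -> f (upd v i x) = f v.

Hypotheses (b0 : 0 <= b) (mr : forall i, mbmeas (r i))
  (rb : forall i v, dot (r i v) (r i v) <= b).
Hypothesis r_indep : forall i k v x, i \in I -> k \in I -> k != i ->
  r k (upd v i x) = r k v.
Hypotheses (mLam : bmeas Lam) (Lam0 : forall v, 0 <= Lam v) (uLam : unaffected Lam).
Hypothesis r_cond : forall i v (A : 'M[R]_m), i \in I -> psd A ->
  Ex (mu i) (fun x => dot (r i (upd v i x)) (A *m r i (upd v i x))) <= Lam v * \tr A.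

(** The sum of the rank-one matrices of the vectors [r i] for [i] in [J]. *)
Definition gramsum (J : {set 'I_n}) v : 'M[R]_m := \sum_(i in J) r i v *m (r i v)^T.

Lemma psd_gramsum J v : psd (gramsum J v).
Proof. by apply: psd_sum => i; exact: psd_rank1. Qed.

Lemma mbmeas_gramsum J : mbmeas (gramsum J).
Proof. by apply: mbmeas_sum => i; apply: mbmeasM => //; exact: mbmeas_tr. Qed.

Lemma psd_gramsumD J v K : 0 <= K -> psd (gramsum J v + K%:M).
Proof. by move=> K0; apply: psdD; [exact: psd_gramsum|exact: psd_scalar]. Qed.

Lemma mbmeas_gramsumX J K q : mbmeas (fun v => (gramsum J v + K%:M) ^+ q).
Proof.
by apply: mbmeasX; apply: mbmeasD; [exact: mbmeas_gramsum|exact: mbmeas_cst].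
Qed.

Let bq i J K q : bmeas (fun v => dot (r i v) ((gramsum J v + K%:M) ^+ q *m r i v)).
Proof. by apply: bmeas_dot => //; apply: mbmeasM => //; exact: mbmeas_gramsumX. Qed.

Let bt J K q : bmeas (fun v => \tr ((gramsum J v + K%:M) ^+ q)).
Proof. exact/bmeas_mxtrace/mbmeas_gramsumX. Qed.

(** Integrating out the entry [i]: replace [r_i r_i^T] by its scalar bound inside
  the power, which frees the power from [i], then take the expectation. *)
Lemma peel_entry (J : {set 'I_n}) (i : 'I_n) (K : R) (q : nat)
    (Z : n.-tuple E -> R) : J \subset I -> i \in J -> 0 <= K ->
  bmeas Z -> (forall v, 0 <= Z v) -> unaffected Z ->
  Ex nu (fun v => Z v * dot (r i v) ((gramsum J v + K%:M) ^+ q *m r i v)) <=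
  Ex nu (fun v => Z v * Lam v * \tr ((gramsum (J :\ i) v + (K + b)%:M) ^+ q)).
Proof.
move=> JI iJ K0 mZ Z0 uZ; have iI := fintype.subsetP JI i iJ.
have Kb0 : 0 <= K + b by rewrite addr_ge0.
apply: (@le_trans _ _ (Ex nu (fun v =>
    Z v * dot (r i v) ((gramsum (J :\ i) v + (K + b)%:M) ^+ q *m r i v)))).
  apply: le_Ex => [||v].
  - exact: (bmeasM mZ (bq _ _ _ _)).
  - exact: (bmeasM mZ (bq _ _ _ _)).
  apply: ler_wpM2l => //; rewrite {1}/gramsum (big_setD1 i iJ) /= -/(gramsum _ _).
  have -> : (K + b)%:M = K%:M + b%:M :> 'M[R]_m by rewrite raddfD.
  rewrite [_ + gramsum _ _]addrC addrAC [in leRHS]addrA.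
  exact: rank1_update (psd_gramsumD _ _ K0) (rb i v).
have uA v x : gramsum (J :\ i) (upd v i x) = gramsum (J :\ i) v.
  apply: eq_bigr => k; rewrite !inE => /andP[ki kJ].
  by rewrite r_indep // (fintype.subsetP JI).
rewrite (resample prod_law i); last exact: (bmeasM mZ (bq _ _ _ _)).
apply: le_Ex => [||v].
- exact: (bmeas_resample _ _ (bmeasM mZ (bq _ _ _ _))).
- exact: (bmeasM (bmeasM mZ mLam) (bt _ _ _)).
have -> : Ex (mu i) (fun x => Z (upd v i x) * dot (r i (upd v i x))
     ((gramsum (J :\ i) (upd v i x) + (K + b)%:M) ^+ q *m r i (upd v i x))) =
   Ex (mu i) (fun x => Z v * dot (r i (upd v i x))
     ((gramsum (J :\ i) v + (K + b)%:M) ^+ q *m r i (upd v i x))).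
  by apply: eq_Ex => x; rewrite uZ // uA.
have mru : mbmeas (fun x => r i (upd v i x)).
  by move=> k l; exact: (bmeas_updr i v (mr i k l)).
rewrite ExZ; last by apply: bmeas_dot => //; apply: mbmeasM => //; exact: mbmeas_cst.
by rewrite -mulrA ler_wpM2l // r_cond //; exact/psdX/psd_gramsumD.
Qed.

Lemma mxtrace_gramsumS J v K q :
  \tr ((gramsum J v + K%:M) ^+ q.+1) =
  K * \tr ((gramsum J v + K%:M) ^+ q) +
  \sum_(i in J) dot (r i v) ((gramsum J v + K%:M) ^+ q *m r i v).
Proof.
rewrite exprS mulrDl mxtraceD addrC -[K%:M * _]/(K%:M *m _) mul_scalar_mx mxtraceZ.
congr (_ + _); rewrite {1}/gramsum mulr_suml raddf_sum /=.
by apply: eq_bigr => i _; exact: mxtrace_rank1.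
Qed.

(** Matrix Chernoff bound in moment form, for sums of independent rank-one
  matrices of norm at most [b] whose conditional covariances are at most [Lam]. The
  shift [K] and the weight [Z] collect what the induction has peeled off. *)
Lemma chernoff_moment (q : nat) (J : {set 'I_n}) (K : R)
    (Z : n.-tuple E -> R) : J \subset I -> 0 <= K ->
  bmeas Z -> (forall v, 0 <= Z v) -> unaffected Z ->
  Ex nu (fun v => Z v * \tr ((gramsum J v + K%:M) ^+ q)) <=
  Ex nu (fun v => Z v * (m%:R * (K + q%:R * b + #|I|%:R * Lam v) ^+ q)).
Proof.
elim: q J K Z => [|q IH] J K Z JI K0 mZ Z0 uZ.
  have -> : (fun v => Z v * \tr ((gramsum J v + K%:M) ^+ 0)) =
      (fun v => Z v * (m%:R * (K + 0%:R * b + #|I|%:R * Lam v) ^+ 0)).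
    by apply/funext => v; rewrite !expr0 mulr1; congr (_ * _); exact: mxtrace1.
  by [].
have mB K' q' q2 : bmeas (fun v => m%:R * (K' + q'%:R * b + #|I|%:R * Lam v) ^+ q2).
  apply: bmeasZ; apply: bmeasX; apply: bmeasD; first exact: bmeas_cst.
  exact: bmeasZ.
have -> : (fun v => Z v * \tr ((gramsum J v + K%:M) ^+ q.+1)) = (fun v =>
    K * (Z v * \tr ((gramsum J v + K%:M) ^+ q)) +
    \sum_(i in J) Z v * dot (r i v) ((gramsum J v + K%:M) ^+ q *m r i v)).
  apply/funext => v; rewrite mxtrace_gramsumS mulrDr; congr (_ + _).
    exact: mulrCA.
  exact: mulr_sumr.
have mZt : bmeas (fun v => Z v * \tr ((gramsum J v + K%:M) ^+ q)).
  exact: (bmeasM mZ (bt _ _ _)).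
have mZq i : bmeas (fun v => Z v * dot (r i v) ((gramsum J v + K%:M) ^+ q *m r i v)).
  exact: (bmeasM mZ (bq _ _ _ _)).
rewrite ExD; [|exact: bmeasZ|by apply: bmeas_sum].
rewrite ExZ // Ex_sum //.
pose B K' v := m%:R * (K' + q%:R * b + #|I|%:R * Lam v) ^+ q.
have mZB K' : bmeas (fun v => Z v * B K' v) by exact: (bmeasM mZ (mB _ _ _)).
have mZLB K' : bmeas (fun v => Z v * Lam v * B K' v).
  exact: (bmeasM (bmeasM mZ mLam) (mB _ _ _)).
apply: (@le_trans _ _ (K * Ex nu (fun v => Z v * B K v) +
  #|J|%:R * Ex nu (fun v => Z v * Lam v * B (K + b) v))).
  apply: lerD; first by rewrite ler_wpM2l // IH.
  rewrite mulr_natl -sumr_const.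
  apply: ler_sum => i iJ; apply: le_trans (peel_entry _ JI iJ K0 mZ Z0 uZ) _.
  apply: (IH (J :\ i) (K + b) (fun v => Z v * Lam v)).
  - by apply: fintype.subset_trans JI; exact: subD1set.
  - by rewrite addr_ge0.
  - exact: bmeasM.
  - by move=> v; rewrite mulr_ge0.
  - by move=> k v x kI; rewrite uZ // uLam.
rewrite -!ExZ // -ExD; [|exact: bmeasZ|exact: bmeasZ].
apply: le_Ex => [||v].
- by apply: bmeasD; exact: bmeasZ.
- exact: (bmeasM mZ (mB _ _ _)).
set c := K + q.+1%:R * b + #|I|%:R * Lam v.
have IL : 0 <= #|I|%:R * Lam v by rewrite mulr_ge0.
have qb : 0 <= q%:R * b by rewrite mulr_ge0.
have c0 : 0 <= c by rewrite !addr_ge0 // mulr_ge0.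
have cE : c = K + b + q%:R * b + #|I|%:R * Lam v.
  by rewrite /c -natr1 mulrDl mul1r; ring.
have h1 : B K v <= m%:R * c ^+ q.
  rewrite ler_wpM2l // lerXn2r ?nnegrE // ?addr_ge0 // cE.
  by rewrite lerD2r lerD2r lerDl.
have h2 : B (K + b) v = m%:R * c ^+ q by rewrite /B cE.
rewrite h2; apply: (@le_trans _ _ ((K + #|J|%:R * Lam v) * (Z v * (m%:R * c ^+ q)))).
  rewrite [leRHS]mulrDl lerD //; first by rewrite ler_wpM2l // ler_wpM2l.
  by rewrite le_eqVlt; apply/orP; left; apply/eqP; ring.
rewrite mulrCA ler_wpM2l // exprS mulrCA ler_wpM2l // ler_wpM2r ?exprn_ge0 //.
rewrite /c -addrA lerD2l; apply: (@le_trans _ _ (#|I|%:R * Lam v)).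
  by rewrite ler_wpM2r // ler_nat subset_leq_card.
by rewrite lerDr mulr_ge0.
Qed.

End Chernoff.

(** * Moments of the directions and of the signs *)

Section Correlation.
Variables (R : rcfType) (n m : nat) (W : 'M[R]_(n, m)) (L : 'M[R]_n) (lam kap : R).
Let G := W *m W^T.
Hypotheses (Glam : forall c, dot c (G *m c) <= lam * dot c c)
  (G1 : forall j, G j j <= 1) (kap01 : 0 <= kap <= 1)
  (LG : forall j k, `|L j k - kap * G j k| <= G j k ^+ 2).

Let pG : psd G. Proof. by exists m, W. Qed.

Let Gsym j k : G j k = G k j.
Proof. by have /matrixP/(_ k j) := psd_sym pG; rewrite mxE. Qed.

(* The rows of G have square norm at most lam: this is G^2 <= lam G tested on
   the basis vectors. *)
Let row_sum j : \sum_k G j k ^+ 2 <= lam.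
Proof.
pose e : 'cV[R]_n := delta_mx j 0; pose w := G *m e.
have ee l : e l 0 = (l == j)%:R by rewrite mxE eqxx andbT.
have wE k : w k 0 = G j k.
  rewrite mxE (bigD1 j) //= big1 => [|l lj]; last by rewrite ee (negbTE lj) mulr0.
  by rewrite ee eqxx mulr1 addr0 Gsym.
have eE (x : 'cV[R]_n) : dot e x = x j 0.
  rewrite dotE (bigD1 j) //= big1 => [|l lj]; last by rewrite ee (negbTE lj) mul0r.
  by rewrite ee eqxx mul1r addr0.
have lam0 : 0 <= lam.
  have := Glam e; rewrite [dot e e]eE ee eqxx mulr1.
  by apply: le_trans; exact: psd_ge0.
have -> : \sum_k G j k ^+ 2 = dot w w.
  by rewrite dotE; apply: eq_bigr => k _; rewrite wE expr2.
have [w0|w0] := eqVneq (dot w w) 0; first by rewrite w0.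
have wpos : 0 < dot w w by rewrite lt_neqAle eq_sym w0 dot_ge0.
rewrite -(ler_pM2r wpos) -expr2.
apply: le_trans (psd_cauchy_schwarz w e pG) _.
have h1 : dot e (G *m e) <= 1 by rewrite eE -/w wE.
apply: (@le_trans _ _ (dot w (G *m w) * 1)).
  by rewrite ler_wpM2l // psd_ge0.
by rewrite mulr1.
Qed.

(** A matrix that is entrywise close to a fraction of a Gram matrix [G] of norm at
  most [lam], up to the squared entries of [G], has its form at most [2 * lam]. *)
Lemma correlation_bound c : dot c (L *m c) <= 2 * lam * dot c c.
Proof.
have [k0 k1] := andP kap01.
have qE (A : 'M[R]_n) : dot c (A *m c) = \sum_j \sum_k A j k * (c j 0 * c k 0).
  rewrite dotE; apply: eq_bigr => j _; rewrite mxE mulr_sumr.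
  by apply: eq_bigr => k _; ring.
apply: (@le_trans _ _ (kap * dot c (G *m c) +
  (2^-1 * \sum_j c j 0 ^+ 2 * (\sum_k G j k ^+ 2) +
   2^-1 * \sum_k c k 0 ^+ 2 * (\sum_j G k j ^+ 2)))).
  have E2 : \sum_k c k 0 ^+ 2 * (\sum_j G k j ^+ 2) =
      \sum_j \sum_k c k 0 ^+ 2 * G j k ^+ 2.
    rewrite exchange_big /=; apply: eq_bigr => k _; rewrite mulr_sumr.
    by apply: eq_bigr => j _; rewrite Gsym.
  (* Entrywise, g^2 |x y| <= g^2 (x^2 + y^2) / 2. *)
  rewrite !qE {2}E2 !mulr_sumr -!big_split /=; apply: ler_sum => j _.
  rewrite !mulr_sumr -!big_split /=; apply: ler_sum => k _.
  have := LG j k; set g := G j k; set x := c j 0; set y := c k 0; set l := L j k.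
  move=> h; rewrite -lerBlDl [kap * (_ * _)]mulrA -mulrBl.
  apply: (@le_trans _ _ (`|l - kap * g| * `|x * y|)); first by rewrite -normrM ler_norm.
  apply: (@le_trans _ _ (g ^+ 2 * `|x * y|)); first by rewrite ler_wpM2r.
  have -> : 2^-1 * (x ^+ 2 * g ^+ 2) + 2^-1 * (y ^+ 2 * g ^+ 2) =
      g ^+ 2 * (2^-1 * (x ^+ 2 + y ^+ 2)) by ring.
  rewrite ler_wpM2l ?sqr_ge0 // normrM.
  have := sqr_ge0 (`|x| - `|y|); rewrite sqrrB !real_normK ?num_real //; lra.
have hs : \sum_j c j 0 ^+ 2 * (\sum_k G j k ^+ 2) <= lam * dot c c.
  rewrite dotE mulr_sumr; apply: ler_sum => j _.
  by rewrite mulrC -expr2 ler_wpM2r ?sqr_ge0 ?row_sum.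
have hk : kap * dot c (G *m c) <= lam * dot c c.
  apply: le_trans (Glam c); rewrite ler_piMl //; exact: psd_ge0.
lra.
Qed.
End Correlation.

Section Moments.
Variables (R : realType) (n d : nat).
Local Notation E := (d.-tuple R).
Variables (nu : probability (n.-tuple E) R) (mu : 'I_n -> probability E R).
Hypothesis prod_law : forall A : 'I_n -> set E, (forall i, measurable (A i)) ->
  nu [set v | forall i, A i (tnth v i)] = (\prod_(i < n) mu i (A i))%E.
Hypotheses (mu_inv : forall i, rotation_invariant (mu i)) (d1 : (1 < d)%N).
Implicit Types (v : n.-tuple E) (I J : {set 'I_n}).

Let d0 : (0 : R) < d%:R. Proof. by rewrite ltr0n ltnW. Qed.

(** The direction of the [j]-th vector. *)
Definition dirv (j : 'I_n) v : 'cV[R]_d := \col_k tnth (hat (tnth v j)) k.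

Lemma dot_dirv i j v : dot (dirv i v) (dirv j v) = dotp (hat (tnth v i)) (hat (tnth v j)).
Proof. by rewrite dotE; apply: eq_bigr => k _; rewrite !mxE. Qed.

Let dirv_norm j v : dot (dirv j v) (dirv j v) <= 1.
Proof. by rewrite dot_dirv; exact: dotp_hat_le1. Qed.

Let dirv_upd (i k : 'I_n) v x : k != i -> dirv k (upd v i x) = dirv k v.
Proof. by move=> ki; apply/matrixP => a b; rewrite !mxE tnth_upd_neq. Qed.

Let mbmeas_dirv j : mbmeas (dirv j).
Proof.
move=> a b; have -> : (fun w => dirv j w a b) = (fun w => tnth (hat (tnth w j)) a).
  by apply/funext => w; rewrite mxE.
exact: (bmeas_comp (bmeas_hat R a) (measurable_tnth (T := E) j)).
Qed.

(* The covariance of a direction is the identity divided by d. *)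
Let dirv_cond (i : 'I_n) v (A : 'M[R]_d) : psd A ->
  Ex (mu i) (fun x => dot (dirv i (upd v i x)) (A *m dirv i (upd v i x))) <=
  d%:R^-1 * \tr A.
Proof.
move=> pA; have bh a b : bmeas (fun x : E => A a b * (tnth (hat x) a * tnth (hat x) b)).
  by apply: bmeasZ; apply: bmeasM; exact: bmeas_hat.
have -> : Ex (mu i) (fun x => dot (dirv i (upd v i x)) (A *m dirv i (upd v i x))) =
    Ex (mu i) (fun x => \sum_a \sum_b A a b * (tnth (hat x) a * tnth (hat x) b)).
  apply: eq_Ex => x; rewrite dotE; apply: eq_bigr => a _.
  rewrite !mxE tnth_upd_eq mulr_sumr; apply: eq_bigr => b _.
  by rewrite !mxE tnth_upd_eq mulrCA.
rewrite Ex_sum => [|a _]; last by apply: bmeas_sum => b _.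
rewrite mulr_sumr; apply: ler_sum => a _; rewrite Ex_sum // (bigD1 a) //=.
rewrite ExZ; last by apply: bmeasM; exact: bmeas_hat.
rewrite Ex_hat_mul // eqxx mul1r mulrC big1 ?addr0 // => b ba.
rewrite ExZ; last by apply: bmeasM; exact: bmeas_hat.
by rewrite Ex_hat_mul // eq_sym (negbTE ba) mul0r mulr0.
Qed.

(** The moment bound for the Gram matrix of the directions. Peeling one entry before
  the Chernoff bound gives a factor [n] where the latter alone would give [d]. *)
Lemma gram_moment p J : (0 < p)%N ->
  Ex nu (fun v => \tr (gramsum dirv J v ^+ p)) <= n%:R * (p%:R + n%:R / d%:R) ^+ p.
Proof.
case: p => // q _.
have b01 : (0 : R) <= 1 by [].
have rin (i k : 'I_n) v x : i \in [set: 'I_n]%SET -> k \in [set: 'I_n]%SET -> k != i ->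
    dirv k (upd v i x) = dirv k v by move=> _ _; exact: dirv_upd.
have mL : bmeas (fun _ : n.-tuple E => d%:R^-1 : R) by exact: bmeas_cst.
have L0 : forall v, 0 <= d%:R^-1 :> R by move=> v; rewrite invr_ge0 ler0n.
have uL : unaffected [set: 'I_n]%SET (fun _ : n.-tuple E => d%:R^-1 : R) by [].
have rc (i : 'I_n) v (A : 'M[R]_d) : i \in [set: 'I_n]%SET -> psd A ->
  Ex (mu i) (fun x => dot (dirv i (upd v i x)) (A *m dirv i (upd v i x))) <=
  d%:R^-1 * \tr A by move=> _; exact: dirv_cond.
have peel := peel_entry prod_law b01 mbmeas_dirv dirv_norm rin mL rc.
have chern := chernoff_moment prod_law b01 mbmeas_dirv dirv_norm rin mL L0 uL rc.
have m1 : bmeas (fun _ : n.-tuple E => 1 : R) by exact: bmeas_cst.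
have term i : i \in J ->
    Ex nu (fun v => dot (dirv i v) (gramsum dirv J v ^+ q *m dirv i v)) <=
    (q.+1%:R + n%:R / d%:R) ^+ q.
  move=> iJ.
  have := peel J i 0 q (fun=> 1) (finset.subsetT _) iJ (lexx _)
    m1 (fun=> b01) (fun _ _ _ _ => erefl).
  have -> : (fun v => 1 * dot (dirv i v) ((gramsum dirv J v + 0%:M) ^+ q *m dirv i v)) =
      (fun v => dot (dirv i v) (gramsum dirv J v ^+ q *m dirv i v)).
    by apply/funext => v; rewrite mul1r raddf0 addr0.
  move=> /le_trans; apply.
  have mL1 : bmeas (fun _ : n.-tuple E => 1 * d%:R^-1 : R) by exact: bmeas_cst.
  have L10 : forall v : n.-tuple E, 0 <= 1 * d%:R^-1 :> R by move=> v; rewrite mul1r.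
  have := chern q (J :\ i) (0 + 1) (fun=> 1 * d%:R^-1) (finset.subsetT _)
    (addr_ge0 (lexx _) b01) mL1 L10 (fun _ _ _ _ => erefl).
  move=> /le_trans; apply; rewrite Ex_cst cardsT card_ord mul1r.
  rewrite mulKf ?gt_eqF // add0r mulr1 -[1 + q%:R]/(1%:R + q%:R) -natrD add1n.
  by [].
have -> : (fun v => \tr (gramsum dirv J v ^+ q.+1)) =
    (fun v => \sum_(i in J) dot (dirv i v) (gramsum dirv J v ^+ q *m dirv i v)).
  apply/funext => v; have := mxtrace_gramsumS dirv J v 0 q.
  by rewrite raddf0 addr0 mul0r add0r.
rewrite Ex_sum => [|i _]; last first.
  apply: bmeas_dot => //; apply: mbmeasM => //; apply: mbmeasX.
  exact: mbmeas_gramsum.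
apply: (@le_trans _ _ (\sum_(i in J) (q.+1%:R + n%:R / d%:R) ^+ q)).
  exact: ler_sum.
rewrite sumr_const -[leLHS]mulr_natl.
pose X : R := q.+1%:R + n%:R / d%:R; rewrite -/X.
have X1 : 1 <= X.
  have nd0 : 0 <= n%:R / d%:R :> R by rewrite divr_ge0.
  have q1 : 1 <= q.+1%:R :> R by rewrite ler1n.
  by apply: (le_trans q1); rewrite /X lerDl.
apply: (@le_trans _ _ (n%:R * X ^+ q)).
  rewrite ler_wpM2r ?exprn_ge0 ?(le_trans _ X1) // ler_nat.
  by rewrite -[X in (_ <= X)%N]card_ord max_card.
rewrite ler_wpM2l // exprS ler_peMl // exprn_ge0 // (le_trans _ X1) //.
Qed.

Section Signs.
Variables (I : {set 'I_n}) (p : nat).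
Hypothesis p0 : (0 < p)%N.

(** The row of [i] in the sign matrix, restricted to the columns outside [I]. *)
Definition signv (i : 'I_n) v : 'cV[R]_n :=
  \col_j (if j \in I then 0 else Num.sg (dotp (tnth v i) (tnth v j))).

Let Ic : {set 'I_n} := finset.setC I.

(* The rows of W are the directions outside I. Its Gram matrix W W^T has the nonzero
   spectrum of the sum W^T W of their rank-one matrices. *)
Let W v : 'M[R]_(n, d) := \matrix_(j, k) (if j \in I then 0 else dirv j v k 0).

Let WW v : (W v)^T *m W v = gramsum dirv Ic v.
Proof.
apply/matrixP => k l; rewrite mxE summxE [RHS]big_mkcond /=; apply: eq_bigr => j _.
rewrite !mxE finset.in_setC; case: (j \in I) => /=; first by rewrite mul0r.
by rewrite big_ord1 !mxE.
Qed.

Let GE v j k : (W v *m (W v)^T) j k =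
  if (j \in I) || (k \in I) then 0 else dotp (hat (tnth v j)) (hat (tnth v k)).
Proof.
rewrite mxE; case: ifP => [h|/negbT].
  apply: big1 => l _; rewrite !mxE.
  by case/orP: h => ->; rewrite ?mul0r ?mulr0.
rewrite negb_or => /andP[/negbTE jI /negbTE kI].
by apply: eq_bigr => l _; rewrite !mxE jI kI.
Qed.

(** An upper bound for the norm of the Gram matrix of the directions outside [I]. *)
Definition normv v : R := \tr (gramsum dirv Ic v ^+ p) `^ p%:R^-1.

Let tr_ge0 v : 0 <= \tr (gramsum dirv Ic v ^+ p).
Proof. exact/psd_tr_ge0/psdX/psd_gramsum. Qed.

Lemma normv_ge0 v : 0 <= normv v. Proof. exact: powR_ge0. Qed.

Lemma normvX v : normv v ^+ p = \tr (gramsum dirv Ic v ^+ p).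
Proof.
rewrite -powR_mulrn ?powR_ge0 // -powRrM mulVf ?powRr1 //.
by rewrite pnatr_eq0 -lt0n.
Qed.

Lemma bmeas_normv : bmeas normv.
Proof.
have [mt [C hC]] : bmeas (fun v => \tr (gramsum dirv Ic v ^+ p)).
  by apply/bmeas_mxtrace/mbmeasX/mbmeas_gramsum.
split.
  exact: (measurableT_comp (measurable_powR (p%:R^-1)) mt).
exists (C `^ p%:R^-1) => v; rewrite ger0_norm ?normv_ge0 //.
have tC : \tr (gramsum dirv Ic v ^+ p) <= C by exact: le_trans (ler_norm _) (hC v).
by apply: ge0_ler_powR => //; rewrite nnegrE ?(le_trans (tr_ge0 v) tC) ?invr_ge0.
Qed.

Let G_bound v c : dot c (W v *m (W v)^T *m c) <= normv v * dot c c.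
Proof.
have pG : psd (W v *m (W v)^T) by exists d, (W v).
rewrite -(@ler_pXn2r _ p) // ?nnegrE ?psd_ge0 ?mulr_ge0 ?dot_ge0 ?normv_ge0 //.
apply: le_trans (psd_pow_le_tr c pG p0) _.
by rewrite mxtrace_gramX // WW exprMn normvX mulrC.
Qed.

(* Given the entries outside I, the covariance of a row of signs is the matrix of
   the sign correlations of the columns. *)
Let signv_cond (i : 'I_n) v (A : 'M[R]_n) : i \in I -> psd A ->
  Ex (mu i) (fun x => dot (signv i (upd v i x)) (A *m signv i (upd v i x))) <=
  2 * normv v * \tr A.
Proof.
move=> iI pA.
pose L : 'M[R]_n := \matrix_(j, k)
  (if (j \in I) || (k \in I) then 0 else sgK (mu i) (tnth v j) (tnth v k)).
have bK (j k : 'I_n) : bmeas (fun x : E => A j k *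
    (Num.sg (dotp x (tnth v j)) * Num.sg (dotp x (tnth v k)))).
  by apply: bmeasZ; exact: bmeas_sgK.
pose F j k (x : E) := if (j \in I) || (k \in I) then 0 else
  A j k * (Num.sg (dotp x (tnth v j)) * Num.sg (dotp x (tnth v k))).
have bF j k : bmeas (F j k).
  by rewrite /F; case: ((j \in I) || (k \in I)); [exact: bmeas_cst|exact: bK].
have -> : Ex (mu i) (fun x => dot (signv i (upd v i x)) (A *m signv i (upd v i x))) =
    Ex (mu i) (fun x => \sum_j \sum_k F j k x).
  apply: eq_Ex => x; rewrite dotE; apply: eq_bigr => j _.
  rewrite !mxE mulr_sumr; apply: eq_bigr => k _.
  rewrite !mxE /F; case jI : (j \in I) => /=; first by rewrite mul0r.
  case kI : (k \in I); first by rewrite !mulr0.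
  have ji : j != i by apply: contraFN jI => /eqP ->.
  have ki : k != i by apply: contraFN kI => /eqP ->.
  by rewrite tnth_upd_eq !tnth_upd_neq // mulrCA.
rewrite Ex_sum => [|j _]; last by apply: bmeas_sum => k _.
have -> : \sum_j Ex (mu i) (fun x => \sum_k F j k x) = \tr (A *m L).
  apply: eq_bigr => j _; rewrite Ex_sum // mxE; apply: eq_bigr => k _.
  rewrite /F !mxE orbC; case: ((k \in I) || (j \in I)); first by rewrite Ex_cst mulr0.
  rewrite (ExZ _ _ (bmeas_sgK _ _)); congr (_ * _).
  exact: (sgKC (mu i) (tnth v j) (tnth v k)).
apply: psd_tr_mul => // c; apply: (correlation_bound (W := W v) (kap := 2 / pi)).
- exact: G_bound.
- by move=> j; rewrite GE orbb; case: ifP => // _; exact: dotp_hat_le1.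
- by rewrite divr_ge0 ?pi_ge0 //= ler_pdivrMr ?pi_gt0 // mul1r pi_ge2.
- move=> j k; rewrite GE mxE; case: ifP => _; last exact: sgK_linear_approx.
  by rewrite mulr0 subrr normr0 expr0n.
Qed.

Let mbmeas_signv i : mbmeas (signv i).
Proof.
move=> j z; have -> : (fun v => signv i v j z) = (fun v => if j \in I then 0 else
    Num.sg (dotp (tnth v i) (tnth v j))) by apply/funext => v; rewrite mxE.
case: (j \in I); first exact: bmeas_cst.
apply: bmeas_sg; apply: measurable_sum => k; apply: measurable_funM.
  exact: (measurableT_comp (measurable_tnth (T := R) k) (measurable_tnth (T := E) i)).
exact: (measurableT_comp (measurable_tnth (T := R) k) (measurable_tnth (T := E) j)).
Qed.

Let signv_norm i v : dot (signv i v) (signv i v) <= n%:R.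
Proof.
rewrite dotE -[X in _ <= X%:R]card_ord -sum1_card natr_sum; apply: ler_sum => j _.
rewrite !mxE; case: ifP => _; first by rewrite mul0r ler01.
by rewrite -expr2 sqr_sg; case: (_ != _).
Qed.

(** Conditionally on the vectors outside [I], the rows in [I] are independent. *)
Lemma sign_moment_cond :
  Ex nu (fun v => \tr (gramsum signv I v ^+ p)) <=
  Ex nu (fun v => n%:R * (p%:R * n%:R + #|I|%:R * (2 * normv v)) ^+ p).
Proof.
have rin (i k : 'I_n) v x : i \in I -> k \in I -> k != i ->
    signv k (upd v i x) = signv k v.
  move=> iI kI ki; apply/matrixP => j z; rewrite !mxE tnth_upd_neq //.
  case jI: (j \in I) => //; rewrite tnth_upd_neq //.
  by apply: contraFN jI => /eqP ->.
have mL : bmeas (fun v => 2 * normv v) by apply: bmeasZ; exact: bmeas_normv.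
have L0 v : 0 <= 2 * normv v by rewrite mulr_ge0 // normv_ge0.
have uL : unaffected I (fun v => 2 * normv v).
  move=> i v x iI; rewrite /normv.
  suff -> : gramsum dirv Ic (upd v i x) = gramsum dirv Ic v by [].
  apply: eq_bigr => j; rewrite finset.in_setC => jI; rewrite dirv_upd //.
  by apply: contraNneq jI => ->.
have n0 : (0 : R) <= n%:R by [].
have := chernoff_moment prod_law n0 mbmeas_signv signv_norm rin mL L0 uL signv_cond.
have m1 : bmeas (fun _ : n.-tuple E => 1 : R) by exact: bmeas_cst.
move=> /(_ p I 0 (fun=> 1) (fintype.subxx _) (lexx _) m1 (fun=> ler01) (fun _ _ _ _ => erefl)).
have -> : (fun v => 1 * \tr ((gramsum signv I v + 0%:M) ^+ p)) =
    (fun v => \tr (gramsum signv I v ^+ p)).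
  by apply/funext => v; rewrite mul1r raddf0 addr0.
move=> /le_trans; apply; rewrite le_eqVlt; apply/orP; left; apply/eqP.
by apply: eq_Ex => v; rewrite mul1r add0r.
Qed.

(** The moment bound for the part of the sign matrix with rows in [I] and
  columns outside [I]. *)
Lemma sign_moment :
  Ex nu (fun v => \tr (gramsum signv I v ^+ p)) <=
  n%:R ^+ 2 * (8 * n%:R * (p%:R + n%:R / d%:R)) ^+ p.
Proof.
have [n0|n0] := posnP n.
  have -> : (fun v => \tr (gramsum signv I v ^+ p)) = (fun=> 0).
    apply/funext => v; rewrite /mxtrace big1 // => i.
    by have := ltn_ord i; rewrite [in X in (_ < X)%N]n0.
  by rewrite Ex_cst mulr_ge0 ?sqr_ge0 ?exprn_ge0 // !mulr_ge0 // addr_ge0 // divr_ge0.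
apply: le_trans sign_moment_cond _.
have powD (a b : R) : 0 <= a -> 0 <= b -> (a + b) ^+ p <= 2 ^+ p * (a ^+ p + b ^+ p).
  move=> a0 b0.
  wlog ab : a b a0 b0 / a <= b.
    move=> H; case: (leP a b) => [|/ltW] h; first exact: H.
    by rewrite addrC [_ ^+ _ + _]addrC; exact: H.
  apply: (@le_trans _ _ ((2 * b) ^+ p)).
    rewrite lerXn2r ?nnegrE ?addr_ge0 ?mulr_ge0 //; lra.
  by rewrite exprMn ler_wpM2l ?exprn_ge0 // lerDr exprn_ge0.
pose X : R := p%:R + n%:R / d%:R.
have X1 : p%:R <= X by rewrite /X lerDl divr_ge0.
have p1 : (1 : R) <= p%:R by rewrite ler1n.
have X0 : 0 <= X by exact: le_trans X1.
pose t v := \tr (gramsum dirv Ic v ^+ p).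
have mt : bmeas t by apply/bmeas_mxtrace/mbmeasX/mbmeas_gramsum.
pose c1 : R := n%:R * (2 ^+ p * (n%:R * X) ^+ p).
pose c2 : R := n%:R * (2 ^+ p * (n%:R ^+ p * 2 ^+ p)).
apply: (@le_trans _ _ (Ex nu (fun v => c1 + c2 * t v))).
  apply: le_Ex => [||v].
  - apply: bmeasZ; apply: bmeasX; apply: bmeasD; first exact: bmeas_cst.
    by apply: bmeasZ; apply: bmeasZ; exact: bmeas_normv.
  - by apply: bmeasD; [exact: bmeas_cst|exact: bmeasZ].
  apply: (@le_trans _ _ (n%:R * (2 ^+ p * ((p%:R * n%:R) ^+ p +
      (#|I|%:R * (2 * normv v)) ^+ p)))).
    by rewrite ler_wpM2l // powD // !mulr_ge0 // normv_ge0.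
  have -> : c1 + c2 * t v =
      n%:R * (2 ^+ p * ((n%:R * X) ^+ p + n%:R ^+ p * 2 ^+ p * t v)).
    by rewrite /c1 /c2; ring.
  apply: ler_wpM2l => //; apply: ler_wpM2l; first exact: exprn_ge0.
  apply: lerD.
    by rewrite mulrC lerXn2r ?nnegrE ?mulr_ge0 // ler_wpM2l.
  rewrite /t -normvX -!exprMn -mulrA lerXn2r ?nnegrE ?mulr_ge0 ?normv_ge0 //.
  rewrite ler_wpM2r ?mulr_ge0 ?normv_ge0 // ler_nat.
  by rewrite -[X in (_ <= X)%N]card_ord max_card.
rewrite ExD; [|exact: bmeas_cst|exact: bmeasZ].
rewrite Ex_cst ExZ //.
have c20 : 0 <= c2 by rewrite /c2 !mulr_ge0 ?exprn_ge0.
apply: (@le_trans _ _ (c1 + c2 * (n%:R * X ^+ p))).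
  by rewrite lerD2l ler_wpM2l // gram_moment.
rewrite -/X /c1 /c2 !exprMn.
pose N : R := n%:R; rewrite -/N.
have N1 : 1 <= N by rewrite /N ler1n.
have -> : N * (2 ^+ p * (N ^+ p * X ^+ p)) +
    N * (2 ^+ p * (N ^+ p * 2 ^+ p)) * (N * X ^+ p) =
   N * (N ^+ p * X ^+ p) * (2 ^+ p * (1 + 2 ^+ p * N)) by ring.
have -> : N ^+ 2 * (8 ^+ p * N ^+ p * X ^+ p) = N * (N ^+ p * X ^+ p) * (8 ^+ p * N) by ring.
rewrite ler_wpM2l ?mulr_ge0 ?exprn_ge0 ?(le_trans _ N1) //.
have -> : (8 : R) = 2 * 4 by ring.
rewrite exprMn -mulrA ler_wpM2l ?exprn_ge0 //.
have -> : (4 : R) = 2 * 2 by ring.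
rewrite exprMn.
have t2 : (2 : R) <= 2 ^+ p by rewrite -{1}(expr1 2) ler_eXn2l // ltr1n.
have t1 : (1 : R) <= 2 ^+ p by apply: le_trans t2; rewrite ler1n.
have tN : 1 <= 2 ^+ p * N by exact: mulr_ege1.
rewrite -mulrA; apply: (@le_trans _ _ (2 * (2 ^+ p * N))).
  by rewrite mulr_natl mulr2n lerD2r.
by rewrite ler_wpM2r // mulr_ge0 ?exprn_ge0 // (le_trans _ N1).
Qed.

End Signs.

End Moments.

(** * Decoupling *)

Section RandomCut.
Variables (R : realFieldType) (n : nat).
Implicit Types (I : {set 'I_n}) (i j k : 'I_n).

Let tog i I : {set 'I_n} := [set k | (k \in I) (+) (k == i)]%SET.

Let mem_tog i I k : (k \in tog i I) = (k \in I) (+) (k == i).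
Proof. by rewrite finset.inE. Qed.

Let togK i : involutive (tog i).
Proof. by move=> I; apply/setP => k; rewrite !mem_tog -addbA addbb addbF. Qed.

(* Toggling the membership of i and of j permutes the sets, so a pair is cut by
   exactly a quarter of them. *)
Let cut_count i j : i != j ->
  (4 * \sum_(I : {set 'I_n}) ((i \in I) && (j \notin I)))%N = #|{set 'I_n}|.
Proof.
move=> ij; set s := (\sum_I _)%N.
have togE k (f : {set 'I_n} -> nat) : (\sum_I f I = \sum_I f (tog k I))%N.
  by rewrite (reindex_inj (inv_inj (togK k))).
have e1 : s = (\sum_(I : {set 'I_n}) ((i \notin I) && (j \notin I)))%N.
  rewrite /s (togE i); apply: eq_bigr => I _; rewrite !mem_tog eqxx.
  by rewrite [j == i]eq_sym (negbTE ij) addbT addbF.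
have e2 : s = (\sum_(I : {set 'I_n}) ((i \in I) && (j \in I)))%N.
  rewrite /s (togE j); apply: eq_bigr => I _; rewrite !mem_tog eqxx.
  by rewrite (negbTE ij) addbT addbF negbK.
have e3 : s = (\sum_(I : {set 'I_n}) ((i \notin I) && (j \in I)))%N.
  rewrite e1 (togE j); apply: eq_bigr => I _; rewrite !mem_tog eqxx.
  by rewrite (negbTE ij) addbT addbF negbK.
have -> : (4 * s = s + s + (s + s))%N by rewrite !mulSn mul0n addn0 !addnA.
rewrite {2}e1 {2}e2 {2}e3 /s -!big_split -sum1_card /=.
by apply: eq_bigr => I _; case: (i \in I); case: (j \in I).
Qed.

(** A sum over ordered pairs is four times its average over the random cuts. *)
Lemma cut_average (a : 'I_n -> 'I_n -> R) :
  4 * (\sum_(I : {set 'I_n}) \sum_(i in I) \sum_(j | j \notin I) a i j) =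
  #|{set 'I_n}|%:R * \sum_i \sum_(j | j != i) a i j.
Proof.
have -> : \sum_(I : {set 'I_n}) \sum_(i in I) \sum_(j | j \notin I) a i j =
    \sum_i \sum_j (\sum_(I : {set 'I_n}) ((i \in I) && (j \notin I)))%N%:R * a i j.
  transitivity (\sum_(I : {set 'I_n}) \sum_i \sum_j
      ((i \in I) && (j \notin I))%:R * a i j).
    apply: eq_bigr => I _; rewrite big_mkcond; apply: eq_bigr => i _ /=.
    case: (i \in I) => /=; last by rewrite big1 // => j _; rewrite mul0r.
    rewrite big_mkcond; apply: eq_bigr => j _ /=.
    by case: (j \in I); rewrite /= ?mul0r ?mul1r.
  rewrite exchange_big; apply: eq_bigr => i _ /=.
  rewrite exchange_big; apply: eq_bigr => j _ /=.
  by rewrite natr_sum mulr_suml.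
rewrite !mulr_sumr; apply: eq_bigr => i _.
rewrite !mulr_sumr [RHS]big_mkcond; apply: eq_bigr => j _ /=.
have [->|ji] := eqVneq j i.
  by rewrite big1 ?mul0r ?mulr0 // => I _; rewrite andbN.
have ij : i != j by rewrite eq_sym.
by rewrite -(cut_count ij) natrM mulrA.
Qed.

End RandomCut.

Section Decoupling.
Variables (R : realType) (n d : nat).
Local Notation E := (d.-tuple R).
Implicit Types (v : n.-tuple E) (I : {set 'I_n}) (u : 'cV[R]_n).

(** The signs of the off-diagonal inner products. *)
Definition sign_mx v : 'M[R]_n :=
  \matrix_(i, j) (if i == j then 0 else Num.sg (dotp (tnth v i) (tnth v j))).

(** The trace moment of the bipartite pieces of the sign matrix, averaged over the
  cuts into [I] and its complement. *)
Definition cut_moment p v : R :=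
  #|{set 'I_n}|%:R^-1 * \sum_(I : {set 'I_n}) \tr (gramsum (signv I) I v ^+ p).

(* The bilinear form of the signs across the cut. *)
Let cut_form v I u := \sum_(i in I) u i 0 * dot (signv I i v) u.

Let sum_cut_form v u :
  4 * \sum_(I : {set 'I_n}) cut_form v I u = #|{set 'I_n}|%:R * dot u (sign_mx v *m u).
Proof.
have := cut_average (fun i j => u i 0 * (Num.sg (dotp (tnth v i) (tnth v j)) * u j 0)).
have -> : \sum_(I : {set 'I_n}) \sum_(i in I) \sum_(j | j \notin I)
    u i 0 * (Num.sg (dotp (tnth v i) (tnth v j)) * u j 0) =
    \sum_(I : {set 'I_n}) cut_form v I u.
  apply: eq_bigr => I _; apply: eq_bigr => i _; rewrite dotE mulr_sumr big_mkcond.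
  by apply: eq_bigr => j _ /=; rewrite mxE; case: (j \in I); rewrite ?mul0r ?mulr0.
move=> ->; congr (_ * _); rewrite dotE; apply: eq_bigr => i _.
rewrite mxE mulr_sumr big_mkcond; apply: eq_bigr => j _ /=.
by rewrite mxE eq_sym; case: eqP => //; rewrite mul0r mulr0.
Qed.

Let cut_form_sqr v I u :
  cut_form v I u ^+ 2 <= dot u u * dot u (gramsum (signv I) I v *m u).
Proof.
pose x : 'cV[R]_n := \col_i (if i \in I then u i 0 else 0).
pose y : 'cV[R]_n := \col_i (if i \in I then dot (signv I i v) u else 0).
have -> : cut_form v I u = dot x y.
  rewrite dotE /cut_form big_mkcond; apply: eq_bigr => i _ /=.
  by rewrite !mxE; case: ifP => // _; rewrite mul0r.
have -> : dot u (gramsum (signv I) I v *m u) = dot y y.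
  rewrite /gramsum mulmx_suml [RHS]dotE.
  have -> : dot u (\sum_(i in I) signv I i v *m (signv I i v)^T *m u) =
      \sum_(i in I) dot u (signv I i v *m (signv I i v)^T *m u).
    by rewrite /dot mulmx_sumr summxE.
  rewrite [LHS]big_mkcond; apply: eq_bigr => i _ /=; rewrite !mxE.
  case: ifP => _; last by rewrite mul0r.
  rewrite -mulmxA [_^T *m u]mx11_scalar mul_mx_scalar dotZr.
  by rewrite -[(_^T *m u) 0 0]/(dot _ _) [dot u _]dotC.
apply: le_trans (cauchy_schwarz x y) _; rewrite ler_wpM2r ?dot_ge0 //.
rewrite !dotE; apply: ler_sum => i _; rewrite !mxE.
by case: ifP => // _; rewrite mul0r -expr2 sqr_ge0.
Qed.

(** The quadratic form of the sign matrix is controlled by the bipartite pieces. *)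
Lemma sign_form_moment p v u : (0 < p)%N ->
  `|dot u (sign_mx v *m u)| ^+ (2 * p) <=
  16 ^+ p * cut_moment p v * dot u u ^+ (2 * p).
Proof.
move=> p0; set N : R := #|{set 'I_n}|%:R.
have N0 : 0 < N by rewrite ltr0n; apply/card_gt0P; exists finset.set0.
have Q I : `|cut_form v I u| ^+ (2 * p) <=
    dot u u ^+ (2 * p) * \tr (gramsum (signv I) I v ^+ p).
  rewrite exprM real_normK ?num_real //.
  apply: (@le_trans _ _ ((dot u u * dot u (gramsum (signv I) I v *m u)) ^+ p)).
    rewrite lerXn2r ?cut_form_sqr ?nnegrE ?sqr_ge0 // mulr_ge0 ?dot_ge0 //.
    exact/psd_ge0/psd_gramsum.
  rewrite exprMn mul2n -addnn exprD -mulrA ler_wpM2l ?exprn_ge0 ?dot_ge0 //.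
  exact/psd_pow_le_tr/p0/psd_gramsum.
have -> : dot u (sign_mx v *m u) = 4 / N * \sum_(I : {set 'I_n}) cut_form v I u.
  by rewrite mulrAC sum_cut_form -/N mulrAC divff ?gt_eqF // mul1r.
rewrite normrM exprMn ger0_norm ?divr_ge0 ?(ltW N0) //.
apply: (@le_trans _ _ ((4 / N) ^+ (2 * p) *
   (N ^+ (2 * p).-1 * \sum_(I : {set 'I_n}) `|cut_form v I u| ^+ (2 * p)))).
  rewrite ler_wpM2l ?exprn_ge0 ?divr_ge0 ?(ltW N0) //.
  have pp : (2 * p)%N = (2 * p).-1.+1 by rewrite prednK // muln_gt0.
  apply: (@le_trans _ _ ((\sum_(I : {set 'I_n}) `|cut_form v I u|) ^+ (2 * p))).
    rewrite lerXn2r ?nnegrE ?sumr_ge0 //; exact: ler_norm_sum.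
  by rewrite pp; apply: power_mean.
have -> : (4 / N) ^+ (2 * p) = 16 ^+ p * N^-1 * N ^- (2 * p).-1.
  have -> : (2 * p)%N = (2 * p).-1.+1 by rewrite prednK // muln_gt0.
  rewrite /= exprMn -mulrA; congr (_ * _); last by rewrite exprVn exprS invfM.
  have -> : (2 * p).-1.+1 = (2 * p)%N by rewrite prednK // muln_gt0.
  by rewrite exprM; congr (_ ^+ p); ring.
rewrite -!mulrA mulKf ?expf_neq0 ?gt_eqF //.
rewrite ler_wpM2l ?exprn_ge0 // ler_wpM2l ?invr_ge0 ?(ltW N0) // mulr_suml.
by apply: ler_sum => I _; rewrite mulrC.
Qed.

(** Off the diagonal an adjacency entry is [(1 + sign) / 2], so that the adjacency
  matrix is half of [J - 1 + M] with [J] the all-ones matrix, [M] the sign matrix. *)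
Lemma lambda2_rgg_le p v tau : (1 < n)%N -> (0 < p)%N -> 0 <= tau ->
  (forall i j, i != j -> dotp (tnth v i) (tnth v j) != 0) ->
  16 ^+ p * cut_moment p v <= tau ^+ (2 * p) ->
  `|lambda2 (adjacency R (rgg_adj (tnth v)))| <= (1 + tau) / 2.
Proof.
move=> n1 p0 tau0 tie hp; set A := adjacency _ _.
have Mle u : `|dot u (sign_mx v *m u)| <= tau * dot u u.
  have pp : (0 < 2 * p)%N by rewrite muln_gt0.
  rewrite -(@ler_pXn2r _ (2 * p)) // ?nnegrE ?mulr_ge0 ?dot_ge0 //.
  apply: le_trans (sign_form_moment v u p0) _.
  by rewrite exprMn ler_wpM2r // exprn_ge0 // dot_ge0.
pose one : 'cV[R]_n := const_mx 1.
have AE u : dot u (A *m u) =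
    2^-1 * (dot one u ^+ 2 - dot u u + dot u (sign_mx v *m u)).
  have -> : A = 2^-1 *: (one *m one^T - 1%:M + sign_mx v).
    apply/matrixP => i j; rewrite !mxE big_ord1 !mxE /rgg_adj.
    case: eqVneq => [->|ij] /=; first by rewrite mulr1 subrr addr0 mulr0.
    have := tie i j ij; rewrite subr0 mulr1.
    by case: ltgtP => // h _; [rewrite gtr0_sg|rewrite ltr0_sg] => //=; lra.
  rewrite -scalemxAl dotZr !mulmxDl !dotDr mulNmx mul1mx -mulmxA.
  rewrite [_^T *m u]mx11_scalar mul_mx_scalar dotZr.
  rewrite -[(_^T *m u) 0 0]/(dot one u) [dot u one]dotC expr2.
  by congr (_ * (_ + _ + _)); rewrite -scaleN1r dotZr mulN1r.
have nn : 0 <= (1 + tau) / 2 by rewrite divr_ge0 // addr_ge0.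
apply: lambda2_abs_le => // [|u u1|u].
- exact: adjacency_rgg_sym.
- have := Mle u; rewrite ler_norml AE [dot one u]u1 => /andP[_ h].
  have := dot_ge0 u; rewrite expr0n /=; lra.
- have := Mle u; rewrite ler_norml AE => /andP[h _].
  have := sqr_ge0 (dot one u); lra.
Qed.

End Decoupling.

(** * The probability bound *)

Section Probability.
Variables (R : realType) (n d : nat).
Local Notation E := (d.-tuple R).
Implicit Types (v : n.-tuple E).

Let measurable_dotp_tnth (i j : 'I_n) :
  measurable_fun setT (fun v => dotp (tnth v i) (tnth v j)).
Proof.
apply: measurable_sum => k; apply: measurable_funM.
  exact: (measurableT_comp (measurable_tnth (T := R) k) (measurable_tnth (T := E) i)).
exact: (measurableT_comp (measurable_tnth (T := R) k) (measurable_tnth (T := E) j)).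
Qed.

(** Events about the graph are measurable: there are finitely many graphs. *)
Lemma measurable_graph_event (Q : pred (rel 'I_n)) :
  (forall e1 e2 : rel 'I_n, e1 =2 e2 -> Q e1 = Q e2) ->
  measurable [set v : n.-tuple E | Q (rgg_adj (fun i => tnth v i))].
Proof.
move=> Qext.
pose C (f : {ffun 'I_n * 'I_n -> bool}) : set (n.-tuple E) :=
  \bigcap_(z in [set: 'I_n * 'I_n])
     [set v : n.-tuple E | (0 <= dotp (tnth v z.1) (tnth v z.2)) = f z].
have mC f : measurable (C f).
  apply: fin_bigcap_measurable => // -[i j] _.
  rewrite -[X in measurable X]setTI.
  have := @measurable_fun_ler _ _ _ setT (fun=> 0) _ (@measurable_cst _ _ _ _ _ _)
    (measurable_dotp_tnth i j).
  by move=> /(_ measurableT [set f (i, j)]); apply.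
pose gr (f : {ffun 'I_n * 'I_n -> bool}) : rel 'I_n := fun i j => (i != j) && f (i, j).
have -> : [set v : n.-tuple E | Q (rgg_adj (fun i => tnth v i))] =
    \bigcup_(f in [set f | Q (gr f)]) C f.
  apply/seteqP; split => [v /= Qv|v [f /= Qf Cf]].
    pose f := [ffun z : 'I_n * 'I_n => 0 <= dotp (tnth v z.1) (tnth v z.2)].
    exists f; last by move=> z _ /=; rewrite ffunE.
    by rewrite /= -(Qext (rgg_adj (fun i => tnth v i))) // => i j; rewrite /gr /rgg_adj ffunE.
  rewrite (Qext _ (gr f)) // => i j; rewrite /gr /rgg_adj.
  by have /= -> := Cf (i, j) I.
by apply: fin_bigcup_measurable.
Qed.

Lemma measurable_lambda2_le (b : R) : measurable
  [set v : n.-tuple E | `|lambda2 (adjacency R (rgg_adj (fun i => tnth v i)))| <= b].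
Proof.
apply: (measurable_graph_event (Q := fun e => `|lambda2 (adjacency R e)| <= b)).
move=> e1 e2 e12; have -> // : adjacency R e1 = adjacency R e2.
by apply/matrixP => i j; rewrite !mxE e12.
Qed.

Variables (nu : probability (n.-tuple E) R) (mu : 'I_n -> probability E R).
Hypothesis prod_law : forall A : 'I_n -> set E, (forall i, measurable (A i)) ->
  nu [set v | forall i, A i (tnth v i)] = (\prod_(i < n) mu i (A i))%E.
Hypotheses (mu_inv : forall i, rotation_invariant (mu i)) (d1 : (1 < d)%N).

(* The event that two vectors are orthogonal, where the sign is 0 but the edge is
   present. *)
Let tieset (i j : 'I_n) : set (n.-tuple E) := [set v | dotp (tnth v i) (tnth v j) = 0].

Let measurable_tieset i j : measurable (tieset i j).
Proof.
rewrite -[X in measurable X]setTI; have := measurable_dotp_tnth i j.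
by move=> /(_ measurableT [set 0]); apply; exact: measurable_set1.
Qed.

Let null_tieset (i j : 'I_n) : i != j -> nu (tieset i j) = 0%E.
Proof.
move=> ij; have ji : j != i by rewrite eq_sym.
suff h : Ex nu (\1_(tieset i j)) = 0.
  have := Ex_indic nu (measurable_tieset i j); rewrite h => /esym e.
  by rewrite -[LHS]fineK ?e // fin_num_measure.
pose Z := [set v : n.-tuple E | dotp (tnth v j) (tnth v j) = 0].
have mZ : measurable Z.
  rewrite -[X in measurable X]setTI; have := measurable_dotp_tnth j j.
  by move=> /(_ measurableT [set 0]); apply; exact: measurable_set1.
have bi : bmeas (\1_(tieset i j) : _ -> R) by exact: bmeas_indic.
have bZ : bmeas (\1_Z : _ -> R) by exact: bmeas_indic.
(* Draw v_i afresh: a tie has probability 0 unless v_j = 0. *)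
have le1 : Ex nu (\1_(tieset i j)) <= Ex nu (\1_Z).
  rewrite (resample prod_law i bi); apply: le_Ex => // [|v].
    exact: bmeas_resample.
  have [v0|v0] := eqVneq (dotp (tnth v j) (tnth v j)) 0.
    rewrite [X in _ <= X]indicE mem_set // -[leRHS](Ex_cst (mu i) 1).
    apply: le_Ex => [||x]; [exact: bmeas_updr|exact: bmeas_cst|].
    by rewrite indicE; case: (_ \in _); rewrite ?ler01.
  rewrite [X in X <= _](_ : _ = Ex (mu i) (\1_[set x : E | dotp x (tnth v j) = 0])).
    rewrite Ex_indic; last exact: measurable_dotp_eq0.
    by rewrite (tie_null (mu_inv i) d1 v0) /= indicE.
  apply: eq_Ex => x; rewrite !indicE; congr ((nat_of_bool _)%:R).
  by apply/idP/idP; rewrite !inE /tieset /= tnth_upd_eq tnth_upd_neq.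
apply/eqP; rewrite eq_le Ex_ge0 ?andbT; last by move=> v; rewrite indicE.
apply: le_trans le1 _.
rewrite (resample prod_law j bZ) -[leRHS](Ex_cst nu 0).
apply: le_Ex => [||v]; [exact: bmeas_resample|exact: bmeas_cst|].
rewrite [X in X <= _](_ : _ = Ex (mu j) (\1_[set x : E | dotp x x = 0])).
  rewrite Ex_indic; last exact: measurable_dotp2_eq0.
  by rewrite (proj1 (mu_inv j)).
apply: eq_Ex => x; rewrite !indicE; congr ((nat_of_bool _)%:R).
by apply/idP/idP; rewrite !inE /Z /= tnth_upd_eq.
Qed.

Lemma cut_moment_le p : (0 < p)%N ->
  bmeas (@cut_moment R n d p) /\
  Ex nu (cut_moment p) <= n%:R ^+ 2 * (8 * n%:R * (p%:R + n%:R / d%:R)) ^+ p.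
Proof.
move=> p0; have bt (I : {set 'I_n}) :
    bmeas (fun v => \tr (gramsum (signv I) I v ^+ p)).
  apply/bmeas_mxtrace/mbmeasX/mbmeas_gramsum => i j z.
  have -> : (fun v => signv I i v j z) = (fun v => if j \in I then 0 else
      Num.sg (dotp (tnth v i) (tnth v j))) by apply/funext => v; rewrite mxE.
  case: (j \in I); first exact: bmeas_cst.
  by apply: bmeas_sg; exact: measurable_dotp_tnth.
have bs : bmeas (fun v => \sum_(I : {set 'I_n}) \tr (gramsum (signv I) I v ^+ p)).
  by apply: bmeas_sum => I _; exact: bt.
split; first exact: bmeasZ.
rewrite /cut_moment ExZ // Ex_sum; last by move=> I _; exact: bt.
rewrite mulrC ler_pdivrMr; last first.
  by rewrite ltr0n; apply/card_gt0P; exists finset.set0.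
apply: (@le_trans _ _ (\sum_(I : {set 'I_n})
  (n%:R ^+ 2 * (8 * n%:R * (p%:R + n%:R / d%:R)) ^+ p : R)));
  last by rewrite sumr_const [leRHS]mulr_natr.
apply: ler_sum => I _; exact: (sign_moment prod_law mu_inv d1 I p0).
Qed.

(** Markov's inequality for the moment of the cuts, off the null event of a tie. *)
Lemma lambda2_probability p (tau bound : R) : (1 < n)%N -> (0 < p)%N -> 0 < tau ->
  (1 + tau) / 2 <= bound ->
  ((1 - 16 ^+ p * (n%:R ^+ 2 * (8 * n%:R * (p%:R + n%:R / d%:R)) ^+ p) /
     tau ^+ (2 * p))%:E <=
   nu [set v : n.-tuple E | (`|lambda2 (adjacency R (rgg_adj (fun i => tnth v i)))| <= bound)%R])%E.
Proof.
move=> n1 p0 tau0 hb; set B := n%:R ^+ 2 * _.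
have [bX EX] := cut_moment_le p0.
pose good := [set v : n.-tuple E | `|lambda2 (adjacency R (rgg_adj (fun i => tnth v i)))| <= bound].
have mgood : measurable good by exact: measurable_lambda2_le.
have t0 : 0 < tau ^+ (2 * p) by rewrite exprn_gt0.
rewrite -/good.
have -> : nu good = (fine (nu good))%:E by rewrite fineK // fin_num_measure.
rewrite lee_fin -(Ex_indic nu mgood) lerBlDr -lerBlDl.
pose N : set (n.-tuple E) := \bigcup_(z in [set z : 'I_n * 'I_n | z.1 != z.2]) tieset z.1 z.2.
have mN : measurable N by apply: fin_bigcup_measurable => // z _; exact: measurable_tieset.
have N0 : nu N = 0%E.
  have : nu.-negligible N.
    pose F k := if unpickle k is Some (i, j) then
      (if i != j :> 'I_n then tieset i j else set0) else set0.
    apply: (@negligibleS _ _ _ _ (\bigcup_k F k)).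
      move=> v [[i j] /= ij h]; exists (pickle (i, j)) => //.
      by rewrite /F pickleK ij.
    apply: negligible_bigcup => k; rewrite /F.
    case: (unpickle k) => [[i j]|]; last exact: negligible_set0.
    case: ifPn => ij; last exact: negligible_set0.
    by apply/negligibleP; [exact: measurable_tieset|exact: null_tieset].
  by move/negligibleP; apply.
have bg : bmeas (\1_good : _ -> R) by exact: bmeas_indic.
have bN : bmeas (\1_N : _ -> R) by exact: bmeas_indic.
have bY : bmeas (fun v => 16 ^+ p / tau ^+ (2 * p) * cut_moment p v) by exact: bmeasZ.
rewrite -[X in X - _](Ex_cst nu 1) -ExB //; last exact: bmeas_cst.
apply: (@le_trans _ _ (Ex nu (fun v =>
   16 ^+ p / tau ^+ (2 * p) * cut_moment p v + \1_N v))); last first.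
  rewrite ExD // ExZ // Ex_indic // N0 addr0 [leRHS]mulrAC.
  by apply: ler_wpM2l EX; rewrite divr_ge0 ?exprn_ge0 // ltW.
have X0 v : 0 <= cut_moment p v.
  rewrite mulr_ge0 ?invr_ge0 // sumr_ge0 // => I _.
  exact/psd_tr_ge0/psdX/psd_gramsum.
apply: le_Ex => [||v].
- by apply: bmeasB => //; exact: bmeas_cst.
- exact: bmeasD.
have Y0 : 0 <= 16 ^+ p / tau ^+ (2 * p) * cut_moment p v.
  by rewrite mulr_ge0 // divr_ge0 ?exprn_ge0 // ltW.
have [vN|vN] := pselect (N v).
  rewrite [X in _ <= _ + X]indicE mem_set // mulr1n.
  have : 0 <= \1_good v :> R by rewrite indicE.
  by move: Y0; lra.
rewrite [X in _ <= _ + X]indicE memNset // addr0.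
have [h|h] := leP (16 ^+ p * cut_moment p v) (tau ^+ (2 * p)).
  rewrite indicE mem_set ?subrr //.
  apply: le_trans hb; apply: (lambda2_rgg_le n1 p0 (ltW tau0) _ h) => i j ij.
  by apply/eqP => h0; apply: vN; exists (i, j).
apply: (@le_trans _ _ 1); first by rewrite gerBl indicE.
by rewrite mulrAC ler_pdivlMr // mul1r ltW.
Qed.

End Probability.

Section Sample.
Variables (R : realType) (disp : measure_display) (T : measurableType disp).
Variables (P : probability T R) (n d : nat) (V : 'I_n -> {RV P >-> d.-tuple R}).

(** The whole sample, as a random element of the space of n-tuples. *)
Definition sample (w : T) : n.-tuple (d.-tuple R) := [tuple V i w | i < n].

Let measurable_sample : measurable_fun setT sample.
Proof.
apply/measurable_fun_tnthP => i.
rewrite (_ : _ \o sample = V i); first exact: measurable_funPT.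
by apply/funext => w; rewrite /= tnth_mktuple.
Qed.

HB.instance Definition _ := isMeasurableFun.Build _ _ _ _ sample measurable_sample.

Hypothesis law : rgg_sphere V \/ rgg_gaussian V.

(** Either law is rotation invariant, so that the moment bound applies to the sample.
  The factor 128 is 16 from the decoupling times 8 from the sign moment. *)
Lemma rgg_lambda2_probability p (tau : R) : (1 < n)%N -> (1 < d)%N -> (0 < p)%N ->
  1 <= tau ->
  measurable [set w | `|rgg_lambda2 V w| <= tau] /\
  ((1 - n%:R ^+ 2 * (128 * n%:R * (p%:R + n%:R / d%:R) / tau ^+ 2) ^+ p)%:E <=
   P [set w | (`|rgg_lambda2 V w| <= tau)%R])%E.
Proof.
move=> n1 d1 p0 tau1.
pose nu := distribution P (sample : {RV P >-> n.-tuple (d.-tuple R)}).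
pose mu i := distribution P (V i).
have prod_law : forall A : 'I_n -> set (d.-tuple R), (forall i, measurable (A i)) ->
    nu [set v | forall i, A i (tnth v i)] = (\prod_(i < n) mu i (A i))%E.
  move=> A mA; have ind : independent V by case: law => -[].
  rewrite -[RHS](ind A mA) /nu /distribution /pushforward /=; congr (P _).
  apply/seteqP; split => w /= h i; first by have := h i; rewrite tnth_mktuple.
  by rewrite tnth_mktuple.
have mu_inv i : rotation_invariant (mu i).
  case: law => -[_ /(_ i)]; first exact: uniform_sphere_rotation_invariant.
  by apply: gaussian_rotation_invariant; exact: ltnW.
have -> : [set w | `|rgg_lambda2 V w| <= tau] = sample @^-1`
    [set v : n.-tuple (d.-tuple R) |
      `|lambda2 (adjacency R (rgg_adj (fun i => tnth v i)))| <= tau].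
  apply/funext => w; rewrite /rgg_lambda2 /=.
  rewrite (_ : (fun i => tnth (sample w) i) = (fun i => V i w)) //.
  by apply/funext => i; rewrite tnth_mktuple.
split.
  rewrite -[X in measurable X]setTI; apply: measurable_sample => //.
  exact: measurable_lambda2_le.
have tau0 : 0 < tau by apply: lt_le_trans tau1.
(* As tau is at least 1, the bound (1 + tau) / 2 on lambda2 is at most tau. *)
have tauh : (1 + tau) / 2 <= tau by lra.
apply: le_trans (lambda2_probability prod_law mu_inv d1 n1 p0 tau0 tauh).
rewrite lee_fin lerD2l lerN2.
rewrite le_eqVlt; apply/orP; left; apply/eqP.
set a := 8 * _ * _; set N := _ ^+ 2.
rewrite [16 ^+ p * _]mulrCA -exprMn exprM -[LHS]mulrA -expr_div_n.
by congr (_ * _ ^+ _); rewrite /a; ring.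
Qed.

End Sample.

(** * Choice of the moment *)

Section Asymptotics.
Variables (R : realType).

(** A base of [e^-3] to a power at least [ln n] beats the dimensional factor [n^2]. *)
Lemma error_le n p (r : R) : (0 < n)%N -> ln n%:R <= p%:R :> R -> 0 <= r ->
  r <= expR (- 3) -> n%:R ^+ 2 * r ^+ p <= n%:R^-1.
Proof.
move=> n0 lp r0 rle; have N0 : 0 < n%:R :> R by rewrite ltr0n.
have e3 : n%:R ^- 3 = expR (- (3%:R * ln n%:R)) :> R by rewrite expRN expRM_natl lnK.
have h : r ^+ p <= n%:R ^- 3.
  apply: (@le_trans _ _ (expR (- 3) ^+ p)); first by rewrite lerXn2r // nnegrE expR_ge0.
  by rewrite -expRM_natl e3 ler_expR; lra.
apply: le_trans (ler_wpM2l _ h) _; first exact: exprn_ge0.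
by rewrite (_ : _ * _ = n%:R^-1) //; field; rewrite gt_eqF.
Qed.

Lemma near_ln_ge (M : R) : \forall n \near \oo, M <= ln n%:R.
Proof.
near=> n; have h : expR M <= n%:R by near: n; exact: nbhs_infty_ger.
by rewrite -ler_expR lnK // posrE; apply: lt_le_trans h; exact: expR_gt0.
Unshelve. all: by end_near. Qed.

(** In the regime [d <= n (ln n)^8] the base of the error is at most [e^-3]: one power
  of [l = ln n] absorbs the numerical constants. *)
Lemma base_le_dense (N D p l : R) : 0 < N -> 0 < D -> 0 <= p -> 1 <= l ->
  512 * expR 3 <= l -> p <= l + 1 -> D <= N * l ^+ 8 ->
  128 * N * (p + N / D) / (N * l ^+ 10 / Num.sqrt D) ^+ 2 <= expR (- 3).
Proof.
move=> N0 D0 p0 l1 lM pl DN; have l0 : 0 < l by lra.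
have -> : (N * l ^+ 10 / Num.sqrt D) ^+ 2 = N ^+ 2 * l ^+ 20 / D.
  by rewrite expr_div_n sqr_sqrtr ?ltW // exprMn -exprM.
have -> : 128 * N * (p + N / D) / (N ^+ 2 * l ^+ 20 / D) =
    128 * (p * (D / N) + 1) / l ^+ 20 by field; rewrite !gt_eqF.
have DN8 : D / N <= l ^+ 8 by rewrite ler_pdivrMr // mulrC.
have DN0 : 0 <= D / N by rewrite divr_ge0 ?ltW.
have l9 : 1 <= l ^+ 9 by exact: exprn_ege1.
rewrite expRN ler_pdivrMr ?exprn_gt0 // ler_pdivlMl ?expR_gt0 //.
have h : p * (D / N) <= 2 * l ^+ 9.
  by rewrite exprS [leRHS]mulrA; apply: ler_pM => //; lra.
apply: (@le_trans _ _ (l * l ^+ 9)); last first.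
  by rewrite -exprS; apply: ler_weXn2l.
apply: le_trans (ler_wpM2r _ lM); last by rewrite exprn_ge0 // ltW.
rewrite [512 * _]mulrC -[leRHS]mulrA ler_wpM2l ?expR_ge0 //; lra.
Qed.

(** The same in the regime [n (ln n)^8 <= d]. *)
Lemma base_le_sparse (N D p l : R) : 0 < N -> 0 < D -> 0 <= p -> 1 <= l ->
  512 * expR 3 <= l -> p <= l + 1 -> N * l ^+ 8 <= D ->
  128 * N * (p + N / D) / (l ^+ 10 * Num.sqrt N) ^+ 2 <= expR (- 3).
Proof.
move=> N0 D0 p0 l1 lM pl DN; have l0 : 0 < l by lra.
have -> : (l ^+ 10 * Num.sqrt N) ^+ 2 = l ^+ 20 * N.
  by rewrite exprMn sqr_sqrtr ?ltW // -exprM.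
have -> : 128 * N * (p + N / D) / (l ^+ 20 * N) =
    128 * (p + N / D) / l ^+ 20 by field; rewrite !gt_eqF.
have ND1 : N / D <= 1.
  rewrite ler_pdivrMr // mul1r; apply: le_trans DN.
  by rewrite ler_peMr ?exprn_ege1 // ltW.
rewrite expRN ler_pdivrMr ?exprn_gt0 // ler_pdivlMl ?expR_gt0 //.
apply: (@le_trans _ _ (l * l)); last by rewrite -expr2; apply: ler_weXn2l.
apply: le_trans (ler_wpM2r _ lM); last exact: ltW.
rewrite [512 * _]mulrC -[leRHS]mulrA ler_wpM2l ?expR_ge0 //; lra.
Qed.

Variables (disp : nat -> measure_display) (T : forall n, measurableType (disp n)).
Variables (P : forall n, probability (T n) R).

Lemma whp_of_error (E : forall n, set (T n)) :
  (\forall n \near \oo, measurable (E n) /\ ((1 - n%:R^-1)%:E <= P n (E n))%E) ->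
  whp P E.
Proof.
move=> h; apply: (@squeeze_cvge _ _ _ _ (fun n => (1 - n%:R^-1)%:E) _ (fun=> 1%E)).
- by apply: filterS h => n [mE ->]; rewrite probability_le1.
- apply: cvg_EFin; first exact: nearW.
  rewrite -[X in _ --> X]subr0; apply: cvgB; first exact: cvg_cst.
  apply/gtr0_cvgV0; last exact: cvgr_idn.
  by exists 1%N => // n /= n0; rewrite ltr0n.
- exact: cvg_cst.
Qed.

End Asymptotics.

Theorem theorem1p9 (R : realType) (gamma : R) (d : nat -> nat)
    (disp : nat -> measure_display) (T : forall n, measurableType (disp n))
    (P : forall n, probability (T n) R)
    (V : forall n, 'I_n -> {RV (P n) >-> (d n).-tuple R}) :
  0 < gamma ->
  (\forall n \near \oo, n%:R `^ gamma <= (d n)%:R) ->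
  (forall n, rgg_sphere (V n)) \/ (forall n, rgg_gaussian (V n)) ->
  ((\forall n \near \oo, (d n)%:R <= n%:R * ln n%:R ^+ 8 :> R) ->
    whp P (fun n => [set w | `|rgg_lambda2 (V n) w|
                      <= n%:R * ln n%:R ^+ 10 / Num.sqrt (d n)%:R])) /\
  ((\forall n \near \oo, n%:R * ln n%:R ^+ 8 <= (d n)%:R :> R) ->
    whp P (fun n => [set w | `|rgg_lambda2 (V n) w|
                      <= ln n%:R ^+ 10 * Num.sqrt n%:R])).
Proof.
move=> gamma0 dn laws.
have law n : rgg_sphere (V n) \/ rgg_gaussian (V n).
  by case: laws => h; [left|right].
(* The moment p satisfies ln n <= p <= ln n + 1. *)
pose p n := (Num.truncn (ln n%:R : R)).+1.
have large : \forall n \near \oo, [/\ (1 < n)%N, (1 < d n)%N,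
    512 * expR 3 <= ln n%:R :> R & 1 <= ln n%:R :> R].
  near=> n; have n1 : (1 < n)%N by near: n; exact: nbhs_infty_gt.
  split=> //; try by near: n; exact: near_ln_ge.
  have : n%:R `^ gamma <= (d n)%:R by near: n.
  rewrite -(ltr1n R); apply: lt_le_trans.
  by rewrite /powR pnatr_eq0 gtn_eqF ?(ltnW n1) // expR_gt1 mulr_gt0 // ln_gt0 // ltr1n.
have pP n : 1 <= ln n%:R :> R -> ln n%:R <= (p n)%:R :> R /\ (p n)%:R <= ln n%:R + 1 :> R.
  move=> l1; have /truncn_itv/andP[a b] : 0 <= ln n%:R :> R by lra.
  by split; [exact: ltW|rewrite -natr1 lerD2r].
split=> reg; apply: whp_of_error; near=> n;
  have [n1 d1 lM l1] : [/\ (1 < n)%N, (1 < d n)%N,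
    512 * expR 3 <= ln n%:R :> R & 1 <= ln n%:R :> R] by near: n.
- have [lp pl] := pP n l1.
  have N0 : 0 < n%:R :> R by rewrite ltr0n ltnW.
  have D0 : 0 < (d n)%:R :> R by rewrite ltr0n ltnW.
  have dn8 : (d n)%:R <= n%:R * ln n%:R ^+ 8 :> R by near: n.
  set tau := _ / _.
  have tau1 : 1 <= tau.
    rewrite ler_pdivlMr ?sqrtr_gt0 // mul1r -(@ler_pXn2r _ 2) ?nnegrE ?sqrtr_ge0 //;
      last by rewrite mulr_ge0 ?exprn_ge0 // ltW // (lt_le_trans _ l1).
    rewrite sqr_sqrtr ?(ltW D0) //; apply: le_trans dn8 _; rewrite exprMn -exprM.
    apply: ler_pM => //; first by rewrite exprn_ge0 // (le_trans _ l1).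
      by apply: ler_eXnr => //; rewrite ler1n ltnW.
    exact: ler_weXn2l.
  have [mE hE] := rgg_lambda2_probability (law n) n1 d1 (ltn0Sn _ : 0 < p n)%N tau1.
  split=> //; apply: le_trans hE; rewrite lee_fin lerD2l lerN2.
  apply: error_le => //; first exact: ltnW.
    by rewrite divr_ge0 ?sqr_ge0 // !mulr_ge0 // addr_ge0 // divr_ge0.
  exact: base_le_dense.
- have [lp pl] := pP n l1.
  have N0 : 0 < n%:R :> R by rewrite ltr0n ltnW.
  have D0 : 0 < (d n)%:R :> R by rewrite ltr0n ltnW.
  have dn8 : n%:R * ln n%:R ^+ 8 <= (d n)%:R :> R by near: n.
  set tau := _ * Num.sqrt _.
  have tau1 : 1 <= tau.
    rewrite mulr_ege1 ?exprn_ege1 // -[leLHS]sqrtr1 ler_wsqrtr //.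
    by rewrite ler1n ltnW.
  have [mE hE] := rgg_lambda2_probability (law n) n1 d1 (ltn0Sn _ : 0 < p n)%N tau1.
  split=> //; apply: le_trans hE; rewrite lee_fin lerD2l lerN2.
  apply: error_le => //; first exact: ltnW.
    by rewrite divr_ge0 ?sqr_ge0 // !mulr_ge0 // addr_ge0 // divr_ge0.
  exact: base_le_sparse.
Unshelve. all: by end_near. Qed.
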